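(* There exists a nonzero rational additively symmetric monoidal $1$-category, with all objects dualizable, whose (additive) algebraic $K$-theory is rational.
   Context: A rational additively symmetric monoidal $1$-category is an ordinary $\mathbb Q$-linear additive category with a symmetric monoidal structure whose tensor product is additive in each variable. Its additive algebraic $K$-theory is the (connective) spectrum obtained as the group completion of its groupoid core under direct sum; a spectrum is rational if all its homotopy groups are $\mathbb Q$-vector spaces. *)

(* Defs.v *)
From mathcomp Require Import all_boot all_order all_algebra.
From mathcomp Require Import boolp.

Set Implicit Arguments.
Unset Strict Implicit.
Unset Printing Implicit Defensive.

Import GRing.Theory.
Local Open Scope ring_scope.

(** * Rational additive symmetric monoidal categories *)

Record rat_linear_category := RatLinearCategory {
  ob :> Type;
  mor : ob -> ob -> lmodType rat;
  idm : forall x, mor x x;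
  compm : forall x y z, mor y z -> mor x y -> mor x z;
  comp_idl : forall x y (f : mor x y), compm (idm y) f = f;
  comp_idr : forall x y (f : mor x y), compm f (idm x) = f;
  comp_assoc : forall w x y z (h : mor y z) (g : mor x y) (f : mor w x),
    compm h (compm g f) = compm (compm h g) f;
  comp_linear_l : forall x y z (a : rat) (g g' : mor y z) (f : mor x y),
    compm (a *: g + g') f = a *: compm g f + compm g' f;
  comp_linear_r : forall x y z (a : rat) (g : mor y z) (f f' : mor x y),
    compm g (a *: f + f') = a *: compm g f + compm g f' }.

Arguments mor {r} x y : rename.
Arguments idm {r} x : rename.
Arguments compm {r x y z} g f : rename.

Declare Scope cat_scope.
Delimit Scope cat_scope with cat.
Notation "g \oc f" := (compm g f) (at level 40, left associativity) : cat_scope.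
Local Open Scope cat_scope.

Definition is_zero_object (C : rat_linear_category) (z : C) : Prop :=
  (forall (y : C) (f : mor z y), f = 0) /\ (forall (y : C) (f : mor y z), f = 0).

Definition is_iso (C : rat_linear_category) (x y : C) (f : mor x y) : Prop :=
  exists g : mor y x, g \oc f = idm x /\ f \oc g = idm y.

Definition is_coproduct (C : rat_linear_category) (x y s : C)
    (i : mor x s) (j : mor y s) : Prop :=
  forall (z : C) (f : mor x z) (g : mor y z),
    exists! h : mor s z, h \oc i = f /\ h \oc j = g.

Record rat_additive_category := RatAdditiveCategory {
  rac_linear :> rat_linear_category;
  zero_ob : rac_linear;
  zero_obP : is_zero_object zero_ob;
  dsum : rac_linear -> rac_linear -> rac_linear;
  inl_ : forall x y, mor x (dsum x y);
  inr_ : forall x y, mor y (dsum x y);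
  prl_ : forall x y, mor (dsum x y) x;
  prr_ : forall x y, mor (dsum x y) y;
  prl_inl : forall x y, prl_ x y \oc inl_ x y = idm x;
  prr_inr : forall x y, prr_ x y \oc inr_ x y = idm y;
  prl_inr : forall x y, prl_ x y \oc inr_ x y = 0;
  prr_inl : forall x y, prr_ x y \oc inl_ x y = 0;
  dsum_id : forall x y,
    inl_ x y \oc prl_ x y + inr_ x y \oc prr_ x y = idm (dsum x y) }.

(* The tensor product is additive in each variable; additive maps of
   Q-vector spaces are Q-linear, so it is automatically Q-bilinear on
   morphisms, and it preserves zero objects and direct sums. *)
Record rat_additive_sym_monoidal_category := RatAdditiveSymMonoidalCategory {
  rasm_additive :> rat_additive_category;
  tens : rasm_additive -> rasm_additive -> rasm_additive;
  tensm : forall x x' y y' : rasm_additive,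
    mor x x' -> mor y y' -> mor (tens x y) (tens x' y');
  tensm_id : forall x y, tensm (idm x) (idm y) = idm (tens x y);
  tensm_comp : forall (x x' x'' y y' y'' : rasm_additive)
      (f' : mor x' x'') (f : mor x x') (g' : mor y' y'') (g : mor y y'),
    tensm (f' \oc f) (g' \oc g) = tensm f' g' \oc tensm f g;
  tensm_addl : forall (x x' y y' : rasm_additive)
      (f f' : mor x x') (g : mor y y'),
    tensm (f + f') g = tensm f g + tensm f' g;
  tensm_addr : forall (x x' y y' : rasm_additive)
      (f : mor x x') (g g' : mor y y'),
    tensm f (g + g') = tensm f g + tensm f g';
  unit_ob : rasm_additive;
  assoc : forall x y z, mor (tens (tens x y) z) (tens x (tens y z));
  associ : forall x y z, mor (tens x (tens y z)) (tens (tens x y) z);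
  lunit : forall x, mor (tens unit_ob x) x;
  runit : forall x, mor (tens x unit_ob) x;
  braid : forall x y, mor (tens x y) (tens y x);
  assocK : forall x y z, associ x y z \oc assoc x y z = idm _;
  associK : forall x y z, assoc x y z \oc associ x y z = idm _;
  lunit_iso : forall x, is_iso (lunit x);
  runit_iso : forall x, is_iso (runit x);
  braidK : forall x y, braid y x \oc braid x y = idm _;
  assoc_nat : forall (x x' y y' z z' : rasm_additive)
      (f : mor x x') (g : mor y y') (h : mor z z'),
    assoc x' y' z' \oc tensm (tensm f g) h
    = tensm f (tensm g h) \oc assoc x y z;
  lunit_nat : forall (x x' : rasm_additive) (f : mor x x'),
    lunit x' \oc tensm (idm unit_ob) f = f \oc lunit x;
  runit_nat : forall (x x' : rasm_additive) (f : mor x x'),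
    runit x' \oc tensm f (idm unit_ob) = f \oc runit x;
  braid_nat : forall (x x' y y' : rasm_additive) (f : mor x x') (g : mor y y'),
    braid x' y' \oc tensm f g = tensm g f \oc braid x y;
  pentagon : forall w x y z,
    assoc w x (tens y z) \oc assoc (tens w x) y z
    = tensm (idm w) (assoc x y z) \oc assoc w (tens x y) z
      \oc tensm (assoc w x y) (idm z);
  triangle : forall x y,
    tensm (idm x) (lunit y) \oc assoc x unit_ob y = tensm (runit x) (idm y);
  hexagon : forall x y z,
    assoc y z x \oc braid x (tens y z) \oc assoc x y z
    = tensm (idm y) (braid x z) \oc assoc y x z \oc tensm (braid x y) (idm z) }.

Arguments tens {r} x y : rename.
Arguments tensm {r x x' y y'} f g : rename.
Arguments unit_ob r : rename.
Arguments assoc {r} x y z : rename.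
Arguments associ {r} x y z : rename.
Arguments lunit {r} x : rename.
Arguments runit {r} x : rename.
Arguments braid {r} x y : rename.

Definition nonzero_category (C : rat_linear_category) : Prop :=
  exists x : C, ~ is_zero_object x.

Definition dualizable (C : rat_additive_sym_monoidal_category) (x : C) : Prop :=
  exists (y : C) (ev : mor (tens y x) (unit_ob C))
         (coev : mor (unit_ob C) (tens x y)),
    runit x \oc tensm (idm x) ev \oc assoc x y x \oc tensm coev (idm x)
      = lunit x
    /\ lunit y \oc tensm ev (idm y) \oc associ y x y \oc tensm (idm y) coev
      = runit y.

(** * Simplicial sets *)

Definition monotone m n (f : {ffun 'I_m.+1 -> 'I_n.+1}) : bool :=
  [forall i : 'I_m.+1, forall j : 'I_m.+1, (i <= j)%N ==> (f i <= f j)%N].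

(* [delta m n] is the set of morphisms [m] -> [n] of the simplex category. *)
Definition delta m n := {f : {ffun 'I_m.+1 -> 'I_n.+1} | monotone f}.
Definition dfun m n (f : delta m n) : 'I_m.+1 -> 'I_n.+1 := val f.
Coercion dfun : delta >-> Funclass.

Lemma delta_mono m n (f : delta m n) (i j : 'I_m.+1) :
  (i <= j)%N -> (f i <= f j)%N.
Proof. by move=> ij; have /forallP/(_ i)/forallP/(_ j)/implyP := valP f; apply. Qed.

Lemma deltaP m n (f g : delta m n) : f =1 g -> f = g.
Proof. by move=> fg; apply/val_inj/ffunP => i; apply: fg. Qed.

Definition mk_delta m n (f : 'I_m.+1 -> 'I_n.+1)
  (hf : forall i j : 'I_m.+1, (i <= j)%N -> (f i <= f j)%N) : delta m n.
Proof.
exists (finfun f); apply/forallP => i; apply/forallP => j; apply/implyP => ij.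
by rewrite !ffunE; apply: hf.
Defined.

Lemma mk_deltaE m n (f : 'I_m.+1 -> 'I_n.+1) hf i : @mk_delta m n f hf i = f i.
Proof. by rewrite /mk_delta /dfun /= ffunE. Qed.

Definition delta_id n : delta n n := @mk_delta n n id (fun i j h => h).

Definition delta_comp l m n (f : delta m n) (g : delta l m) : delta l n :=
  @mk_delta l n (fun i => f (g i))
    (fun i j h => delta_mono f (delta_mono g h)).

Lemma lift_mono n (k : 'I_n.+2) (i j : 'I_n.+1) :
  (i <= j)%N -> (lift k i <= lift k j)%N.
Proof. by move=> ij; rewrite /= leq_bump2. Qed.

Definition coface n (k : 'I_n.+2) : delta n n.+1 := mk_delta (@lift_mono n k).

Definition delta_const m : delta m 0 :=
  @mk_delta m 0 (fun=> ord0) (fun i j h => leqnn 0).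

Record sset := SSet {
  simplex :> nat -> Type;
  smap : forall m n, delta m n -> simplex n -> simplex m;
  smap_id : forall n (x : simplex n), smap (delta_id n) x = x;
  smap_comp : forall l m n (f : delta m n) (g : delta l m) (x : simplex n),
    smap (delta_comp f g) x = smap g (smap f x) }.

Arguments smap {s m n} f x : rename.

Record sset_map (X Y : sset) := SSetMap {
  sfun :> forall n, X n -> Y n;
  sfun_nat : forall m n (f : delta m n) (x : X n),
    sfun (smap f x) = smap f (sfun x) }.

Arguments sfun {X Y} s {n} x : rename.

Definition face (X : sset) n (k : 'I_n.+2) (x : X n.+1) : X n :=
  smap (coface k) x.

(* [base x0 n] is the totally degenerate n-simplex on the vertex x0. *)
Definition base (X : sset) (x0 : X 0) n : X n := smap (delta_const n) x0.

Lemma delta_comp_id l n (g : delta l n) : delta_comp g (delta_id l) = g.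
Proof. by apply: deltaP => i; rewrite !mk_deltaE. Qed.

Lemma delta_compA k l m n (f : delta m n) (g : delta l m) (h : delta k l) :
  delta_comp f (delta_comp g h) = delta_comp (delta_comp f g) h.
Proof. by apply: deltaP => i; rewrite !mk_deltaE. Qed.

Definition std_simplex (n : nat) : sset :=
  @SSet (fun m => delta m n) (fun _ _ f x => delta_comp x f)
    (fun _ x => delta_comp_id x) (fun _ _ _ f g x => delta_compA x f g).

Definition in_horn n (k : 'I_n.+1) m (f : delta m n) : bool :=
  [exists j : 'I_n.+1, (j != k) && [forall i, f i != j]].

Lemma in_horn_comp n (k : 'I_n.+1) l m (f : delta m n) (g : delta l m) :
  in_horn k f -> in_horn k (delta_comp f g).
Proof.
move=> /existsP[j /andP[jk /forallP fj]]; apply/existsP; exists j.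
by rewrite jk /=; apply/forallP => i; rewrite mk_deltaE.
Qed.

Definition horn_map n (k : 'I_n.+1) l m (g : delta l m)
    (x : {f : delta m n | in_horn k f}) : {f : delta l n | in_horn k f} :=
  exist _ (delta_comp (val x) g) (in_horn_comp g (valP x)).

Definition horn n (k : 'I_n.+1) : sset.
Proof.
refine (@SSet (fun m => {f : delta m n | in_horn k f})
  (fun _ _ g x => horn_map g x) _ _).
- by move=> m x; apply: val_inj; apply: delta_comp_id.
- by move=> l m p f g x; apply: val_inj; apply: delta_compA.
Defined.

Definition horn_incl n (k : 'I_n.+1) : sset_map (horn k) (std_simplex n) :=
  @SSetMap (horn k) (std_simplex n) (fun m x => val x) (fun _ _ _ _ => erefl).

Definition has_lift (A B X Y : sset) (i : sset_map A B) (p : sset_map X Y) : Prop :=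
  forall (u : sset_map A X) (v : sset_map B Y),
    (forall n (a : A n), p n (u n a) = v n (i n a)) ->
    exists w : sset_map B X,
      (forall n (a : A n), w n (i n a) = u n a) /\
      (forall n (b : B n), p n (w n b) = v n b).

Definition kan_fibration (X Y : sset) (p : sset_map X Y) : Prop :=
  forall n (k : 'I_n.+2), has_lift (horn_incl k) p.

Definition kan_complex (Y : sset) : Prop :=
  forall n (k : 'I_n.+2) (u : sset_map (horn k) Y),
    exists w : sset_map (std_simplex n.+1) Y,
      forall m (a : horn k m), w m (horn_incl k m a) = u m a.

(* The trivial cofibrations are the maps with the left lifting property
   against all Kan fibrations. *)
Definition trivial_cofibration (A B : sset) (i : sset_map A B) : Prop :=
  forall (X Y : sset) (p : sset_map X Y), kan_fibration p -> has_lift i p.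

Definition fibrant_replacement (X Y : sset) (i : sset_map X Y) : Prop :=
  trivial_cofibration i /\ kan_complex Y.

(** * Homotopy groups *)

(* The elements of pi_{p+1}(Y, y0), for a Kan complex Y, are represented by the
   (p+1)-simplices all of whose faces are the base point. *)
Definition spherical (Y : sset) (y0 : Y 0) p (x : Y p.+1) : Prop :=
  forall k : 'I_p.+2, face k x = base y0 p.

Definition homotopic (Y : sset) (y0 : Y 0) p (x y : Y p.+1) : Prop :=
  exists w : Y p.+2, forall k : 'I_p.+3,
    face k w = if k == p.+1 :> nat then x
               else if k == p.+2 :> nat then y
               else base y0 p.+1.

(* [z] represents the product of the classes of [x] and [y]. *)
Definition homotopy_product (Y : sset) (y0 : Y 0) p (x y z : Y p.+1) : Prop :=
  exists w : Y p.+2, forall k : 'I_p.+3,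
    face k w = if k == p :> nat then x
               else if k == p.+1 :> nat then z
               else if k == p.+2 :> nat then y
               else base y0 p.+1.

(* [phi] induces an isomorphism from the group pi_{p+1}(Y, y0) onto the
   additive group of [A].  In a Kan complex any two spherical simplices have a
   product, so the last clause determines the whole group law. *)
Definition presents_homotopy_group (Y : sset) (y0 : Y 0) p (A : zmodType)
    (phi : Y p.+1 -> A) : Prop :=
  [/\ forall a : A, exists2 x, spherical y0 x & phi x = a,
      forall x y, spherical y0 x -> spherical y0 y ->
        (phi x = phi y <-> homotopic y0 x y) &
      forall x y z, spherical y0 x -> spherical y0 y -> spherical y0 z ->
        homotopy_product y0 x y z -> phi z = phi x + phi y].

(* pi_{p+1}(X, x0) is a Q-vector space.  It is computed in a fibrant
   replacement of X: one exists by the small object argument, and the group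
   does not depend on which one is used. *)
Definition rational_homotopy_group (X : sset) (x0 : X 0) (p : nat) : Prop :=
  forall (Y : sset) (i : sset_map X Y), fibrant_replacement i ->
    exists (V : lmodType rat) (phi : Y p.+1 -> V),
      presents_homotopy_group (i 0 x0) phi.

(** * Additive algebraic K-theory *)

(* The group completion of the groupoid core of C under direct sum is formed as
   Omega B, with Segal's model of the bar construction (Segal, "Categories and
   cohomology theories", section 2).  Let C(n) be the groupoid of functors from
   the poset of subsets of {1, ..., n} to C that take disjoint unions to sums
   (and the empty set to a zero object), and of isomorphisms between them; it is
   equivalent to the n-th power of the core.  The C(n) form a simplicial
   groupoid, and B is the diagonal of its nerve: an n-simplex of B is a string
   of n composable isomorphisms in C(n), that is, a functor
   [n] x P({1, ..., n}) -> C satisfying the conditions below. *)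
Definition cube n := ('I_n.+1 * {set 'I_n})%type.
Definition cube_le n (p q : cube n) : bool :=
  (p.1 <= q.1)%N && (p.2 \subset q.2).

Record segal_simplex (C : rat_linear_category) (n : nat) := SegalSimplex {
  sob : cube n -> C;
  smor : forall p q, cube_le p q -> mor (sob p) (sob q);
  smor_id : forall p (h : cube_le p p), smor h = idm (sob p);
  smor_comp : forall p q r (h : cube_le p q) (h' : cube_le q r)
      (h'' : cube_le p r), smor h'' = smor h' \oc smor h;
  smor_iso : forall (i j : 'I_n.+1) (S : {set 'I_n})
      (h : cube_le (i, S) (j, S)), is_iso (smor h);
  smor_sum : forall (i : 'I_n.+1) (S T : {set 'I_n})
      (hS : cube_le (i, S) (i, S :|: T)) (hT : cube_le (i, T) (i, S :|: T)),
    [disjoint S & T] -> is_coproduct (smor hS) (smor hT);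
  sob_zero : forall i : 'I_n.+1, is_zero_object (sob (i, set0)) }.

(* The element j of 'I_n stands for the step from j to j+1 in [n]; a monotone
   map sends the step from k to k+1 to the set of steps between its images. *)
Definition push_set m n (f : delta m n) (S : {set 'I_m}) : {set 'I_n} :=
  [set j : 'I_n | [exists k in S,
     (f (widen_ord (leqnSn m) k) <= j < f (lift ord0 k))%N]].

Definition push m n (f : delta m n) (p : cube m) : cube n :=
  (f p.1, push_set f p.2).

Lemma push_setU m n (f : delta m n) (S T : {set 'I_m}) :
  push_set f (S :|: T) = push_set f S :|: push_set f T.
Proof.
apply/setP => j; rewrite !inE; apply/existsP/orP.
- move=> [k]; rewrite inE => /andP[/orP[kS|kT] fk].
  + by left; apply/existsP; exists k; rewrite kS.
  + by right; apply/existsP; exists k; rewrite kT.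
- by case=> /existsP[k /andP[kS fk]]; exists k; rewrite inE kS ?orbT.
Qed.

Lemma push_set0 m n (f : delta m n) : push_set f set0 = set0.
Proof.
by apply/setP => j; rewrite !inE; apply/existsP => -[k]; rewrite inE.
Qed.

Lemma push_set_disjoint m n (f : delta m n) (S T : {set 'I_m}) :
  [disjoint S & T] -> [disjoint push_set f S & push_set f T].
Proof.
move=> dST; rewrite disjoint_subset; apply/subsetP => j; rewrite !inE.
move=> /existsP[k /andP[kS /andP[k1 k2]]].
apply/existsP => -[l /andP[lT /andP[l1 l2]]].
have [kl|lk|/val_inj kl] := ltngtP k l.
- have := leq_ltn_trans (leq_trans (@delta_mono _ _ f (lift ord0 k)
    (widen_ord (leqnSn m) l) kl) l1) k2; by rewrite ltnn.
- have := leq_ltn_trans (leq_trans (@delta_mono _ _ f (lift ord0 l)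
    (widen_ord (leqnSn m) k) lk) k1) l2; by rewrite ltnn.
- by move: (disjointFr dST kS); rewrite kl lT.
Qed.

Lemma push_mono m n (f : delta m n) (p q : cube m) :
  cube_le p q -> cube_le (push f p) (push f q).
Proof.
move=> /andP[h1 h2]; rewrite /cube_le /push /= delta_mono //=.
by move/setUidPr: h2 => <-; rewrite push_setU subsetUl.
Qed.

Lemma push_id n (p : cube n) : push (delta_id n) p = p.
Proof.
case: p => i S; rewrite /push /= mk_deltaE; congr (_, _).
apply/setP => j; rewrite inE; apply/existsP/idP.
- move=> [k /andP[kS]]; rewrite !mk_deltaE /= /bump /= add1n ltnS -eqn_leq.
  by move=> /eqP/val_inj <-.
- by move=> jS; exists j; rewrite jS !mk_deltaE /= /bump /= add1n leqnn ltnSn.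
Qed.

Lemma push_set_comp l m n (f : delta m n) (g : delta l m) (S : {set 'I_l}) :
  push_set (delta_comp f g) S = push_set f (push_set g S).
Proof.
apply/setP => j; rewrite !inE; apply/existsP/existsP.
- move=> [k /andP[kS]]; rewrite !mk_deltaE => /andP[h1 h2].
  set a := g (widen_ord _ k) in h1; set b := g (lift ord0 k) in h2.
  pose P i := [exists t : 'I_m.+1, (t == i :> nat) && (f t <= j)%N].
  have exP : exists i, P i.
    by exists (a : nat); apply/existsP; exists a; rewrite eqxx h1.
  have ubP i : P i -> (i <= m)%N.
    by move=> /existsP[t /andP[/eqP<- _]]; rewrite -ltnS.
  case: (ex_maxnP exP ubP) => i /existsP[t /andP[/eqP ti ft]] maxi.
  have ai : (a <= i)%N.
    by apply: maxi; apply/existsP; exists a; rewrite eqxx h1.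
  have ib : (i < b)%N.
    rewrite ltnNge; apply/negP => bi.
    have : (f b <= f t)%N by apply: delta_mono; rewrite ti.
    by move=> /leq_trans/(_ ft)/leq_trans/(_ (leqnn _)); rewrite leqNgt h2.
  have im : (i < m)%N by apply: leq_trans ib _; rewrite -ltnS.
  exists (Ordinal im); rewrite inE; apply/andP; split.
    by apply/existsP; exists k; rewrite kS /= ai ib.
  apply/andP; split.
    suff -> : widen_ord (leqnSn m) (Ordinal im) = t by [].
    by apply: val_inj; rewrite /= ti.
  rewrite ltnNge; apply/negP => le.
  have : (i.+1 <= i)%N.
    apply: maxi; apply/existsP; exists (lift ord0 (Ordinal im)).
    by rewrite le andbT /= /bump /= add1n.
  by rewrite ltnn.
- move=> [i]; rewrite inE => /andP[/existsP[k /andP[kS /andP[h1 h2]]] /andP[h3 h4]].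
  exists k; rewrite kS !mk_deltaE /=; apply/andP; split.
    by apply: leq_trans h3; apply: delta_mono.
  by apply: leq_trans h4 _; apply: delta_mono; rewrite /= /bump /= add1n.
Qed.

Lemma push_comp l m n (f : delta m n) (g : delta l m) (p : cube l) :
  push (delta_comp f g) p = push f (push g p).
Proof. by rewrite /push /= mk_deltaE push_set_comp. Qed.

Section Restrict.
Variables (C : rat_linear_category) (m n : nat).

Lemma smor_sum_eq (D : segal_simplex C n) (i : 'I_n.+1) (S T U : {set 'I_n})
    (hS : cube_le (i, S) (i, U)) (hT : cube_le (i, T) (i, U)) :
  U = S :|: T -> [disjoint S & T] -> is_coproduct (smor D hS) (smor D hT).
Proof. by move=> eU; subst U; apply: smor_sum. Qed.

Lemma sob_zero_eq (D : segal_simplex C n) (i : 'I_n.+1) (S : {set 'I_n}) :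
  S = set0 -> is_zero_object (sob D (i, S)).
Proof. by move=> ->; apply: sob_zero. Qed.

Definition restrict (f : delta m n) (D : segal_simplex C n) :
    segal_simplex C m :=
  @SegalSimplex C m (fun p => sob D (push f p))
    (fun p q h => smor D (push_mono f h))
    (fun p h => smor_id D _)
    (fun p q r h h' h'' => smor_comp D _ _ _)
    (fun i j S h => smor_iso D (push_mono f h))
    (fun i S T hS hT d =>
       @smor_sum_eq D _ _ _ _ (push_mono f hS) (push_mono f hT)
         (push_setU f S T) (push_set_disjoint f d))
    (fun i => sob_zero_eq D (f i) (push_set0 f)).

End Restrict.

Lemma segal_simplex_ext (C : rat_linear_category) m n (D : segal_simplex C n)
    (F G : cube m -> cube n)
    (hF : forall p q, cube_le p q -> cube_le (F p) (F q))
    (hG : forall p q, cube_le p q -> cube_le (G p) (G q))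
    (A B : segal_simplex C m) :
  F = G ->
  forall (eA : sob A = fun p => sob D (F p)) (eB : sob B = fun p => sob D (G p)),
  (forall p q (h : cube_le p q),
     smor A h = eq_rect_r (fun s => mor (s p) (s q)) (smor D (hF p q h)) eA) ->
  (forall p q (h : cube_le p q),
     smor B h = eq_rect_r (fun s => mor (s p) (s q)) (smor D (hG p q h)) eB) ->
  A = B.
Proof.
move=> eFG; subst G; rewrite (Prop_irrelevance hG hF).
case: A => a1 a2 a3 a4 a5 a6 a7; case: B => b1 b2 b3 b4 b5 b6 b7 /=.
move=> eA eB; subst a1 b1; rewrite /eq_rect_r /= => hA hB.
have e : a2 = b2.
  apply: functional_extensionality_dep => p; apply: functional_extensionality_dep => q.
  by apply: functional_extensionality_dep => h; rewrite hA hB.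
by subst b2; congr SegalSimplex; apply: Prop_irrelevance.
Qed.

Lemma restrict_id (C : rat_linear_category) n (D : segal_simplex C n) :
  restrict (delta_id n) D = D.
Proof.
have e : push (delta_id n) = id by apply: funext => p; rewrite push_id.
exact: (@segal_simplex_ext C n n D _ _ (push_mono (delta_id n)) (fun p q h => h)
  (restrict (delta_id n) D) D e erefl erefl
  (fun _ _ _ => erefl) (fun _ _ _ => erefl)).
Qed.

Lemma restrict_comp (C : rat_linear_category) l m n (f : delta m n)
    (g : delta l m) (D : segal_simplex C n) :
  restrict (delta_comp f g) D = restrict g (restrict f D).
Proof.
have e : push (delta_comp f g) = fun p => push f (push g p).
  by apply: funext => p; rewrite push_comp.
exact: (@segal_simplex_ext C l n D _ _ (push_mono (delta_comp f g))
  (fun p q h => push_mono f (push_mono g h))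
  (restrict (delta_comp f g) D) (restrict g (restrict f D)) e erefl erefl
  (fun _ _ _ => erefl) (fun _ _ _ => erefl)).
Qed.

Definition segal_bar (C : rat_linear_category) : sset :=
  @SSet (segal_simplex C) (fun m n f D => restrict f D)
    (@restrict_id C) (@restrict_comp C).

Lemma zero_iso (C : rat_linear_category) (z : C) (f : mor z z) :
  is_zero_object z -> is_iso f.
Proof. by move=> hz; exists (idm z); split; rewrite (hz.1 _ (idm z)); apply: hz.1. Qed.

Lemma zero_coproduct (C : rat_linear_category) (z : C) :
  is_zero_object z -> is_coproduct (idm z) (idm z).
Proof.
move=> hz y f g; exists f; split; first by rewrite comp_idr (hz.1 _ f) (hz.1 _ g).
by move=> h [<- _]; rewrite comp_idr.
Qed.

Definition segal_base (C : rat_additive_category) : segal_bar C 0 :=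
  @SegalSimplex C 0 (fun=> zero_ob C) (fun _ _ _ => idm (zero_ob C))
    (fun _ _ => erefl) (fun _ _ _ _ _ _ => esym (comp_idl _))
    (fun _ _ _ _ => zero_iso _ (zero_obP C))
    (fun _ _ _ _ _ _ => zero_coproduct (zero_obP C))
    (fun _ => zero_obP C).

(* The K-theory spectrum is connective, and its n-th homotopy group is
   pi_n(Omega B) = pi_{n+1}(B) for n >= 0. *)
Definition rational_K_theory (C : rat_additive_category) : Prop :=
  forall n : nat, rational_homotopy_group (segal_base C) n.

(* Main.v *)
From HB Require Import structures.
From mathcomp Require Import all_boot all_order all_algebra.
From mathcomp Require Import boolp.
From mathcomp Require Import zify ring.
Require Import Defs.

(* If [K_0] is rational, there are virtual objects of dimension [1/n], so cancellation of direct sums has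
   to fail.  Let [W_n] be the set of words over an
   alphabet of [n + 2] letters.  Removing the first letter gives a bijection [W_n = 1 + (n + 2) W_n], so a
   finitely additive measure compatible with it gives [W_n] the mass [-1/(n + 1)] (each single word has
   mass [1]).  Objects are the polynomial expressions in the sets [W_n] (finite sums of finite products);
   a morphism is a kernel, that is, a rational function on the product of two such sets that is definable
   from equality of words and removal of letters; kernels compose by integration, which makes sense
   because definable functions are stable under integration and satisfy Fubini's theorem.  All structure
   morphisms are graphs of bijections, and every object is its own dual through the diagonal.

   Since [W_n] is isomorphic to [1 + (n + 2) W_n] in this category, [n + 1] times the class of [W_n] in
   [K_0] is [-1].  Every homotopy group of the K-theory is a module over [K_0]: tensoring with an object
   [A] acts on it by an endomorphism that is additive in [A].  Hence every positive integer acts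
   invertibly.  To make this precise in an arbitrary fibrant replacement [Y] of the bar construction [B],
   the strictly unital sum [B x B -> B], the maps [A (x) - : B -> B] and the homotopies between them are
   extended to [Y] using that [Y^K -> Y^L] is a Kan fibration for every monomorphism [L -> K]. *)

Set Implicit Arguments.
Unset Strict Implicit.
Unset Printing Implicit Defensive.

Import GRing.Theory.

(** * Filling horns and prisms *)

(** Fubini selects the functions: kernels must contain equality of words (identities) and removal of
    a letter, yet integrate to functions of the same kind. Equations between terms [u ++ drop j y]
    are enough: relative to one word variable, every function so generated is a sum of products with
    a function of finitely many letters and of weighted graphs of terms. Both integrate explicitly,
    and invariance of the measure under [drop] gives Fubini. One alphabet inverts only one integer,
    hence the whole family [W_n]. On the homotopy side all that is known of [B -> Y] is a lifting
    property, so each operation and homotopy is first built on [B]. There the base point is one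
    specific zero object, and the sum and the functors are altered by a case distinction to respect
    it on the nose. The strict units so obtained allow Eckmann-Hilton to identify the sum with the
    group law of [pi_(p+1)(Y)], even for the fundamental group. A natural isomorphism becomes a
    homotopy once its source and target are seen as two replacements, up to isomorphism, of the
    values of a single functor. *)

Lemma dcompE l m n (f : delta m n) (g : delta l m) i : delta_comp f g i = f (g i).
Proof. exact: mk_deltaE. Qed.

Lemma delta_idE n i : delta_id n i = i.
Proof. exact: mk_deltaE. Qed.

Definition dconst m n (v : 'I_n.+1) : delta m n :=
  @mk_delta m n (fun=> v) (fun _ _ _ => leqnn v).

Lemma dconstE m n (v : 'I_n.+1) i : dconst m v i = v.
Proof. exact: mk_deltaE. Qed.

Lemma delta_id_comp m n (f : delta m n) : delta_comp (delta_id n) f = f.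
Proof. by apply: deltaP => i; rewrite dcompE mk_deltaE. Qed.

Definition misses m n (v : 'I_n.+1) (f : delta m n) := [forall i, f i != v].

Lemma missesP m n (v : 'I_n.+1) (f : delta m n) : reflect (forall i, f i <> v) (misses v f).
Proof. by apply: (iffP forallP) => h i; apply/eqP. Qed.

Lemma misses_comp l m n v (f : delta m n) (g : delta l m) :
  misses v f -> misses v (delta_comp f g).
Proof. by move=> /missesP h; apply/missesP => i; rewrite dcompE. Qed.

Definition nonsurj m n (f : delta m n) : Prop := exists v, misses v f.

Lemma nonsurj_comp l m n (f : delta m n) (g : delta l m) : nonsurj f -> nonsurj (delta_comp f g).
Proof. by case=> v h; exists v; apply: misses_comp. Qed.

Lemma in_hornP n (k : 'I_n.+1) m (f : delta m n) :
  reflect (exists2 j, j <> k & misses j f) (in_horn k f).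
Proof.
apply: (iffP existsP) => [[j /andP[/eqP jk h]]|[j /eqP jk h]]; exists j => //.
by rewrite jk.
Qed.

Lemma codeg_subproof n (k : 'I_n.+1) (i j : 'I_n.+2) :
  i <= j -> (inord (i - (k < i)) : 'I_n.+1) <= (inord (j - (k < j)) : 'I_n.+1).
Proof. by move=> ij; have := ltn_ord i; have := ltn_ord j; have := ltn_ord k; move=> *; rewrite !inordK; lia. Qed.

Definition codeg n (k : 'I_n.+1) : delta n.+1 n := mk_delta (@codeg_subproof n k).

Lemma codegE n (k : 'I_n.+1) i : codeg k i = i - (k < i) :> nat.
Proof. by rewrite mk_deltaE inordK //; have := ltn_ord i; have := ltn_ord k; lia. Qed.

Lemma cofaceE n (k : 'I_n.+2) i : coface k i = bump k i :> nat.
Proof. by rewrite mk_deltaE. Qed.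

Lemma coface_misses n (k : 'I_n.+2) : misses k (coface k).
Proof. by apply/missesP => i /(congr1 val); rewrite /= cofaceE /bump; lia. Qed.

Lemma codeg_coface n (k : 'I_n.+1) (s : 'I_n.+2) : s = k :> nat \/ s = k.+1 :> nat ->
  delta_comp (codeg k) (coface s) = delta_id n.
Proof.
move=> h; apply: deltaP => i; apply/val_inj; rewrite dcompE delta_idE /= codegE cofaceE /bump; lia.
Qed.

Lemma coface_codeg m n (k : 'I_n.+1) (s : 'I_n.+2) (c : delta m n.+1) :
  s = k :> nat \/ s = k.+1 :> nat -> misses s c ->
  delta_comp (coface s) (delta_comp (codeg k) c) = c.
Proof.
move=> h /missesP hc; apply: deltaP => i; apply/val_inj => /=.
have : c i <> s :> nat by move=> /val_inj /hc.
rewrite !dcompE cofaceE codegE /bump; lia.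
Qed.

Lemma misses_factor m n (s : 'I_n.+2) (c : delta m n.+1) : misses s c ->
  exists a, c = delta_comp (coface s) a.
Proof.
move=> h; case: (ltnP s n.+1) => sn.
  exists (delta_comp (codeg (Ordinal sn)) c).
  by rewrite coface_codeg //; left.
have k1 : s.-1 < n.+1 by have := ltn_ord s; lia.
exists (delta_comp (codeg (Ordinal k1)) c).
by rewrite coface_codeg //; right => /=; lia.
Qed.

Lemma coface_inj l n (s : 'I_n.+2) (a b : delta l n) :
  delta_comp (coface s) a = delta_comp (coface s) b -> a = b.
Proof.
move=> e; apply: deltaP => i; have := congr1 (fun f : delta l n.+1 => f i) e.
by rewrite !dcompE !mk_deltaE => /lift_inj.
Qed.

(** [G] is a total family that matters only on simplices of the horn; a horn given by formulas then
    needs no subtypes. *)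
Lemma horn_fill (Y : sset) (HY : kan_complex Y) n (k : 'I_n.+2)
    (G : forall m, delta m n.+1 -> Y m) :
  (forall l m (a : delta m n.+1) (g : delta l m), in_horn k a ->
     smap g (G m a) = G l (delta_comp a g)) ->
  exists w : Y n.+1, forall m (a : delta m n.+1), in_horn k a -> smap a w = G m a.
Proof.
move=> hG.
have nat m l (f : delta m l) (x : horn k l) : G m (val (smap f x)) = smap f (G l (val x)).
  by rewrite hG //; apply: valP.
pose u := @SSetMap (horn k) Y (fun m x => G m (val x)) nat.
have [w hw] := HY n k u; exists (w n.+1 (delta_id n.+1)) => m a ha.
rewrite -sfun_nat /= delta_id_comp.
exact: (hw m (exist _ a ha)).
Qed.

(** A simplex of the horn may lie in two faces [i < j]. It then factors through their common face of
    codimension two, where the simplicial identity makes both prescriptions agree. *)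
Lemma face_fill (Y : sset) (HY : kan_complex Y) n (k : 'I_n.+3) (y : 'I_n.+3 -> Y n.+1) :
  (forall (i j : 'I_n.+3) (i' j' : 'I_n.+2), i <> k -> j <> k -> i < j ->
     i' = i :> nat -> j = j'.+1 :> nat -> face i' (y j) = face j' (y i)) ->
  exists w : Y n.+2, forall i, i <> k -> face i w = y i.
Proof.
move=> hy.
have cmp m (i j : 'I_n.+3) (a b : delta m n.+1) : i <> k -> j <> k -> i < j ->
    delta_comp (coface i) a = delta_comp (coface j) b -> smap a (y i) = smap b (y j).
  move=> ik jk ij e.
  have eab x : bump i (a x) = bump j (b x).
    by have := congr1 (fun f : delta m n.+2 => f x : nat) e; rewrite !dcompE !cofaceE.
  have i'n : i < n.+2 by have := ltn_ord j; lia.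
  have j'n : j.-1 < n.+2 by have := ltn_ord j; lia.
  have [a' ea] : exists a', a = delta_comp (coface (Ordinal j'n)) a'.
    apply: misses_factor; apply/missesP => x /(congr1 val) /= ex.
    by have := eab x; rewrite ex /bump; lia.
  have [b' eb] : exists b', b = delta_comp (coface (Ordinal i'n)) b'.
    apply: misses_factor; apply/missesP => x /(congr1 val) /= ex.
    by have := eab x; rewrite ex /bump; lia.
  have eab' : a' = b'.
    apply: deltaP => x; apply: val_inj => /=; move: (eab x).
    rewrite ea eb !dcompE !cofaceE /= /bump; lia.
  rewrite ea eb eab' !smap_comp; congr (smap _ _); apply: esym.
  by apply: hy => //=; lia.
have cmp2 m (i j : 'I_n.+3) (a b : delta m n.+1) : i <> k -> j <> k ->
    delta_comp (coface i) a = delta_comp (coface j) b -> smap a (y i) = smap b (y j).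
  move=> ik jk e; case: (ltngtP i j) => ij.
  - exact: cmp e.
  - by apply: esym; apply: cmp (esym e).
  - by move/val_inj: ij e => -> /coface_inj ->.
pose P m (c : delta m n.+2) (z : Y m) :=
  exists i (a : delta m n.+1), [/\ i <> k, c = delta_comp (coface i) a & z = smap a (y i)].
have exP m (c : delta m n.+2) : exists z, in_horn k c -> P m c z.
  case: (boolP (in_horn k c)) => [/in_hornP[i ik /misses_factor[a ea]]|_].
    by exists (smap a (y i)) => _; exists i, a.
  by exists (smap (dconst m ord0) (y k)).
pose G m c := projT1 (cid (exP m c)).
have hG m c : in_horn k c -> P m c (G m c) by exact: projT2 (cid (exP m c)).
have [l m c g hc|w hw] := @horn_fill Y HY n.+1 k G.
  have [i [a [ik ea ->]]] := hG _ _ hc.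
  have [j [b [jk eb ->]]] := hG _ _ (in_horn_comp g hc).
  by rewrite -smap_comp; apply: cmp2 => //; rewrite -eb ea delta_compA.
exists w => i ik.
have hi : in_horn k (coface i) by apply/in_hornP; exists i => //; apply: coface_misses.
rewrite /face (hw _ _ hi); have [j [b [jk eb ->]]] := hG _ _ hi.
rewrite -[RHS]smap_id; apply: cmp2 => //.
by rewrite -eb delta_comp_id.
Qed.

Lemma cut_subproof n (j : nat) (i i' : 'I_n.+1) :
  i <= i' -> (inord (j <= i) : 'I_2) <= (inord (j <= i') : 'I_2).
Proof. by move=> ii; rewrite !inordK; lia. Qed.

(** [j = 0] gives the constant map 1 and [j = n.+1] the constant map 0; these are all the
    [n]-simplices of the interval. *)
Definition cut n (j : nat) : delta n 1 := mk_delta (@cut_subproof n j).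

Lemma cutE n j i : cut n j i = (j <= i) :> nat.
Proof. by rewrite mk_deltaE inordK //; lia. Qed.

Section Prism.
Variables (Y : sset) (HY : kan_complex Y) (q : nat) (e : 'I_2).
Variable F : forall m, delta m q -> delta m 1 -> Y m.

Definition pdom m (a : delta m q) (b : delta m 1) : Prop := nonsurj a \/ forall i, b i = e.

Hypothesis Fnat : forall l m (g : delta l m) (a : delta m q) (b : delta m 1), pdom a b ->
  smap g (F a b) = F (delta_comp a g) (delta_comp b g).

(* [t] is a candidate for the value of the filler on the simplex [(id, cut q j)]. *)
Let good j (t : Y q) := forall m (g : delta m q), nonsurj g ->
  smap g t = F g (delta_comp (cut q j) g).

(* The [j]-th nondegenerate simplex of maximal dimension of the prism. *)
Let top j (w : Y q.+1) := forall m (c : delta m q.+1), nonsurj (delta_comp (codeg (inord j)) c) ->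
  smap c w = F (delta_comp (codeg (inord j)) c) (delta_comp (cut q.+1 j.+1) c).

(** Faces [j] and [j.+1] of the [j]-th maximal simplex are the sections [(id, cut q j)] and
    [(id, cut q j.+1)]; its other faces lie over the boundary. Once one section is known, a horn
    filler yields the other. *)
Lemma prism_step j s r t : j <= q -> (s = j /\ r = j.+1) \/ (s = j.+1 /\ r = j) -> good s t ->
  exists t', good r t' /\ exists w, [/\ face (inord s) w = t, face (inord r) w = t' & top j w].
Proof.
move=> jq sr ht.
set J : 'I_q.+1 := inord j; set S : 'I_q.+2 := inord s; set R : 'I_q.+2 := inord r.
have Jj : J = j :> nat by rewrite inordK.
have Ss : S = s :> nat by rewrite inordK //; lia.
have Rr : R = r :> nat by rewrite inordK //; lia.
have SJ : S = J :> nat \/ S = J.+1 :> nat by lia.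
have RJ : R = J :> nat \/ R = J.+1 :> nat by lia.
have SR : S <> R by move=> /(congr1 val) /=; lia.
have cutS : delta_comp (cut q.+1 j.+1) (coface S) = cut q s.
  apply: deltaP => i; apply: val_inj; rewrite /= dcompE !cutE cofaceE /bump; lia.
have cutR : delta_comp (cut q.+1 j.+1) (coface R) = cut q r.
  apply: deltaP => i; apply: val_inj; rewrite /= dcompE !cutE cofaceE /bump; lia.
pose G m (c : delta m q.+1) := if misses S c then smap (delta_comp (codeg J) c) t
  else F (delta_comp (codeg J) c) (delta_comp (cut q.+1 j.+1) c).
have cutSc m (c : delta m q.+1) : misses S c ->
    delta_comp (cut q s) (delta_comp (codeg J) c) = delta_comp (cut q.+1 j.+1) c.
  by move=> /(coface_codeg SJ) {2}<-; rewrite [RHS]delta_compA cutS.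
have Gns m (c : delta m q.+1) : nonsurj (delta_comp (codeg J) c) ->
    G m c = F (delta_comp (codeg J) c) (delta_comp (cut q.+1 j.+1) c).
  by rewrite /G; case: ifP => // hS hc; rewrite ht // cutSc.
have hns m (c : delta m q.+1) i : i <> R -> i <> S -> misses i c -> nonsurj (delta_comp (codeg J) c).
  move=> iR iS /missesP hi.
  have iR' : i <> R :> nat by move=> /val_inj.
  have iS' : i <> S :> nat by move=> /val_inj.
  exists (codeg J i); apply/missesP => x; rewrite dcompE => /(congr1 val) /=.
  rewrite !codegE => ex; have : c x <> i :> nat by move=> /val_inj /hi.
  have := ltn_ord (c x); lia.
have hG l m (c : delta m q.+1) (g : delta l m) : in_horn R c -> smap g (G m c) = G l (delta_comp c g).
  move=> /in_hornP[i iR ic]; case: (boolP (misses S c)) => hS.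
    by rewrite /G hS misses_comp // -smap_comp delta_compA.
  have h : nonsurj (delta_comp (codeg J) c).
    by apply: (hns _ _ _ iR _ ic) => iS; rewrite -iS ic in hS.
  have h' : nonsurj (delta_comp (codeg J) (delta_comp c g)) by rewrite delta_compA; apply: nonsurj_comp.
  by rewrite !Gns // Fnat ?delta_compA //; left.
have [w hw] := horn_fill HY hG.
have hS : in_horn R (coface S) by apply/in_hornP; exists S => //; apply: coface_misses.
have hnsw m (c : delta m q.+1) : nonsurj (delta_comp (codeg J) c) ->
    smap c w = F (delta_comp (codeg J) c) (delta_comp (cut q.+1 j.+1) c).
  move=> h; rewrite -Gns // hw //; case: h => v /missesP hv; apply/in_hornP.
  have [vJ|vJ] := eqVneq v J.
    exists S => //; apply/missesP => x ex; apply: (hv x); rewrite dcompE ex vJ.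
    by apply: val_inj; rewrite /= codegE; lia.
  have vJ' : v <> J :> nat by move=> /val_inj /eqP; apply/negP.
  exists (inord (bump J v)) => [/(congr1 val)|]; first by rewrite /= inordK /bump; have := ltn_ord v; lia.
  apply/missesP => x /(congr1 val) ex; apply: (hv x); apply: val_inj; move: ex.
  by rewrite dcompE /= codegE inordK /bump; have := ltn_ord v; lia.
exists (face R w); split; last first.
  exists w; split => //; rewrite /face (hw _ _ hS) /G coface_misses.
  by rewrite codeg_coface // smap_id.
move=> m g hg; rewrite /face -smap_comp hnsw.
  by rewrite !delta_compA codeg_coface // cutR delta_id_comp.
by rewrite delta_compA codeg_coface // delta_id_comp.
Qed.

Let rel j t t' w := [/\ face (inord j) w = t, face (inord j.+1) w = t' & top j w].

(** Serves the end [e = 1], as [cut q 0] is constantly 1; [prism_down] starts at [cut q q.+1] and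
    serves the end 0. *)
Lemma prism_up t0 : good 0 t0 -> exists (t : nat -> Y q) (w : nat -> Y q.+1),
  t 0 = t0 /\ forall j, j <= q -> rel j (t j) (t j.+1) (w j).
Proof.
move=> h0.
have [w0 _] : exists w : Y q.+1, True.
  by have [_ [_ [w _]]] := prism_step (leq0n q) (or_introl (conj erefl erefl)) h0; exists w.
suff /(_ q.+1 (leqnn _)) [t [w [e0 _ h]]] : forall N, N <= q.+1 -> exists (t : nat -> Y q) (w : nat -> Y q.+1),
    [/\ t 0 = t0, good N (t N) & forall j, j < N -> rel j (t j) (t j.+1) (w j)].
  by exists t, w; split => // j jq; apply: h.
elim=> [|N IH] hN; first by exists (fun=> t0), (fun=> w0).
have [t [w [e0 hgood h]]] := IH (ltnW hN).
have [t' [hg' [w' [h1 h2 h3]]]] := prism_step hN (or_introl (conj erefl erefl)) hgood.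
exists (fun i => if i <= N then t i else t'), (fun i => if i < N then w i else w').
split => [//||j jN]; first by rewrite ltnn.
move: jN; rewrite ltnS leq_eqVlt => /orP[/eqP ->|jN] /=; last by rewrite jN orbT; apply: h.
by rewrite eqxx !ltnn.
Qed.

Lemma prism_down t0 : good q.+1 t0 -> exists (t : nat -> Y q) (w : nat -> Y q.+1),
  t q.+1 = t0 /\ forall j, j <= q -> rel j (t j) (t j.+1) (w j).
Proof.
move=> h0.
have [w0 _] : exists w : Y q.+1, True.
  by have [_ [_ [w _]]] := prism_step (leqnn q) (or_intror (conj erefl erefl)) h0; exists w.
suff /(_ 0 (leq0n _)) [t [w [e0 _ h]]] : forall N, N <= q.+1 -> exists (t : nat -> Y q) (w : nat -> Y q.+1),
    [/\ t q.+1 = t0, good N (t N) & forall j, N <= j <= q -> rel j (t j) (t j.+1) (w j)].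
  by exists t, w; split => // j jq; apply: h.
move=> N NQ; rewrite -(subKn NQ); move: (q.+1 - N) (leq_subr N q.+1) => d {N NQ}.
elim: d => [|d IH] hd.
  rewrite subn0; exists (fun=> t0), (fun=> w0); split => // j; lia.
have [t [w [e0 hgood h]]] := IH (ltnW hd).
set N := q.+1 - d.+1; have eN : q.+1 - d = N.+1 by rewrite /N; lia.
rewrite eN in hgood h; have NQ : N <= q by rewrite /N; lia.
have [t' [hg' [w' [h1 h2 h3]]]] := prism_step NQ (or_intror (conj erefl erefl)) hgood.
exists (fun i => if N < i then t i else t'), (fun i => if N < i then w i else w').
split => [||j /andP[]]; first by rewrite ltnS NQ.
  by rewrite ltnn.
rewrite leq_eqVlt => /orP[/eqP <- _|Nj jq] /=; first by rewrite ltnn ltnSn.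
by rewrite Nj ltnS (ltnW Nj); apply: h; rewrite Nj.
Qed.

Let theta_subproof m (a : delta m q) (b : delta m 1) (i i' : 'I_m.+1) :
  i <= i' -> (inord (a i + b i) : 'I_q.+2) <= (inord (a i' + b i') : 'I_q.+2).
Proof.
move=> ii; have := delta_mono a ii; have := delta_mono b ii.
have := ltn_ord (a i); have := ltn_ord (a i'); have := ltn_ord (b i); have := ltn_ord (b i').
by move=> *; rewrite !inordK; lia.
Qed.

(** A simplex [(a, b)] of the prism lies in the [j]-th maximal simplex for each [valid] index [j],
    and the factoring map is this one, whatever [j] is. *)
Let theta m (a : delta m q) (b : delta m 1) : delta m q.+1 := mk_delta (@theta_subproof m a b).

Let thetaE m (a : delta m q) (b : delta m 1) i : theta a b i = a i + b i :> nat.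
Proof. by rewrite mk_deltaE inordK //; have := ltn_ord (a i); have := ltn_ord (b i); lia. Qed.

Let valid m (a : delta m q) (b : delta m 1) j :=
  forall i, if b i == 0 :> nat then a i <= j else j <= a i.

Lemma prism_fill : exists W : forall m, delta m q -> delta m 1 -> Y m,
  (forall l m (g : delta l m) a b, smap g (W m a b) = W l (delta_comp a g) (delta_comp b g)) /\
  (forall m a b, pdom a b -> W m a b = F a b).
Proof.
pose t0 := F (delta_id q) (dconst q e).
have dom0 : pdom (delta_id q) (dconst q e) by right => i; rewrite dconstE.
have good0 j : (forall i : 'I_q.+1, (j <= i) = e :> nat) -> good j t0.
  move=> hj m g hg; rewrite Fnat // delta_id_comp; congr (F _ (delta_comp _ _)).
  by apply: deltaP => i; apply: val_inj; rewrite dconstE /= cutE.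
have [t [w [h0 ht]]] : exists (t : nat -> Y q) (w : nat -> Y q.+1),
    t (if e == 0 :> nat then q.+1 else 0) = t0 /\ forall j, j <= q -> rel j (t j) (t j.+1) (w j).
  case: eqP => e0.
    by apply: prism_down; apply: good0 => i; have := ltn_ord i; rewrite e0; lia.
  by apply: prism_up; apply: good0 => i; have := ltn_ord e; lia.
(* The least valid index. It may drop when [(a, b)] is restricted along a map, so naturality
   requires independence of the index. *)
pose J m (a : delta m q) (b : delta m 1) := \max_(i | b i == 0 :> nat) a i.
have Jq m a b : J m a b <= q by apply/bigmax_leqP => i _; rewrite -ltnS.
have Jv m a b : valid a b (J m a b).
  move=> i; case: eqP => bi.
    by apply: (@leq_bigmax_cond _ (fun i => b i == 0 :> nat) (fun i => a i : nat) i); apply/eqP.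
  apply/bigmax_leqP => i' /eqP bi'; apply: delta_mono.
  case: (leqP i' i) => // /ltnW /(delta_mono b); lia.
have th1 m a b j : j <= q -> valid a b j -> delta_comp (codeg (inord j)) (theta a b) = a :> delta m q.
  move=> jq hv; apply: deltaP => i; apply: val_inj; rewrite /= dcompE codegE inordK // thetaE.
  have := hv i; have := ltn_ord (b i); case: eqP; lia.
have th2 m a b j : j <= q -> valid a b j -> delta_comp (cut q.+1 j.+1) (theta a b) = b :> delta m 1.
  move=> jq hv; apply: deltaP => i; apply: val_inj; rewrite /= dcompE cutE thetaE.
  have := hv i; have := ltn_ord (b i); case: eqP; lia.
(* If [j] and [j.+1] are both valid, [theta a b] misses the vertex [j.+1], hence factors through the
   face shared by two consecutive maximal simplices. *)
have succ m (a : delta m q) b j : j < q -> valid a b j -> valid a b j.+1 ->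
    smap (theta a b) (w j) = smap (theta a b) (w j.+1).
  move=> jq v1 v2.
  have [_ r1 _] := ht j (ltnW jq); have [r2 _ _] := ht j.+1 jq.
  have mis : misses (inord j.+1) (theta a b).
    apply/missesP => i /(congr1 val); rewrite /= thetaE inordK; last by lia.
    have := v1 i; have := v2 i; have := ltn_ord (b i); case: eqP; lia.
  have JJ : (inord j.+1 : 'I_q.+2) = (inord j : 'I_q.+1).+1 :> nat by rewrite !inordK //; lia.
  rewrite -(coface_codeg (or_intror JJ) mis) !(smap_comp (coface _)).
  by rewrite -![smap (coface _) _]/(face _ _) r1 r2.
have indep m (a : delta m q) b j j' : j <= j' -> j' <= q -> valid a b j -> valid a b j' ->
    smap (theta a b) (w j) = smap (theta a b) (w j').
  move=> jj; rewrite -(subnK jj); elim: (j' - j) => [//|d IH] dq v1 v2.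
  rewrite addSn in dq v2 *.
  have v3 : valid a b (d + j).
    move=> i; have := v1 i; have := v2 i; case: eqP; lia.
  have dq' : d + j <= q by lia.
  by rewrite (IH dq' v1 v3); apply: succ.
have indep' m (a : delta m q) b j j' : j <= q -> j' <= q -> valid a b j -> valid a b j' ->
    smap (theta a b) (w j) = smap (theta a b) (w j').
  by move=> jq j'q v v'; case: (leqP j j') => [|/ltnW] h; [|apply: esym]; apply: indep.
exists (fun m a b => smap (theta a b) (w (J m a b))); split.
  move=> l m g a b; rewrite -smap_comp.
  have -> : delta_comp (theta a b) g = theta (delta_comp a g) (delta_comp b g).
    by apply: deltaP => i; apply: val_inj; rewrite /= dcompE !thetaE !dcompE.
  apply: indep' => // i; rewrite !dcompE; exact: Jv.
move=> m a b; case: (pselect (nonsurj a)) => [ha _|na [//|be]].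
  have [_ _ htop] := ht _ (Jq m a b).
  by rewrite htop !th1 ?th2.
have ab (x : 'I_q.+2) : (forall i, theta a b i <> x) -> (x = q.+1 :> nat \/ x = 0 :> nat) ->
    (forall i, b i = (if x == 0 :> nat then 1 else 0) :> nat) ->
    theta a b = delta_comp (coface x) a.
  move=> hx x0 hb; apply: deltaP => i; apply: val_inj; rewrite /= thetaE dcompE cofaceE /bump hb.
  by have := ltn_ord (a i); case: eqP; lia.
have t0E : smap a t0 = F a b.
  rewrite Fnat // delta_id_comp; congr F; apply: deltaP => i.
  by rewrite dcompE dconstE be.
case: (eqVneq (e : nat) 0) => e0.
  rewrite e0 eqxx in h0.
  have v : valid a b q by move=> i; rewrite be e0 eqxx -ltnS.
  rewrite (indep' _ _ _ _ q) //; have [_ r _] := ht q (leqnn q).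
  rewrite (ab (inord q.+1)); last first.
  - by move=> i; rewrite be e0 inordK.
  - by left; rewrite inordK.
  - move=> i /(congr1 val); rewrite /= thetaE be e0 inordK //; have := ltn_ord (a i); lia.
  by rewrite smap_comp -[smap (coface _) _]/(face _ _) r h0.
rewrite (negPf e0) in h0.
have e1 : e = 1 :> nat by have := ltn_ord e; move/eqP: e0; lia.
have v : valid a b 0 by move=> i; rewrite be e1.
rewrite (indep' _ _ _ _ 0) //; have [r _ _] := ht 0 (leq0n q).
rewrite (ab (inord 0)); last first.
- by move=> i; rewrite be e1 inordK.
- by right; rewrite inordK.
- by move=> i /(congr1 val); rewrite /= thetaE be e1 inordK // addn1.
by rewrite smap_comp -[smap (coface _) _]/(face _ _) r h0.
Qed.

End Prism.

Lemma surjP m n (s : delta m n) : ~ nonsurj s -> forall v, exists i, s i = v.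
Proof.
move=> h v; apply: contrapT => hv; apply: h; exists v; apply/missesP => i e.
by apply: hv; exists i.
Qed.

(** A set-theoretic section of a monotone surjection is automatically monotone, so one of its values
    can be prescribed. *)
Lemma section_at m r (s : delta m r) (i : 'I_m.+1) : ~ nonsurj s ->
  exists2 d : delta r m, delta_comp s d = delta_id r & d (s i) = i.
Proof.
move=> hs; have [c hc] := choice (surjP hs).
pose d v := if v == s i then i else c v.
have hd v : s (d v) = v by rewrite /d; case: eqP => [->|_].
have dm (v v' : 'I_r.+1) : v <= v' -> d v <= d v'.
  rewrite leq_eqVlt => /orP[/eqP/val_inj -> //|vv].
  case: (leqP (d v) (d v')) => // /ltnW /(delta_mono s); rewrite !hd; lia.
exists (mk_delta dm).
  by apply: deltaP => v; rewrite dcompE !mk_deltaE hd.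
by rewrite mk_deltaE /d eqxx.
Qed.

Lemma surj_endo r (t : delta r r) : ~ nonsurj t -> t = delta_id r.
Proof.
move=> ht; have inj : injective t.
  have [c hc] := choice (surjP ht).
  have ic : injective c by move=> x y /(congr1 t); rewrite !hc.
  have bc := injF_bij ic.
  exact: bij_inj (bij_can_bij bc hc).
apply: deltaP => i; rewrite delta_idE; apply: val_inj => /=.
move: {2}(nat_of_ord i) (leqnn i) => b; elim: b i => [|b IH] i ib.
all: have ti (u : 'I_r.+1) : u < i -> t u = u :> nat by
  first [by move=> ui; lia | by move=> ui; apply: IH; lia].
all: have [w ew] := surjP ht i.
all: have wi : i <= w by case: (leqP i w) => // wi; have := ti _ wi; rewrite ew; lia.
all: have := delta_mono t wi; rewrite ew => le.
all: case: (ltngtP (t i) i) => // [lt|]; last by lia.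
all: by have /val_inj/inj e := ti _ lt; move: lt; rewrite {1}e ltnn.
Qed.

(** * Extension over a cylinder, skeleton by skeleton *)

Section Skeleta.
Variables (Y : sset) (HY : kan_complex Y) (N : sset) (e : 'I_2).

Let fn := forall m, N m -> delta m 1 -> Y m.

Definition closed_under_smap (X : sset) (M : forall m, X m -> Prop) :=
  forall l m (g : delta l m) (x : X m), M m x -> M l (smap g x).

Definition cdom (M : forall m, N m -> Prop) m (x : N m) (b : delta m 1) : Prop :=
  M m x \/ forall i, b i = e.

Lemma cdom_smap M l m (g : delta l m) x b : closed_under_smap M ->
  cdom M x b -> cdom M (smap g x) (delta_comp b g).
Proof. by move=> hM [/hM|h]; [left|right=> i; rewrite dcompE]. Qed.

Definition cnat M (F : fn) := forall l m (g : delta l m) x b, cdom M x b ->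
  smap g (F m x b) = F l (smap g x) (delta_comp b g).

(** This is the [(r-1)]-skeleton; [sk 0] is empty. *)
Definition sk r m (x : N m) := exists q (y : N q) (s : delta m q), q < r /\ x = smap s y.

Lemma sk_closed r : closed_under_smap (@sk r).
Proof.
move=> l m g _ [q [y [s [qr ->]]]]; exists q, y, (delta_comp s g); split => //.
by rewrite smap_comp.
Qed.

Lemma nonsurj_sk r m (x : N r) (a : delta m r) : nonsurj a -> sk r (smap a x).
Proof.
case: r x a => [|r] x a [v hv].
  by move/missesP: hv => /(_ ord0); rewrite !ord1.
have [a' ->] := misses_factor hv.
by exists r, (smap (coface v) x), a'; rewrite smap_comp.
Qed.

(** An [r]-simplex outside [M] is nondegenerate with boundary in [M], so it contributes one prism to
    fill. Uniqueness of the Eilenberg-Zilber decomposition makes the separate fillers fit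
    together. *)
Lemma cell_step (M : forall m, N m -> Prop) r (F : fn) : closed_under_smap M ->
  (forall m (x : N m), sk r x -> M m x) -> cnat M F ->
  exists2 G : fn, cnat (fun m x => M m x \/ sk r.+1 x) G &
    forall m x b, cdom M x b -> G m x b = F m x b.
Proof.
move=> hM skM hF.
have /choice[W hW] : forall x : N r, exists W : forall m, delta m r -> delta m 1 -> Y m,
    (forall l m (g : delta l m) a b, smap g (W m a b) = W l (delta_comp a g) (delta_comp b g)) /\
    (forall m a b, pdom e a b -> W m a b = F m (smap a x) b).
  move=> x; apply: (prism_fill HY (F := fun m a b => F m (smap a x) b)) => l m g a b hab.
  rewrite smap_comp hF //; case: hab => [/nonsurj_sk h|]; [left|by right].
  exact/skM/h.
(* A section of [s] is also a section of [s'], since otherwise the simplex would come from the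
   [(r-1)]-skeleton, which lies in [M]. As [s] has sections through every vertex, this forces
   [s = s']. *)
have uniq m (x x' : N r) (s s' : delta m r) : smap s x = smap s' x' -> ~ M m (smap s x) -> x = x' /\ s = s'.
  move=> ess nM.
  have ss : ~ nonsurj s by move=> /nonsurj_sk h; apply/nM/skM/h.
  have sd d : delta_comp s d = delta_id r -> delta_comp s' d = delta_id r.
    move=> sd; apply: surj_endo => /nonsurj_sk h; apply: nM; apply: (hM).
    by apply: skM; rewrite -(smap_id x) -sd smap_comp ess -smap_comp; apply: h.
  split.
    have [d d1 _] := section_at ord0 ss.
    by rewrite -(smap_id x) -d1 smap_comp ess -smap_comp (sd _ d1) smap_id.
  apply: deltaP => i; have [d d1 d2] := section_at i ss.
  have := congr1 (fun f : delta r r => f (s i)) (sd _ d1).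
  by rewrite /= dcompE d2 delta_idE.
pose P m (y : N m) b z := exists x s, y = smap s x /\ z = W x m s b.
have exG m (y : N m) b : exists z, (cdom M y b -> z = F m y b) /\
    (~ cdom M y b -> sk r.+1 y -> P m y b z).
  case: (pselect (cdom M y b)) => h; first by exists (F m y b).
  case: (pselect (sk r.+1 y)) => h'; last by exists (F m y b).
  case: h' => q [x [s [qr ey]]].
  case: (ltngtP q r) => [qr'|qr'|qr'].
  - case: h; left; apply: skM; by exists q, x, s.
  - by lia.
  - by subst q; exists (W x m s b); split => // _ _; exists x, s.
have [G hG] : exists G : fn, forall m y b, (cdom M y b -> G m y b = F m y b) /\
    (~ cdom M y b -> sk r.+1 y -> P m y b (G m y b)).
  by exists (fun m y b => projT1 (cid (exG m y b))) => m y b; apply: projT2 (cid (exG m y b)).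
exists G => [l m g y b hyb|m y b]; last exact: (hG m y b).1.
case: (pselect (cdom M y b)) => [h|h].
  by rewrite (hG m y b).1 // (hG l _ _).1 ?hF //; apply: cdom_smap.
have sky : sk r.+1 y by case: hyb => [[My|//]|be]; [case: h; left|case: h; right].
have [x [s [ey ->]]] := (hG m y b).2 h sky.
rewrite (hW x).1; case: (pselect (cdom M (smap g y) (delta_comp b g))) => h'.
  rewrite (hG l _ _).1 // ey -smap_comp (hW x).2 //.
  apply: contrapT => hp; have ns : ~ nonsurj (delta_comp s g) by move=> ?; apply: hp; left.
  case: h' => [|?]; last by apply: hp; right.
  have [d d1 _] := section_at ord0 ns.
  rewrite ey -smap_comp => /(hM _ _ d); rewrite -smap_comp d1 smap_id => Mx.
  by apply: h; left; rewrite ey; apply: hM.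
have [x' [s' [ey' ->]]] := (hG l _ _).2 h' (sk_closed g sky).
have [||[-> ->] //] := uniq _ x x' (delta_comp s g) s'.
  by rewrite smap_comp -ey.
by rewrite smap_comp -ey => ?; apply: h'; left.
Qed.

Lemma cylinder_ext (M : forall m, N m -> Prop) (F : fn) : closed_under_smap M -> cnat M F ->
  exists2 G : fn, (forall l m (g : delta l m) x b, smap g (G m x b) = G l (smap g x) (delta_comp b g)) &
    forall m x b, cdom M x b -> G m x b = F m x b.
Proof.
move=> hM hF; pose Mr r m (x : N m) := M m x \/ sk r x.
have Mrc r : closed_under_smap (Mr r).
  by move=> l m g x [/hM|/sk_closed h]; [left|right; apply: h].
have step r (F' : {F' : fn | cnat (Mr r) F'}) : {G : {G : fn | cnat (Mr r.+1) G} |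
    forall m x b, cdom (Mr r) x b -> sval G m x b = sval F' m x b}.
  case: F' => F' hF' /=; apply: cid.
  have [|G hG e1] := cell_step (r := r) (Mrc r) _ hF'; first by right.
  unshelve eexists; first exists G => //.
    move=> l m g x b hx; apply: hG; case: hx => [[Mx|skx]|]; [left; left; left|left; right|right] => //.
  exact: e1.
have h0 : cnat (Mr 0) F.
  by move=> l m g x b hx; apply: hF; case: hx => [[|[q [y [s []]]]]|] //; [left|right].
pose S := fix S r : {F' : fn | cnat (Mr r) F'} :=
  if r is r'.+1 then projT1 (step r' (S r')) else exist _ F h0.
have SS r m x b : cdom (Mr r) x b -> sval (S r.+1) m x b = sval (S r) m x b.
  exact: (projT2 (step r (S r))).
have Mrle r r' m (x : N m) : r <= r' -> Mr r m x -> Mr r' m x.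
  move=> rr [|[q [y [s [qr ->]]]]]; first by left.
  by right; exists q, y, s; split => //; apply: leq_trans rr.
have Sle r r' m x b : r <= r' -> cdom (Mr r) x b -> sval (S r') m x b = sval (S r) m x b.
  move=> /subnK <-; elim: (r' - r) => // d IH hx; rewrite addSn SS ?IH //.
  by case: hx => [hx|]; [left; apply: Mrle hx; apply: leq_addl|right].
(* The value on an [m]-simplex no longer changes from stage [m.+1] on, which is where the limit
   reads it. *)
have skm m (x : N m) : Mr m.+1 m x.
  by right; exists m, x, (delta_id m); rewrite smap_id.
exists (fun m x b => sval (S m.+1) m x b).
  move=> l m g x b; rewrite (svalP (S m.+1)); last by left; apply: skm.
  case: (leqP l m) => lm; [|apply: esym]; apply: Sle; rewrite ?ltnS //; try exact: ltnW.
    by left; apply: skm.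
  by left; apply: Mrc; apply: skm.
move=> m x b hx; rewrite (Sle 0) //.
by case: hx => [hx|]; [left; left|right].
Qed.

End Skeleta.

(** * Exponentials and extensions along trivial cofibrations *)

Definition prod_sset (X Y : sset) : sset.
Proof.
refine (@SSet (fun n => (X n * Y n)%type) (fun _ _ f x => (smap f x.1, smap f x.2)) _ _).
- by move=> n [x y] /=; rewrite !smap_id.
- by move=> l m n f g [x y] /=; rewrite !smap_comp.
Defined.

Section HornProduct.
Variables (Y : sset) (HY : kan_complex Y) (K : sset) (L : forall m, K m -> Prop).
Variables (n : nat) (k : 'I_n.+2) (g : forall m, K m -> delta m n.+1 -> Y m).
Hypothesis Lc : closed_under_smap L.

Let hdom m (x : K m) (a : delta m n.+1) : Prop := L x \/ in_horn k a.

Hypothesis gnat : forall l m (h : delta l m) x a, hdom x a ->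
  smap h (g x a) = g (smap h x) (delta_comp a h).

(** [ret] shows the horn inclusion to be a retract of the inclusion of [horn x Delta^1] together
    with the end [e] into [Delta^(n+1) x Delta^1]. The problem becomes one of cylinders over
    [K x Delta^(n+1)], and the answer is read at the end [e']. *)
Lemma horn_prod_retract (e e' : 'I_2) (ret : forall m, delta m n.+1 -> delta m 1 -> delta m n.+1) :
  (forall l m (h : delta l m) a b,
     delta_comp (ret m a b) h = ret l (delta_comp a h) (delta_comp b h)) ->
  (forall m (a : delta m n.+1) b, in_horn k a -> in_horn k (ret m a b)) ->
  (forall m a (b : delta m 1), (forall i, b i = e) -> in_horn k (ret m a b)) ->
  (forall m a, ret m a (dconst m e') = a) ->
  exists G : forall m, K m -> delta m n.+1 -> Y m,
    (forall l m (h : delta l m) x a, smap h (G m x a) = G l (smap h x) (delta_comp a h)) /\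
    (forall m x a, hdom x a -> G m x a = g x a).
Proof.
move=> retn reth rete ret1.
pose N := prod_sset K (std_simplex n.+1).
pose M m (x : N m) : Prop := hdom x.1 x.2.
have hM : closed_under_smap M.
  by move=> l m h x [hL|hh]; [left; apply: Lc|right; apply: in_horn_comp].
pose F m (x : N m) (b : delta m 1) : Y m := g x.1 (ret m x.2 b).
have hF : cnat e M F.
  move=> l m h x b hx; rewrite /F gnat ?retn //.
  by case: hx => [[hL|hh]|be]; [left|right; apply: reth|right; apply: rete].
have [G hG1 hG2] := cylinder_ext HY hM hF.
exists (fun m x a => G m ((x, a) : N m) (dconst m e')); split.
  move=> l m h x a; rewrite hG1; congr (G _ _ _).
  by apply: deltaP => i; rewrite dcompE !dconstE.
by move=> m x a hx; rewrite hG2 /F /= ?ret1 //; left.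
Qed.

Let down_subproof m (a : delta m n.+1) (b : delta m 1) (i j : 'I_m.+1) : i <= j ->
  (inord (if b i == 0 :> nat then minn (a i) k else a i) : 'I_n.+2) <=
  (inord (if b j == 0 :> nat then minn (a j) k else a j) : 'I_n.+2).
Proof.
move=> ij; have := delta_mono a ij; have := delta_mono b ij.
have := ltn_ord (a i); have := ltn_ord (a j); move=> h1 h2 h3 h4.
by rewrite !inordK; case: eqP; try case: eqP; lia.
Qed.

Let up_subproof m (a : delta m n.+1) (b : delta m 1) (i j : 'I_m.+1) : i <= j ->
  (inord (if b i == 0 :> nat then a i : nat else maxn (a i) k) : 'I_n.+2) <=
  (inord (if b j == 0 :> nat then a j : nat else maxn (a j) k) : 'I_n.+2).
Proof.
move=> ij; have := delta_mono a ij; have := delta_mono b ij.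
have := ltn_ord (a i); have := ltn_ord (a j); have := ltn_ord k; move=> h1 h2 h3 h4 h5.
by rewrite !inordK; case: eqP; try case: eqP; lia.
Qed.

Lemma horn_prod_ext : exists G : forall m, K m -> delta m n.+1 -> Y m,
  (forall l m (h : delta l m) x a, smap h (G m x a) = G l (smap h x) (delta_comp a h)) /\
  (forall m x a, hdom x a -> G m x a = g x a).
Proof.
have kn := ltn_ord k.
(* If [k] is not the last vertex, the end 0 is squeezed onto the vertices up to [k] and misses the
   last one. If it is, the end 1 collapses to [k] and misses 0. *)
case: (ltnP k n.+1) => hk.
- pose ret m a b : delta m n.+1 := mk_delta (@down_subproof m a b).
  have retE m a b i : ret m a b i = (if b i == 0 :> nat then minn (a i) k else a i) :> nat.
    by rewrite mk_deltaE inordK //; have := ltn_ord (a i); case: eqP; lia.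
  apply: (@horn_prod_retract ord0 ord_max ret).
  + by move=> l m h a b; apply: deltaP => i; apply: val_inj; rewrite /= dcompE !retE !dcompE.
  + move=> m a b /in_hornP[j jk /missesP hj]; apply/in_hornP; exists j => //.
    have jk' : j <> k :> nat by move=> /val_inj.
    apply/missesP => i /(congr1 val); rewrite /= retE.
    by have : a i <> j :> nat by [move=> /val_inj /hj]; case: eqP; lia.
  + move=> m a b be; apply/in_hornP; exists ord_max => [/(congr1 val) /=|]; first by lia.
    by apply/missesP => i /(congr1 val); rewrite /= retE be /=; lia.
  + by move=> m a; apply: deltaP => i; apply: val_inj; rewrite /= retE dconstE.
- pose ret m a b : delta m n.+1 := mk_delta (@up_subproof m a b).
  have retE m a b i : ret m a b i = (if b i == 0 :> nat then a i : nat else maxn (a i) k) :> nat.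
    by rewrite mk_deltaE inordK //; have := ltn_ord (a i); case: eqP; lia.
  apply: (@horn_prod_retract ord_max ord0 ret).
  + by move=> l m h a b; apply: deltaP => i; apply: val_inj; rewrite /= dcompE !retE !dcompE.
  + move=> m a b /in_hornP[j jk /missesP hj]; apply/in_hornP; exists j => //.
    have jk' : j <> k :> nat by move=> /val_inj.
    apply/missesP => i /(congr1 val); rewrite /= retE.
    by have : a i <> j :> nat by [move=> /val_inj /hj]; case: eqP; lia.
  + move=> m a b be; apply/in_hornP; exists ord0 => [/(congr1 val) /=|]; first by lia.
    by apply/missesP => i /(congr1 val); rewrite /= retE be /=; lia.
  + by move=> m a; apply: deltaP => i; apply: val_inj; rewrite /= retE dconstE.
Qed.

End HornProduct.

Lemma sset_mapP (X Y : sset) (f g : sset_map X Y) : (forall n (x : X n), f n x = g n x) -> f = g.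
Proof.
case: f g => [f hf] [g hg] /= fg.
have e : f = g by apply: functional_extensionality_dep => n; apply: funext.
by subst g; congr SSetMap; apply: Prop_irrelevance.
Qed.

Section Exponential.
Variables K Y : sset.

Definition exp_simplex n := sset_map (prod_sset K (std_simplex n)) Y.

Definition exp_smap m n (f : delta m n) (u : exp_simplex n) : exp_simplex m.
Proof.
refine (@SSetMap (prod_sset K (std_simplex m)) Y
  (fun l x => u l ((x.1, delta_comp f x.2) : prod_sset K (std_simplex n) l)) _).
by move=> l' l g x /=; rewrite -sfun_nat /= delta_compA.
Defined.

Definition exp_sset : sset.
Proof.
refine (@SSet exp_simplex exp_smap _ _).
- by move=> n x; apply: sset_mapP => m [y a] /=; rewrite delta_id_comp.
- by move=> l m n f g x; apply: sset_mapP => j [y a] /=; rewrite delta_compA.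
Defined.

End Exponential.

Definition exp_res (K L Y : sset) (j : sset_map L K) : sset_map (exp_sset K Y) (exp_sset L Y).
Proof.
unshelve refine (@SSetMap (exp_sset K Y) (exp_sset L Y) (fun n u => _) _).
- refine (@SSetMap (prod_sset L (std_simplex n)) Y
    (fun m x => (u : exp_simplex K Y n) m ((j m x.1, x.2) : prod_sset K (std_simplex n) m)) _).
  by move=> l m g x /=; rewrite sfun_nat -[RHS]sfun_nat.
- by move=> m n f u; apply: sset_mapP.
Defined.

Lemma exp_res_fibration (K L Y : sset) (j : sset_map L K) (y0 : Y 0) : kan_complex Y ->
  (forall n, injective (j n)) -> kan_fibration (exp_res Y j).
Proof.
move=> HY jinj n k u v huv.
pose Lp m (x : K m) : Prop := exists l, x = j m l.
have Lc : closed_under_smap Lp.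
  by move=> l m h _ [x ->]; exists (smap h x); rewrite sfun_nat.
pose ev m (w : exp_simplex L Y m) (l : L m) := w m ((l, delta_id m) : prod_sset L (std_simplex m) m).
pose ev' m (w : exp_simplex K Y m) (x : K m) := w m ((x, delta_id m) : prod_sset K (std_simplex m) m).
have uE l m (h : delta l m) (a : delta m n.+1) (ha : in_horn k a) :
    u l (exist _ (delta_comp a h) (in_horn_comp h ha)) = smap h (u m (exist _ a ha)).
  rewrite -sfun_nat; congr (u l _); congr exist; exact: Prop_irrelevance.
have ex m (x : K m) (a : delta m n.+1) : exists y : Y m,
    (forall l, x = j m l -> y = ev m (v m a) l) /\
    (forall h : in_horn k a, y = ev' m (u m (exist _ a h)) x).
  case: (pselect (Lp m x)) => [[l0 e0]|nL].
    exists (ev m (v m a) l0); split=> [l|h]; first by rewrite e0 => /jinj ->.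
    by have := huv m (exist _ a h) => /= <- /=; rewrite /ev /ev' /= e0.
  case: (pselect (is_true (in_horn k a))) => h; last first.
    by exists (smap (delta_const m) y0); split=> [l e|//]; case: nL; exists l.
  exists (ev' m (u m (exist _ a h)) x); split=> [l e|h']; first by case: nL; exists l.
  by rewrite (Prop_irrelevance h h').
pose g m x a := projT1 (cid (ex m x a)).
have g1 m l a : g m (j m l) a = ev m (v m a) l by exact: (projT2 (cid (ex m (j m l) a))).1.
have g2 m x a h : g m x a = ev' m (u m (exist _ a h)) x by exact: (projT2 (cid (ex m x a))).2.
have [|G [G1 G2]] := horn_prod_ext HY (k := k) (g := g) Lc.
  move=> l m h x a [[y ->]|hh].
    rewrite -sfun_nat !g1 -[delta_comp a h]/(smap (s := std_simplex n.+1) h a).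
    by rewrite sfun_nat /ev -sfun_nat /= delta_id_comp delta_comp_id.
  rewrite (g2 _ _ _ hh) (g2 _ _ _ (in_horn_comp h hh)).
  by rewrite uE /ev' -sfun_nat /= delta_id_comp delta_comp_id.
pose w1 m (a : delta m n.+1) : exp_simplex K Y m := @SSetMap (prod_sset K (std_simplex m)) Y
  (fun l x => G l x.1 (delta_comp a x.2))
  (fun l' l h x => ltac:(by rewrite /= G1 delta_compA)).
pose w := @SSetMap (std_simplex n.+1) (exp_sset K Y) w1
  (fun m l h a => ltac:(by apply: sset_mapP => i [x b] /=; rewrite delta_compA)).
exists w; split.
  move=> m [a ha]; apply: sset_mapP => l [x b] /=.
  rewrite G2; last by right; apply: in_horn_comp.
  rewrite (g2 _ _ _ (in_horn_comp b ha)).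
  by rewrite uE /ev' /= delta_comp_id.
move=> m a; apply: sset_mapP => l [x b] /=.
rewrite G2; last by left; exists x.
rewrite g1 -[delta_comp a b]/(smap (s := std_simplex n.+1) b a) sfun_nat /ev /=.
by rewrite delta_comp_id.
Qed.

(** By adjunction [f] is a map [A -> Y^K] and [g] a map [A' -> Y^L]; they form a square from [i] to
    the fibration [Y^K -> Y^L], and [h] is its diagonal. *)
Lemma ext_cof (A A' K L Y : sset) (i : sset_map A A') (j : sset_map L K) (y0 : Y 0)
    (f : sset_map (prod_sset A K) Y) (g : sset_map (prod_sset A' L) Y) :
  trivial_cofibration i -> kan_complex Y -> (forall n, injective (j n)) ->
  (forall n (a : A n) (l : L n), f n (a, j n l) = g n (i n a, l)) ->
  exists h : sset_map (prod_sset A' K) Y,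
    (forall n (a : A n) (x : K n), h n (i n a, x) = f n (a, x)) /\
    (forall n (a : A' n) (l : L n), h n (a, j n l) = g n (a, l)).
Proof.
move=> Hi HY jinj fg.
pose u1 n (a : A n) : exp_simplex K Y n := @SSetMap (prod_sset K (std_simplex n)) Y
  (fun m x => f m ((smap x.2 a, x.1) : prod_sset A K m))
  (fun l m h x => ltac:(by rewrite -sfun_nat /= smap_comp)).
pose u := @SSetMap A (exp_sset K Y) u1
  (fun m n h a => ltac:(by apply: sset_mapP => l [x b] /=; rewrite smap_comp)).
pose v1 n (a : A' n) : exp_simplex L Y n := @SSetMap (prod_sset L (std_simplex n)) Y
  (fun m x => g m ((smap x.2 a, x.1) : prod_sset A' L m))
  (fun l m h x => ltac:(by rewrite -sfun_nat /= smap_comp)).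
pose v := @SSetMap A' (exp_sset L Y) v1
  (fun m n h a => ltac:(by apply: sset_mapP => l [x b] /=; rewrite smap_comp)).
have [|w [w1 w2]] := Hi _ _ _ (exp_res_fibration y0 HY jinj) u v.
  by move=> n a; apply: sset_mapP => m [x b] /=; rewrite fg sfun_nat.
unshelve eexists.
  refine (@SSetMap (prod_sset A' K) Y (fun n x => (w n x.1 : exp_simplex K Y n) n
    ((x.2, delta_id n) : prod_sset K (std_simplex n) n)) _).
  by move=> l m h [a x] /=; rewrite (sfun_nat w) -[RHS]sfun_nat /= delta_id_comp delta_comp_id.
split=> [n a x|n a l] /=.
  by rewrite w1 /= smap_id.
have := congr1 (fun z : exp_simplex L Y n => z n ((l, delta_id n) : prod_sset L (std_simplex n) n)) (w2 n a).
by rewrite /= smap_id.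
Qed.

(** * Homotopy groups of Kan complexes *)

Lemma smap_base (Y : sset) (y0 : Y 0) m n (f : delta m n) : smap f (base y0 n) = base y0 m.
Proof.
rewrite /base -smap_comp; congr (smap _ _); apply: deltaP => i.
by rewrite dcompE !mk_deltaE.
Qed.

Lemma base0 (Y : sset) (y0 : Y 0) : base y0 0 = y0.
Proof.
rewrite /base -[RHS]smap_id; congr (smap _ _); apply: deltaP => i.
by rewrite !mk_deltaE !ord1.
Qed.

Lemma sfun_base (X Y : sset) (f : sset_map X Y) (x0 : X 0) n : f n (base x0 n) = base (f 0 x0) n.
Proof. exact: sfun_nat. Qed.

Lemma face_face (Y : sset) n (w : Y n.+2) (i j : 'I_n.+2) (i' j' : 'I_n.+3) :
  i' = i :> nat -> j' = j.+1 :> nat -> i' < j' -> face i (face j' w) = face j (face i' w).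
Proof.
move=> ii jj ij; rewrite /face -!smap_comp; congr (smap _ _); apply: deltaP => x.
by apply: val_inj; rewrite /= !dcompE !cofaceE /bump; lia.
Qed.

Section Spheres.
Variables (Y : sset) (HY : kan_complex Y) (y0 : Y 0) (p : nat).

Notation sph := (spherical y0 (p := p)).
Notation e := (base y0 p.+1).

Lemma spherical_nonsurj m (x : Y p.+1) (a : delta m p.+1) : sph x -> nonsurj a ->
  smap a x = base y0 m.
Proof.
move=> hx [v hv]; have [a' ->] := misses_factor hv.
by rewrite smap_comp -[smap (coface v) x]/(face v x) hx smap_base.
Qed.

Lemma spherical_base : sph e.
Proof. by move=> k; apply: smap_base. Qed.

(** Faces of the prescribed simplices are all the base point, so compatibility is automatic; the
    faces of the missing face are among them. *)
Lemma sphere_fill (k : 'I_p.+3) (y : 'I_p.+3 -> Y p.+1) : (forall i, i <> k -> sph (y i)) ->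
  exists w, (forall i, i <> k -> face i w = y i) /\ sph (face k w).
Proof.
move=> hy; have [|w hw] := @face_fill Y HY p k y.
  by move=> i j i' j' ik jk _ _ _; rewrite !hy.
exists w; split => // i.
case: (ltnP i k) => ik.
  have kn : k.-1 < p.+2 by have := ltn_ord k; lia.
  have ne : widen_ord (leqnSn p.+2) i <> k by move=> /(congr1 val) /=; lia.
  rewrite (@face_face _ _ w i (Ordinal kn) (widen_ord (leqnSn p.+2) i)) //=; last by lia.
  by rewrite hw ?hy.
have kn : k < p.+2 by apply: leq_ltn_trans ik _.
have li : lift ord0 i = i.+1 :> nat by rewrite /= /bump; lia.
have ne : lift ord0 i <> k by move=> /(congr1 (@nat_of_ord _)); rewrite li; lia.
rewrite -(@face_face _ _ w (Ordinal kn) i k (lift ord0 i)) ?li //.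
by rewrite hw ?hy.
Qed.

(* For [u < v], [c u v] is the common face of the [u]-th and [v]-th faces of a [(p+3)]-simplex; [row c v]
   says that there is a [v]-th face. *)
Definition row (c : nat -> nat -> Y p.+1) (v : nat) : Prop :=
  exists w : Y p.+2, forall i : 'I_p.+3, face i w = if i < v then c i v else c v i.+1.

(** Two rows meet in the same entry of [c], so the given rows form a horn; row [k] is the missing
    face of a filler. *)
Lemma rows_fill c (k : 'I_p.+4) : (forall v : 'I_p.+4, v <> k -> row c v) -> row c k.
Proof.
move=> hr.
have ex (v : 'I_p.+4) : exists w : Y p.+2, v <> k ->
    forall i : 'I_p.+3, face i w = if i < v then c i v else c v i.+1.
  by case: (pselect (v = k)) => [vk|/hr[w hw]]; [exists (base y0 p.+2)|exists w].
have [y hy] := choice ex.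
have [|W hW] := @face_fill Y HY p.+1 k y.
  move=> i j i' j' ik jk ij ei ej; rewrite (hy _ jk) (hy _ ik).
  by rewrite ei ij /= ifF ?ej //; lia.
exists (face k W) => i; case: (ltnP i k) => ik.
  have kn : k.-1 < p.+3 by have := ltn_ord k; lia.
  have ne : widen_ord (leqnSn p.+3) i <> k by move=> /(congr1 val) /=; lia.
  rewrite (@face_face _ _ W i (Ordinal kn) (widen_ord (leqnSn p.+3) i)) //=; last by lia.
  by rewrite hW // hy //= ifF ?prednK //; lia.
have kn : k < p.+3 by apply: leq_ltn_trans ik _.
have li : lift ord0 i = i.+1 :> nat by rewrite /= /bump; lia.
have ne : lift ord0 i <> k by move=> /(congr1 (@nat_of_ord _)); rewrite li; lia.
rewrite -(@face_face _ _ W (Ordinal kn) i k (lift ord0 i)) ?li //.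
by rewrite hW // hy // li ltnS ik.
Qed.

(* In [pi_(p+1)], [tri j a0 a1 a2] means [a1 = a0 + a2] (up to the order of the terms). *)
Definition tri j (a0 a1 a2 : Y p.+1) : Prop :=
  exists w : Y p.+2, forall k : 'I_p.+3,
    face k w = if k == j :> nat then a0
               else if k == j.+1 :> nat then a1
               else if k == j.+2 :> nat then a2 else e.

Lemma tri_deg1 j x : j <= p -> sph x -> tri j x x e.
Proof.
move=> jp hx; exists (smap (codeg (inord j : 'I_p.+2)) x) => k.
rewrite /face -smap_comp.
have ej : (inord j : 'I_p.+2) = j :> nat by rewrite inordK //; lia.
case: eqP => [kj|kj]; first by rewrite codeg_coface ?smap_id // ej; left.
case: eqP => [kj'|kj']; first by rewrite codeg_coface ?smap_id // ej; right.
rewrite if_same; apply: spherical_nonsurj => //.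
exists (codeg (inord j) k); apply/missesP => i /(congr1 val); rewrite /= dcompE !codegE cofaceE ej /bump.
lia.
Qed.

Lemma tri_deg2 j x : j <= p -> sph x -> tri j e x x.
Proof.
move=> jp hx; exists (smap (codeg (inord j.+1 : 'I_p.+2)) x) => k.
rewrite /face -smap_comp.
have ej : (inord j.+1 : 'I_p.+2) = j.+1 :> nat by rewrite inordK //; lia.
have ns : k <> j.+1 :> nat -> k <> j.+2 :> nat -> smap (delta_comp (codeg (inord j.+1)) (coface k)) x = e.
  move=> k1 k2; apply: spherical_nonsurj => //.
  exists (codeg (inord j.+1) k); apply/missesP => i /(congr1 val).
  by rewrite /= dcompE !codegE cofaceE ej /bump; lia.
case: eqP => [kj|kj]; first by apply: ns; lia.
case: eqP => [kj'|kj']; first by rewrite codeg_coface ?smap_id // ej; left.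
case: eqP => [kj''|kj'']; first by rewrite codeg_coface ?smap_id // ej; right.
exact: ns.
Qed.

Section Tetra.
Variables (j : nat) (c01 c02 c03 c12 c13 c23 : Y p.+1).

Definition tetra_row (r : nat) : Prop :=
  match r with
  | 0 => tri j c01 c02 c03
  | 1 => tri j c01 c12 c13
  | 2 => tri j c02 c12 c23
  | _ => tri j c03 c13 c23
  end.

Let c (u v : nat) := if u == j then (if v == j.+1 then c01 else if v == j.+2 then c02
                             else if v == j.+3 then c03 else e)
  else if u == j.+1 then (if v == j.+2 then c12 else if v == j.+3 then c13 else e)
  else if u == j.+2 then (if v == j.+3 then c23 else e) else e.

Let t (r i : nat) := if i == j then (if r is 0 then c01 else if r is 1 then c01 else if r is 2 then c02 else c03)
  else if i == j.+1 then (if r is 0 then c02 else if r is 1 then c12 else if r is 2 then c12 else c13)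
  else if i == j.+2 then (if r is 0 then c03 else if r is 1 then c13 else c23) else e.

Let rowE r : r < 4 -> row c (j + r) <-> tetra_row r.
Proof.
move=> r4; have h (i : nat) : (if i < j + r then c i (j + r) else c (j + r) i.+1) = t r i.
  by rewrite /c /t; case: r r4 => [|[|[|[|//]]]] _;
    repeat (case: ltnP => ? || case: eqP => ?); try done; lia.
have {}h : row c (j + r) <-> exists w : Y p.+2, forall i : 'I_p.+3, face i w = t r i.
  by split=> -[w hw]; exists w => i; rewrite hw h.
by rewrite h /t; case: r r4 {h} => [|[|[|[|//]]]] _.
Qed.

(** A [(p+3)]-simplex with base faces except the four from [j] to [j+3]: any three of them determine
    a filler for the fourth. The group axioms below are instances, most of them with a degenerate
    row. *)
Lemma tetra k : j <= p -> k < 4 -> (forall r, r < 4 -> r <> k -> tetra_row r) -> tetra_row k.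
Proof.
move=> jp k4 h; apply/(rowE k4).
have kp : j + k < p.+4 by lia.
apply: (rows_fill (k := Ordinal kp)) => v vk.
have vk' : v <> j + k :> nat by move=> ev; apply: vk; apply: val_inj.
case: (boolP (j <= v < j + 4)) => hv.
  have -> : v = j + (v - j) :> nat by lia.
  by apply/rowE; [lia|apply: h; lia].
exists (base y0 p.+2) => i; rewrite /face smap_base /c.
by repeat (case: ltnP => ? || case: eqP => ?); try done; lia.
Qed.

End Tetra.

Lemma tetra_ind (P : nat -> Prop) k : (forall r, r < 4 -> r <> k -> P r) <->
  [/\ 0 <> k -> P 0, 1 <> k -> P 1, 2 <> k -> P 2 & 3 <> k -> P 3].
Proof.
split=> [h|[h0 h1 h2 h3] [|[|[|[|//]]]] _ //]; by split; apply: h.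
Qed.

Lemma tri_uniq j a b b' c : j <= p -> sph a -> tri j a b c -> tri j a b' c -> tri j e b' b.
Proof.
move=> jp ha h h'; apply: (@tetra j e a a b' b c 1) => //; apply/tetra_ind; split=> //= _.
exact: tri_deg2.
Qed.

Lemma tri_trans j x y z : j <= p -> tri j e x y -> tri j e x z -> tri j e y z.
Proof.
move=> jp h h'; apply: (@tetra j e e e x y z 3) => //; apply/tetra_ind; split=> //= _.
exact: tri_deg2 spherical_base.
Qed.

Lemma tri_sym j x y : j <= p -> sph x -> tri j e x y -> tri j e y x.
Proof. by move=> jp hx h; apply: tri_trans h _ => //; apply: tri_deg2. Qed.

Lemma tri_3 j a b c c' : j <= p -> sph a -> tri j a b c -> tri j e c c' -> tri j a b c'.
Proof.
move=> jp ha h h'; apply: (@tetra j a a e b c c' 2) => //; apply/tetra_ind; split=> //= _.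
exact: tri_deg1.
Qed.

Lemma tri_1 j a a' b c : j <= p -> sph b -> tri j a b c -> tri j e a a' -> tri j a' b c.
Proof.
move=> jp hb h h'; apply: (@tetra j e a a' b b c 3) => //; apply/tetra_ind; split=> //= _.
exact: tri_deg2.
Qed.

Lemma tri_assoc j a b c ab bc abc : j <= p -> tri j a ab b -> tri j b bc c -> tri j ab abc c ->
  tri j a abc bc.
Proof.
by move=> jp h1 h2 h3; apply: (@tetra j a ab b abc bc c 1) => //; apply/tetra_ind; split.
Qed.

Lemma homotopicE x y : homotopic y0 x y <-> tri p e x y.
Proof.
by split=> -[w hw]; exists w => k; rewrite hw; repeat (case: eqP => ?); try done; lia.
Qed.

(** [homotopic] insists on the last two faces. Comparing [tri i x y e] with the degenerate
    [tri i x x e] gives [tri i e x y], which moves the pair up by one position; iterating reaches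
    the end. *)
Lemma edge_homotopic j x y (w : Y p.+2) : j <= p.+1 -> sph x ->
  (forall k : 'I_p.+3, face k w = if k == j :> nat then x else if k == j.+1 :> nat then y else e) ->
  homotopic y0 x y.
Proof.
move=> jp hx hw.
have up i a b : i <= p -> sph a -> tri i a b e -> tri i e a b.
  by move=> ip ha h; apply: tri_uniq h (tri_deg1 ip ha).
have H d : forall i a b, d + i = p -> sph a -> tri i a b e -> homotopic y0 a b.
  elim: d => [|d IH] i a b dip ha h.
    have h' := up i a b (eq_leq dip) ha h.
    by have ei : i = p; [rewrite -dip|subst i; apply/homotopicE].
  have ip : i <= p by lia.
  have h' := up i a b ip ha h.
  apply: (IH i.+1) => //; first by lia.
  case: h' => v hv; exists v => k; rewrite hv.
  by repeat (case: eqP => ?); try done; lia.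
case: (ltnP j p.+1) => jp'.
  apply: (H (p - j) j) => //; first by lia.
  by exists w => k; rewrite hw if_same.
by have ej : j = p.+1; [lia|subst j; exists w].
Qed.

End Spheres.

(** * Maps that are homotopic on [B] agree on the homotopy groups of [Y] *)

Section HomotopyInvariance.
Variables (Y : sset) (HY : kan_complex Y) (y0 : Y 0) (p : nat).

Lemma spherical_map (f : sset_map Y Y) (x : Y p.+1) : f 0 y0 = y0 ->
  spherical y0 x -> spherical y0 (f p.+1 x).
Proof. by move=> f0 hx k; rewrite /face -sfun_nat -[smap _ x]/(face k x) hx sfun_base f0. Qed.

(** Decompose the prism over [x] into maximal simplices. As the faces of [x] are the base point,
    each has just two possibly nontrivial faces, consecutive sections [t j] and [t j.+1]. The
    section [t 0] is the end 1 and [t p.+2] the end 0. *)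
Lemma cylinder_homotopic (H : sset_map (prod_sset Y (std_simplex 1)) Y) (x : Y p.+1) :
  (forall m (b : delta m 1), H m (base y0 m, b) = base y0 m) -> spherical y0 x ->
  homotopic y0 (H p.+1 (x, dconst p.+1 ord_max)) (H p.+1 (x, dconst p.+1 ord0)).
Proof.
move=> Hb hx; pose t j := H p.+1 (x, cut p.+1 j).
have ts j : spherical y0 (t j).
  by move=> k; rewrite /face /t -sfun_nat /= -[smap _ x]/(face k x) hx Hb.
have step j : j <= p.+1 -> homotopic y0 (t j) (t j.+1).
  move=> jp; have jp2 : j < p.+2 by [].
  set J : 'I_p.+2 := Ordinal jp2.
  apply: (@edge_homotopic _ HY _ _ j _ _ (H p.+2 (smap (codeg J) x, cut p.+2 j.+1))) => // k.
  rewrite /face -sfun_nat /= -smap_comp.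
  have ck s : k = s :> nat -> s = j \/ s = j.+1 -> delta_comp (cut p.+2 j.+1) (coface k) = cut p.+1 s.
    by move=> ks sj; apply: deltaP => i; apply: val_inj; rewrite /= dcompE !cutE cofaceE /bump; lia.
  case: eqP => [kj|kj]; first by rewrite codeg_coface ?smap_id ?(ck j) //; left.
  case: eqP => [kj'|kj']; first by rewrite codeg_coface ?smap_id ?(ck j.+1) //; right.
  rewrite (spherical_nonsurj hx) ?Hb //.
  exists (codeg J k); apply/missesP => i /(congr1 val).
  by rewrite /= dcompE !codegE cofaceE /= /bump; lia.
have chain j : j <= p.+1 -> homotopic y0 (t 0) (t j.+1).
  elim: j => [|j IH] jp; first exact: step.
  have /homotopicE h1 := IH (ltnW jp); have /homotopicE h2 := step _ jp.
  apply/homotopicE; apply: (tri_trans HY (leqnn p) _ h2).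
  exact: tri_sym (leqnn p) (ts 0) h1.
have := chain p.+1 (leqnn _).
have -> : t 0 = H p.+1 (x, dconst p.+1 ord_max).
  by congr (H _ (_, _)); apply: deltaP => i; apply: val_inj; rewrite /= cutE dconstE.
have -> // : t p.+2 = H p.+1 (x, dconst p.+1 ord0).
congr (H _ (_, _)); apply: deltaP => i; apply: val_inj; rewrite /= cutE dconstE /=.
by have := ltn_ord i; lia.
Qed.

(** The boundary of the interval, as a discrete simplicial set. *)
Definition ends_sset : sset :=
  @SSet (fun _ => 'I_2) (fun _ _ _ x => x) (fun _ _ => erefl) (fun _ _ _ _ _ _ => erefl).

Definition ends_incl : sset_map ends_sset (std_simplex 1) :=
  @SSetMap ends_sset (std_simplex 1) (fun m v => dconst m v)
    (fun l m h v => ltac:(by apply: deltaP => i; rewrite dcompE !dconstE)).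

Lemma ends_incl_inj n : injective (ends_incl n).
Proof. by move=> v v' /(congr1 (fun f : delta n 1 => f ord0)); rewrite !dconstE. Qed.

(** The homotopy exists on [B] only; [ext_cof] with [K] the interval and [L] its boundary extends it
    to [Y] with [f] and [g] as prescribed ends. *)
Lemma ext_homotopic (B : sset) (b0 : B 0) (i : sset_map B Y) (f g : sset_map Y Y)
    (h : sset_map (prod_sset B (std_simplex 1)) Y) (x : Y p.+1) :
  trivial_cofibration i -> y0 = i 0 b0 ->
  (forall n b, h n (b, dconst n ord0) = f n (i n b)) ->
  (forall n b, h n (b, dconst n ord_max) = g n (i n b)) ->
  (forall n (c : delta n 1), h n (base b0 n, c) = base y0 n) ->
  spherical y0 x -> homotopic y0 (g p.+1 x) (f p.+1 x).
Proof.
move=> Hi ey h0 h1 hb hx.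
pose fg n (a : prod_sset Y ends_sset n) : Y n := if a.2 == ord0 then f n a.1 else g n a.1.
pose FG := @SSetMap (prod_sset Y ends_sset) Y fg
  (fun l m d a => ltac:(by rewrite /fg /=; case: eqP => _; rewrite sfun_nat)).
have [|H [H1 H2]] := @ext_cof B Y (std_simplex 1) ends_sset Y i ends_incl y0 h FG Hi HY ends_incl_inj.
  move=> n a l; rewrite /= /fg /=; case: eqP => [->|/eqP l0]; first exact: h0.
  rewrite -h1; congr (h _ (_, dconst _ _)); apply: val_inj => /=.
  by have := ltn_ord l; have : l <> 0 :> nat by [move=> e; move/eqP: l0; apply; apply: val_inj]; lia.
have -> : g p.+1 x = H p.+1 (x, dconst p.+1 ord_max) by rewrite H2.
have -> : f p.+1 x = H p.+1 (x, dconst p.+1 ord0) by rewrite H2.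
apply: cylinder_homotopic => // m b.
by rewrite {1}ey -sfun_base H1 hb.
Qed.

(** Extend the constant homotopy: two extensions to [Y] of the same map on [B] act alike on homotopy
    classes. *)
Lemma ext_homotopic_id (B : sset) (b0 : B 0) (i : sset_map B Y) (f g : sset_map Y Y) (x : Y p.+1) :
  trivial_cofibration i -> y0 = i 0 b0 -> f 0 y0 = y0 ->
  (forall n b, f n (i n b) = g n (i n b)) ->
  spherical y0 x -> homotopic y0 (g p.+1 x) (f p.+1 x).
Proof.
move=> Hi ey f0 fg hx.
pose h := @SSetMap (prod_sset B (std_simplex 1)) Y (fun n b => f n (i n b.1))
  (fun l m d a => ltac:(by rewrite /= !sfun_nat)).
apply: (@ext_homotopic B b0 i f g h) => // n c /=.
by rewrite sfun_base -ey sfun_base f0.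
Qed.

End HomotopyInvariance.

(** * Extending operations along a trivial cofibration *)

Definition point_sset : sset :=
  @SSet (fun _ => unit) (fun _ _ _ x => x) (fun _ _ => erefl) (fun _ _ _ _ _ _ => erefl).

Definition empty_sset : sset :=
  @SSet (fun _ => void) (fun _ _ _ x => x) (fun _ _ => erefl) (fun _ _ _ _ _ _ => erefl).

Definition from_empty (X : sset) : sset_map empty_sset X :=
  @SSetMap empty_sset X (fun _ x => match x with end) (fun _ _ _ x => match x with end).

Lemma ext_trivial (A A' K Y : sset) (i : sset_map A A') (y0 : Y 0) (f : sset_map (prod_sset A K) Y) :
  trivial_cofibration i -> kan_complex Y ->
  exists h : sset_map (prod_sset A' K) Y, forall n a x, h n (i n a, x) = f n (a, x).
Proof.
move=> Hi HY.
pose g := @SSetMap (prod_sset A' empty_sset) Y (fun _ x => match x.2 with end)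
  (fun _ _ _ x => match x.2 with end).
have [n []|n a []|h [h1 _]] := @ext_cof A A' K empty_sset Y i (from_empty K) y0 f g Hi HY.
by exists h.
Qed.

Lemma ext_unary (B Y : sset) (i : sset_map B Y) (y0 : Y 0) (f : sset_map B Y) :
  trivial_cofibration i -> kan_complex Y ->
  exists h : sset_map Y Y, forall n b, h n (i n b) = f n b.
Proof.
move=> Hi HY.
pose f' := @SSetMap (prod_sset B point_sset) Y (fun n b => f n b.1)
  (fun l m d a => ltac:(by rewrite /= sfun_nat)).
have [h hf] := ext_trivial y0 f' Hi HY.
unshelve eexists.
  refine (@SSetMap Y Y (fun n y => h n (y, tt)) _).
  by move=> l m d a; rewrite -sfun_nat.
by move=> n b; rewrite /= hf.
Qed.

(** One variable is extended at a time, from [B x B] to [Y x B] and then to [Y x Y]; the swaps bring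
    the variable to be extended to the front. *)
Lemma ext_binary (B Y : sset) (i : sset_map B Y) (y0 : Y 0) (f : sset_map (prod_sset B B) B) :
  trivial_cofibration i -> kan_complex Y ->
  exists h : sset_map (prod_sset Y Y) Y, forall n b b', h n (i n b, i n b') = i n (f n (b, b')).
Proof.
move=> Hi HY.
pose f1 := @SSetMap (prod_sset B B) Y (fun n b => i n (f n b))
  (fun l m d a => ltac:(by rewrite -!sfun_nat)).
have [h1 hf1] := ext_trivial y0 f1 Hi HY.
pose f2 := @SSetMap (prod_sset B Y) Y (fun n b => h1 n (b.2, b.1))
  (fun l m d a => ltac:(by rewrite -sfun_nat)).
have [h2 hf2] := ext_trivial y0 f2 Hi HY.
unshelve eexists.
  refine (@SSetMap (prod_sset Y Y) Y (fun n y => h2 n (y.2, y.1)) _).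
  by move=> l m d a; rewrite -sfun_nat.
by move=> n b b'; rewrite /= hf2 /= hf1.
Qed.

(** * An abelian group from the relation [tri], read as [b = a + c] *)

Section QuotientGroup.
Variables (S : Type) (T : S -> S -> S -> Prop) (e : S) (op : S -> S -> S).
Hypothesis T_mul : forall a c, exists b, T a b c.
Hypothesis T_inv : forall c, exists a, T a e c.
Hypothesis T_deg1 : forall x, T x x e.
Hypothesis T_deg2 : forall x, T e x x.
Hypothesis T_uniq : forall a b b' c, T a b c -> T a b' c -> T e b' b.
Hypothesis T_trans : forall x y z, T e x y -> T e x z -> T e y z.
Hypothesis T_1 : forall a a' b c, T a b c -> T e a a' -> T a' b c.
Hypothesis T_3 : forall a b c c', T a b c -> T e c c' -> T a b c'.
Hypothesis T_assoc : forall a b c ab bc abc, T a ab b -> T b bc c -> T ab abc c -> T a abc bc.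
Hypothesis op_T : forall a b c a' b' c', T a b c -> T a' b' c' -> T (op a a') (op b b') (op c c').
Hypothesis op_er : forall x, T e (op x e) x.
Hypothesis op_el : forall x, T e (op e x) x.

(** A class is stored as the predicate [T e x]; [{classic _}] provides the choice structure that a
    [zmodType] requires. *)
Let carrier := {classic {P : S -> Prop | exists x, P = T e x}}.
Let cls x : carrier := exist _ (T e x) (ex_intro _ x erefl).

Let T_sym x y : T e x y -> T e y x.
Proof. by move=> h; apply: T_trans h _. Qed.

Let clsE x y : cls x = cls y <-> T e x y.
Proof.
split=> [/(congr1 sval) /= h|h]; first by rewrite h.
apply: eq_exist => /=; apply: funext => z; apply/propext; split=> h'.
  exact: T_trans h h'.
exact: T_trans (T_sym h) h'.
Qed.

Let rep (u : carrier) : S := projT1 (cid (svalP u)).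

Let repK u : cls (rep u) = u.
Proof.
by case: u => P hP; apply: eq_exist => /=; rewrite /rep; case: cid => x /= ->.
Qed.

Let add (u v : carrier) : carrier := cls (projT1 (cid (T_mul (rep u) (rep v)))).
Let opp (u : carrier) : carrier := cls (projT1 (cid (T_inv (rep u)))).

Let addE a b c : T a b c -> cls b = add (cls a) (cls c).
Proof.
rewrite /add; case: cid => b' /= h' h; apply/clsE.
apply: (T_uniq h'); apply: T_3 (T_1 h _) _; apply/clsE; by rewrite repK.
Qed.

Let addA : associative add.
Proof.
move=> u v w; rewrite -(repK u) -(repK v) -(repK w).
have [ab h1] := T_mul (rep u) (rep v); have [bc h2] := T_mul (rep v) (rep w).
have [abc h3] := T_mul ab (rep w).
by rewrite -(addE h1) -(addE h2) -(addE h3) (addE (T_assoc h1 h2 h3)).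
Qed.

Let opE x y : cls (op x y) = add (cls x) (cls y).
Proof.
rewrite (addE (op_T (T_deg1 x) (T_deg2 y))).
by rewrite (proj2 (clsE _ _) (op_er x)) (proj2 (clsE _ _) (op_el y)).
Qed.

(* Eckmann-Hilton *)
Let addC : commutative add.
Proof.
move=> u v; rewrite -(repK u) -(repK v) -opE (addE (op_T (T_deg2 (rep u)) (T_deg1 (rep v)))).
by rewrite (proj2 (clsE _ _) (op_er _)) (proj2 (clsE _ _) (op_el _)).
Qed.

Let add0 : left_id (cls e) add.
Proof. by move=> u; rewrite -(repK u) -(addE (T_deg2 (rep u))). Qed.

Let addN : left_inverse (cls e) opp add.
Proof.
move=> u; rewrite /opp; case: cid => a /= h.
by rewrite -{1}(repK u) -(addE h).
Qed.

Lemma quotient_group : exists (V : zmodType) (c : S -> V),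
  [/\ forall v, exists x, c x = v, forall x y, c x = c y <-> T e x y,
      forall x y z, T x y z -> c y = (c x + c z)%R &
      forall x y, c (op x y) = (c x + c y)%R].
Proof.
pose zm := GRing.isZmodule.Build carrier addA addC add0 addN.
exists (HB.pack_for zmodType {classic {P : S -> Prop | exists x, P = T e x}} zm), cls; split=> [v|x y|x y z|x y].
- by exists (rep v); apply: repK.
- exact: clsE.
- exact: addE.
- exact: opE.
Qed.

End QuotientGroup.

Section ScaledModule.
Variables (V : zmodType) (sc : rat -> V -> V).
Hypothesis scA : forall a b v, sc a (sc b v) = sc (a * b)%R v.
Hypothesis sc1 : left_id 1%R sc.
Hypothesis scDr : right_distributive sc +%R.
Hypothesis scDl : forall v, {morph sc^~ v : a b / (a + b)%R}.

(** The laws are recorded in the type so that a module instance can be attached to it. *)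
Definition scaled_module : Type := let _ := (scA, sc1, scDr, scDl) in V.
HB.instance Definition _ := GRing.Zmodule.copy scaled_module V.
HB.instance Definition _ :=
  GRing.Zmodule_isLmodule.Build rat scaled_module scA sc1 scDr scDl.

Definition scaled_lmod : lmodType rat := scaled_module.

End ScaledModule.

(** Unique divisibility makes [sc a v] the only solution [u] of [u *~ denq a = v *~ numq a]; the
    axioms are checked after multiplication by a common denominator. *)
Lemma divisible_lmod (V : zmodType) :
  (forall n (v : V), exists u, (u *+ n.+1 = v)%R) ->
  (forall n (u : V), (u *+ n.+1 = 0)%R -> u = 0%R) ->
  exists (W : lmodType rat) (f : V -> W),
    [/\ injective f, forall w, exists v, f v = w & forall u v, f (u + v)%R = (f u + f v)%R].
Proof.
move=> hdiv htor.
have dv (d : int) (v : V) : d != 0%R -> exists u, (u *~ d = v)%R.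
  case: d => [[//|n]|n] _; first exact: hdiv.
  have [u hu] := hdiv n v; exists (- u)%R.
  by rewrite NegzE mulrNz mulNrz opprK.
have can (d : int) (u v : V) : d != 0%R -> (u *~ d = v *~ d)%R -> u = v.
  move=> d0 /eqP; rewrite -subr_eq0 -mulrzBl => /eqP h; apply/eqP; rewrite -subr_eq0; apply/eqP.
  case: d d0 h => [[//|n]|n] _ h; first exact: htor h.
  by apply: (htor n); move: h; rewrite NegzE mulrNz => /eqP; rewrite oppr_eq0 => /eqP.
have ex (a : rat) (v : V) : exists u, (u *~ denq a = v *~ numq a)%R by apply: dv; apply: denq_neq0.
pose sc a v := projT1 (cid (ex a v)).
have scq a v : (sc a v *~ denq a = v *~ numq a)%R := projT2 (cid (ex a v)).
have scE (a : rat) v (n d : int) : d != 0%R -> (a = n%:~R / d%:~R)%R -> (sc a v *~ d = v *~ n)%R.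
  move=> d0 ea; apply: (can (denq a)); first exact: denq_neq0.
  rewrite mulrzAC scq -!mulrzA; congr (_ *~ _)%R.
  apply: (@intr_inj rat); rewrite !intrM; apply/eqP.
  have d0' : d%:~R%R != 0%R :> rat by rewrite intr_eq0.
  have dq0 : (denq a)%:~R%R != 0%R :> rat by rewrite intr_eq0 denq_neq0.
  by rewrite -eqr_div // divq_num_den ea.
have dq0 (a : rat) : (denq a)%:~R%R != 0%R :> rat by rewrite intr_eq0 denq_neq0.
have ae (a : rat) : a = ((numq a)%:~R / (denq a)%:~R)%R by rewrite divq_num_den.
have scA a b v : sc a (sc b v) = sc (a * b)%R v.
  apply: (can (denq a * denq b)%R); first by rewrite mulf_neq0 ?denq_neq0.
  rewrite [RHS](scE _ _ (numq b * numq a)%R) ?mulf_neq0 ?denq_neq0 //.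
    by rewrite mulrzA scq mulrzAC scq mulrzA.
  by rewrite {1}(ae a) {1}(ae b) !intrM; field; rewrite !dq0.
have sc1 : left_id 1%R sc by move=> v; have := scE 1%R v 1%R 1%R isT (erefl _); rewrite !mulr1z.
have scDr : right_distributive sc +%R.
  move=> a u v; apply: (can (denq a)); first exact: denq_neq0.
  by rewrite scq !mulrzDl !scq.
have scDl v : {morph sc^~ v : a b / (a + b)%R}.
  move=> a b; apply: (can (denq a * denq b)%R); first by rewrite mulf_neq0 ?denq_neq0.
  rewrite (scE (a + b)%R v (numq a * denq b + numq b * denq a)%R) ?mulf_neq0 ?denq_neq0 //.
    rewrite mulrzDr mulrzDl !mulrzA (scq a); congr (_ + _)%R.
    by rewrite [RHS]mulrzAC (scq b).
  by rewrite {1}(ae a) {1}(ae b) intrD !intrM; field; rewrite !dq0.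
by exists (scaled_lmod scA sc1 scDr scDl), id; split=> // w; exists w.
Qed.

(** * Homotopy groups of a unital simplicial magma *)

Section UnitalMagma.
Variables (B : sset) (b0 : B 0) (sum : sset_map (prod_sset B B) B).
Hypothesis sum_r : forall n (b : B n), sum n (b, base b0 n) = b.
Hypothesis sum_l : forall n (b : B n), sum n (base b0 n, b) = b.
Variables (Y : sset) (i : sset_map B Y) (p : nat).
Hypothesis Hi : trivial_cofibration i.
Hypothesis HY : kan_complex Y.

Definition pointed (f : sset_map B B) : Prop := f 0 b0 = b0.

Definition pointed_homotopy (h : sset_map (prod_sset B (std_simplex 1)) B) : Prop :=
  forall n (c : delta n 1), h n (base b0 n, c) = base b0 n.

(** [star f] is the endomorphism of [pi_(p+1)(Y)] induced by a chosen extension of [f]. It is a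
    total function of [f], and its laws are asserted for pointed maps. *)
Lemma magma_homotopy_group : exists (V : zmodType) (phi : Y p.+1 -> V) (star : sset_map B B -> V -> V),
  [/\ presents_homotopy_group (i 0 b0) phi,
      forall f, pointed f -> forall u v, star f (u + v)%R = (star f u + star f v)%R,
      forall f h, pointed f -> pointed_homotopy h ->
        (forall n b, h n (b, dconst n ord0) = f n b) -> (forall n b, h n (b, dconst n ord_max) = b) ->
        forall v, star f v = v &
      forall f g g' h, pointed f -> pointed g -> pointed g' -> pointed_homotopy h ->
        (forall n b, h n (b, dconst n ord0) = f n b) ->
        (forall n b, h n (b, dconst n ord_max) = sum n (g n b, g' n b)) ->
        forall v, star f v = (star g v + star g' v)%R].
Proof.
set y0 := i 0 b0.
have [S hS] := ext_binary y0 sum Hi HY.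
have /choice[F hF] : forall f : sset_map B B, exists F : sset_map Y Y, forall n b, F n (i n b) = i n (f n b).
  move=> f; pose f' := @SSetMap B Y (fun n b => i n (f n b)) (fun l m d a => ltac:(by rewrite -!sfun_nat)).
  exact: (ext_unary y0 f' Hi HY).
have F0 f : pointed f -> F f 0 y0 = y0 by move=> hf; rewrite hF hf.
have iB n : base y0 n = i n (base b0 n) by rewrite sfun_base.
have S0 n : S n (base y0 n, base y0 n) = base y0 n by rewrite iB hS sum_r.
pose sph := {x : Y p.+1 | spherical y0 x}.
pose sv (x : sph) : Y p.+1 := proj1_sig x.
have svP (x : sph) : spherical y0 (sv x) := proj2_sig x.
have Sf n (k : 'I_n.+2) x y : face k (S n.+1 (x, y)) = S n (face k x, face k y) by rewrite /face -sfun_nat.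
have opP (x y : sph) : spherical y0 (S p.+1 (sv x, sv y)).
  by move=> k; rewrite Sf !svP S0.
pose op (x y : sph) : sph := exist _ _ (opP x y).
pose e : sph := exist _ _ (@spherical_base Y y0 p).
pose T (a b c : sph) := tri y0 p (sv a) (sv b) (sv c).
have pp := leqnn p.
have T_mul a c : exists b, T a b c.
  pose y (k : 'I_p.+3) := if k == p :> nat then sv a else if k == p.+2 :> nat then sv c else base y0 p.+1.
  have hy k : k <> inord p.+1 -> spherical y0 (y k).
    by move=> _; rewrite /y; case: ifP => _; [exact: svP|case: ifP => _; [exact: svP|exact: spherical_base]].
  have [w [w1 w2]] := sphere_fill HY hy.
  exists (exist _ _ w2), w => k; case: (eqVneq (k : nat) p.+1) => kp.
    rewrite ifF; last by apply/eqP; lia.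
    congr (face _ w); apply: val_inj; by rewrite /= inordK.
  rewrite w1 //; by move=> kk; move: kp; rewrite kk inordK // eqxx.
have T_inv c : exists a, T a e c.
  pose y (k : 'I_p.+3) := if k == p.+2 :> nat then sv c else base y0 p.+1.
  have hy k : k <> inord p -> spherical y0 (y k).
    by move=> _; rewrite /y; case: ifP => _; [exact: svP|exact: spherical_base].
  have [w [w1 w2]] := sphere_fill HY hy.
  have ip : (inord p : 'I_p.+3) = p :> nat by rewrite inordK //; lia.
  exists (exist _ _ w2), w => k; case: (eqVneq (k : nat) p) => kp.
    by congr (face _ w); apply: val_inj; rewrite /= ip.
  rewrite w1; last by move=> kk; move: kp; rewrite kk ip eqxx.
  by move/eqP: kp => kp; rewrite /y; repeat (case: eqP => ?); try done; lia.
have T_op a b c a' b' c' : T a b c -> T a' b' c' -> T (op a a') (op b b') (op c c').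
  move=> [w hw] [w' hw']; exists (S p.+2 (w, w')) => k; rewrite Sf hw hw'.
  by do 3 case: eqP => _ //.
(* The extended sum is unital on [Y] only up to homotopy: adding the base point and the identity
   agree on [B], where the unit is strict. *)
have op_er x : T e (op x e) x.
  pose g := @SSetMap Y Y (fun n y => S n (y, base y0 n))
    (fun l m d a => ltac:(by rewrite -sfun_nat /= smap_base)).
  pose f := @SSetMap Y Y (fun n y => y) (fun l m d a => erefl).
  apply/homotopicE; apply: (@ext_homotopic_id Y HY y0 p B b0 i f g) => //= n b.
  by rewrite iB hS sum_r.
have op_el x : T e (op e x) x.
  pose g := @SSetMap Y Y (fun n y => S n (base y0 n, y))
    (fun l m d a => ltac:(by rewrite -sfun_nat /= smap_base)).
  pose f := @SSetMap Y Y (fun n y => y) (fun l m d a => erefl).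
  apply/homotopicE; apply: (@ext_homotopic_id Y HY y0 p B b0 i f g) => //= n b.
  by rewrite iB hS sum_l.
have [V [c [c1 c2 c3 c4]]] := @quotient_group sph T e op T_mul T_inv
  (fun x => tri_deg1 pp (svP x)) (fun x => tri_deg2 pp (svP x))
  (fun a b b' c => tri_uniq HY pp (svP a) (b := sv b) (b' := sv b') (c := sv c))
  (fun x y z => tri_trans HY pp (x := sv x) (y := sv y) (z := sv z))
  (fun a a' b c => tri_1 HY pp (a := sv a) (a' := sv a') (c := sv c) (svP b))
  (fun a b c c' => tri_3 HY pp (b := sv b) (c := sv c) (c' := sv c') (svP a))
  (fun a b c ab bc abc => tri_assoc HY pp (a := sv a) (b := sv b) (c := sv c) (ab := sv ab)
     (bc := sv bc) (abc := sv abc)) T_op op_er op_el.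
pose phi x : V := if pselect (spherical y0 x) is left h then c (exist _ x h) else 0%R.
have phiE (x : sph) : phi (sv x) = c x.
  rewrite /phi; case: pselect => [h|[]]; last exact: svP.
  by congr c; case: x h => x hx h; apply: eq_exist.
have phi_eq x y : spherical y0 x -> spherical y0 y -> phi x = phi y <-> homotopic y0 x y.
  move=> hx hy; rewrite (phiE (exist _ x hx)) (phiE (exist _ y hy)).
  by rewrite c2; apply: iff_sym; apply: homotopicE.
have phi_tri a b d : spherical y0 a -> spherical y0 b -> spherical y0 d -> tri y0 p a b d ->
    phi b = (phi a + phi d)%R.
  move=> ha hb hd h; rewrite (phiE (exist _ a ha)) (phiE (exist _ b hb)) (phiE (exist _ d hd)).
  exact: c3.
have phi_S a b : spherical y0 a -> spherical y0 b -> phi (S p.+1 (a, b)) = (phi a + phi b)%R.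
  move=> ha hb; rewrite (phiE (exist _ a ha)) (phiE (exist _ b hb)) -c4.
  exact: (phiE (op (exist _ a ha) (exist _ b hb))).
have Ftri f (a b d : Y p.+1) : pointed f -> tri y0 p a b d -> tri y0 p (F f _ a) (F f _ b) (F f _ d).
  move=> hf [w hw]; exists (F f _ w) => k; rewrite /face -sfun_nat -[smap _ w]/(face k w) hw.
  by do 3 case: eqP => _ //; rewrite sfun_base F0.
have Fbase f n : pointed f -> F f n (base y0 n) = base y0 n by move=> hf; rewrite sfun_base F0.
have Fsph f x : pointed f -> spherical y0 x -> spherical y0 (F f p.+1 x).
  by move=> hf; apply: spherical_map; apply: F0.
have [rep hrep] := choice c1.
pose star f v := phi (F f p.+1 (sv (rep v))).
have starE f (x : sph) : pointed f -> star f (c x) = phi (F f p.+1 (sv x)).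
  move=> hf; apply/phi_eq; [exact: Fsph|exact: Fsph|].
  have /c2 := hrep (c x); move=> /(Ftri f _ _ _ hf); rewrite Fbase //.
  by move=> h; apply/homotopicE.
exists V, phi, star; split.
- split=> [a|x y|x y z hx hy hz h].
  + by have [x <-] := c1 a; exists (sv x); [exact: svP|exact: phiE].
  + exact: phi_eq.
  + exact: (phi_tri x z y).
- move=> f hf u v; have [x <-] := c1 u; have [y <-] := c1 v.
  have [z hz] := T_mul x y; rewrite -(c3 _ _ _ hz) !starE //.
  by apply: phi_tri; [exact: Fsph|exact: Fsph|exact: Fsph|exact: Ftri].
- move=> f h hf hh h0 h1 v; have [x <-] := c1 v; rewrite starE // -[RHS]phiE.
  apply: esym; apply/phi_eq; [exact: svP|exact: Fsph|].
  pose g := @SSetMap Y Y (fun n y => y) (fun l m d a => erefl).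
  pose ih := @SSetMap (prod_sset B (std_simplex 1)) Y (fun n a => i n (h n a))
    (fun l m d a => ltac:(by rewrite -!sfun_nat)).
  apply: (@ext_homotopic Y HY y0 p B b0 i (F f) g ih) => //= n b.
  + by rewrite h0 hF.
  + by rewrite h1.
  + by rewrite hh iB.
- move=> f g g' h hf hg hg' hh h0 h1 v; have [x <-] := c1 v; rewrite !starE //.
  rewrite -phi_S; [|exact: Fsph|exact: Fsph].
  apply: esym; apply/phi_eq; [|exact: Fsph|].
    exact: (opP (exist _ _ (Fsph g _ hg (svP x))) (exist _ _ (Fsph g' _ hg' (svP x)))).
  pose gg := @SSetMap Y Y (fun n y => S n (F g n y, F g' n y))
    (fun l m d a => ltac:(by rewrite -sfun_nat /= !sfun_nat)).
  pose ih := @SSetMap (prod_sset B (std_simplex 1)) Y (fun n a => i n (h n a))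
    (fun l m d a => ltac:(by rewrite -!sfun_nat)).
  apply: (@ext_homotopic Y HY y0 p B b0 i (F f) gg ih) => //= n b.
  + by rewrite h0 hF.
  + by rewrite h1 !hF hS.
  + by rewrite hh iB.
Qed.

End UnitalMagma.

Local Open Scope ring_scope.

Definition ind (P : Prop) : rat := if `[< P >] then 1 else 0.

Lemma ind1 P : P -> ind P = 1.
Proof. by move=> p; rewrite /ind asboolT. Qed.

Lemma ind0 P : ~ P -> ind P = 0.
Proof. by move=> p; rewrite /ind asboolF. Qed.

Lemma ind_iff P Q : (P <-> Q) -> ind P = ind Q.
Proof. by move=> h; congr ind; apply/propext. Qed.

Lemma indM P Q : ind P * ind Q = ind (P /\ Q).
Proof.
case: (pselect P) => p; last by rewrite (ind0 p) mul0r ind0 // => -[].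
by rewrite (ind1 p) mul1r; apply: ind_iff; split=> // -[].
Qed.

Lemma ind_mul_eq P (a b : rat) : (P -> a = b) -> ind P * a = ind P * b.
Proof. by case: (pselect P) => [p -> //|p _]; rewrite ind0 // !mul0r. Qed.

(** * Regularised summation over words *)

Notation word n := (seq 'I_n.+2).

(** [take k] leaves shorter words unchanged, so such a function can isolate a word of length below
    [k], whereas a word of length [k] is not separated from its extensions. *)
Definition cylindrical n k (f : word n -> rat) := forall w, f w = f (take k w).

(* The cylinder of all words extending a given one has mass [-1/(n+1)]: this is the only mass
   [m] such that [m = 1 + (n + 2) m]. *)
Fixpoint lint n k (f : word n -> rat) : rat :=
  if k is k'.+1 then f [::] + \sum_(i < n.+2) lint k' (fun w => f (i :: w))
  else - (n.+1)%:R^-1 * f [::].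

(** The bound chosen here is immaterial by [lint_le]; 0 is a default outside the cylindrical
    functions. *)
Definition wint n (f : word n -> rat) : rat :=
  if pselect (exists k, cylindrical k f) is left h then lint (projT1 (cid h)) f else 0.

Lemma cylindricalS n k (f : word n -> rat) : cylindrical k f -> cylindrical k.+1 f.
Proof. by move=> h w; rewrite h [in RHS]h take_takel. Qed.

Lemma cylindrical_le n k l (f : word n -> rat) : (k <= l)%N -> cylindrical k f -> cylindrical l f.
Proof. by move=> /subnK <-; elim: (l - k)%N => // d IH /IH /cylindricalS. Qed.

Lemma cylindrical_cons n k (f : word n -> rat) i :
  cylindrical k f -> cylindrical k (fun w => f (i :: w)).
Proof. by move=> /cylindricalS h w; rewrite h. Qed.

Lemma cylindrical_consS n k (f : word n -> rat) i :
  cylindrical k.+1 f -> cylindrical k (fun w => f (i :: w)).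
Proof. by move=> h w; rewrite h. Qed.

(** At depth 0 this is the equation [m = 1 + (n + 2) m]; greater depths follow letter by letter. *)
Lemma lint_stable n k (f : word n -> rat) : cylindrical k f -> lint k.+1 f = lint k f.
Proof.
elim: k f => [|k IH] f h; last first.
  rewrite [LHS]/= [RHS]/=; congr (_ + _); apply: eq_bigr => i _.
  by apply: IH; apply: cylindrical_consS.
rewrite /= (eq_bigr (fun=> - (n.+1)%:R^-1 * f [::])) => [|i _]; last first.
  by rewrite (h [:: i]).
have e : (n.+2)%:R = (n.+1)%:R + 1 :> rat by rewrite -[n.+2]addn1 natrD.
rewrite sumr_const card_ord -[X in _ + X = _]mulr_natr e {e}; move: (f [::]) => x.
have n0 : (n.+1)%:R != 0 :> rat by rewrite Num.Theory.pnatr_eq0.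
by move: (n.+1)%:R n0 => a a0; field.
Qed.

Lemma lint_le n k l (f : word n -> rat) : (k <= l)%N -> cylindrical k f -> lint l f = lint k f.
Proof.
move=> /subnK <-; elim: (l - k)%N => // d IH h; rewrite addSn lint_stable ?IH //.
by apply: cylindrical_le h; rewrite leq_addl.
Qed.

Lemma wintE n k (f : word n -> rat) : cylindrical k f -> wint f = lint k f.
Proof.
move=> h; rewrite /wint; case: pselect => [e|[]]; last by exists k.
case: (cid e) => l hl /=.
by case: (leqP k l) => kl; [rewrite (lint_le kl)|rewrite (lint_le (ltnW kl))].
Qed.

Lemma wint_rec n k (f : word n -> rat) : cylindrical k f ->
  wint f = f [::] + \sum_(i < n.+2) wint (fun w => f (i :: w)).
Proof.
move=> h; rewrite (wintE (cylindricalS h)) /=; congr (_ + _); apply: eq_bigr => i _.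
by rewrite (wintE (cylindrical_cons _ h)).
Qed.

Lemma lint_add n k (f g : word n -> rat) : lint k (fun w => f w + g w) = lint k f + lint k g.
Proof.
elim: k f g => [|k IH] f g /=; first by rewrite mulrDr.
by under eq_bigr do rewrite IH; rewrite big_split /= addrACA.
Qed.

Lemma lint_scale n k a (f : word n -> rat) : lint k (fun w => a * f w) = a * lint k f.
Proof.
elim: k f => [|k IH] f /=; first by rewrite mulrCA.
by under eq_bigr do rewrite IH; rewrite -mulr_sumr mulrDr.
Qed.

Lemma cylindrical_add n k l (f g : word n -> rat) : cylindrical k f -> cylindrical l g ->
  cylindrical (maxn k l) (fun w => f w + g w).
Proof.
move=> /(cylindrical_le (leq_maxl k l)) hf /(cylindrical_le (leq_maxr k l)) hg w.
by rewrite -hf -hg.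
Qed.

Lemma cylindrical_mul n k l (f g : word n -> rat) : cylindrical k f -> cylindrical l g ->
  cylindrical (maxn k l) (fun w => f w * g w).
Proof.
move=> /(cylindrical_le (leq_maxl k l)) hf /(cylindrical_le (leq_maxr k l)) hg w.
by rewrite -hf -hg.
Qed.

Lemma cylindrical_cst n a : cylindrical 0 (fun _ : word n => a).
Proof. by []. Qed.

Lemma wint_add n k l (f g : word n -> rat) : cylindrical k f -> cylindrical l g ->
  wint (fun w => f w + g w) = wint f + wint g.
Proof.
move=> hf hg; rewrite (wintE (cylindrical_add hf hg)) lint_add.
by rewrite -(wintE (cylindrical_le (leq_maxl k l) hf)) -(wintE (cylindrical_le (leq_maxr k l) hg)).
Qed.

Lemma wint_scale n k a (f : word n -> rat) : cylindrical k f ->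
  wint (fun w => a * f w) = a * wint f.
Proof.
move=> hf; rewrite (wintE hf) -lint_scale; apply: wintE.
by move=> w; rewrite -hf.
Qed.

Lemma wint0 n : wint (fun _ : word n => 0) = 0.
Proof.
by rewrite -[RHS](mul0r (wint (fun _ : word n => 0))) -(@wint_scale n 0) //;
   congr wint; apply: funext => w; rewrite mul0r.
Qed.

(** One letter past [size a] has to be inspected in order to see that the word stops there. *)
Lemma cylindrical_dirac n (a : word n) h :
  cylindrical (size a).+1 (fun y => ind (a = y) * h y).
Proof.
move=> w; case: (leqP (size w) (size a).+1) => [s|s]; first by rewrite take_oversize.
have ne v : (size a < size v)%N -> ind (a = v) = 0.
  by move=> av; rewrite ind0 // => e; rewrite e ltnn in av.
by rewrite !ne ?mul0r ?size_takel // ltnW // ltnW.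
Qed.

(** A single word has mass 1. This is what makes the diagonal a unit for the composition of
    kernels. *)
Lemma wint_dirac n (a : word n) h : wint (fun y => ind (a = y) * h y) = h a.
Proof.
elim: a h => [|i a IH] h; rewrite (wint_rec (cylindrical_dirac _ _)).
  rewrite ind1 // mul1r big1 ?addr0 // => i _.
  rewrite -[RHS](wint0 n); congr wint; apply: funext => w.
  by rewrite ind0 ?mul0r.
rewrite ind0 // mul0r add0r (bigD1 i) //= big1 ?addr0 => [|j ji].
  rewrite -(IH (fun w => h (i :: w))); congr wint; apply: funext => w.
  by congr (_ * _); apply: ind_iff; split=> [[]|->].
rewrite -[RHS](wint0 n); congr wint; apply: funext => w.
by rewrite ind0 ?mul0r // => -[ij _]; rewrite ij eqxx in ji.
Qed.

(** * Codes and tame functions *)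

Inductive code := c0 | c1 | cX of nat | cS of code & code | cP of code & code.

Fixpoint El (c : code) : Type :=
  match c with
  | c0 => void
  | c1 => unit
  | cX n => word n
  | cS c d => (El c + El d)%type
  | cP c d => (El c * El d)%type
  end.

Fixpoint intg (c : code) : (El c -> rat) -> rat :=
  match c return (El c -> rat) -> rat with
  | c0 => fun f => 0
  | c1 => fun f => f tt
  | cX n => fun f => wint f
  | cS c d => fun f => intg (fun x => f (inl x)) + intg (fun y => f (inr y))
  | cP c d => fun f => intg (fun x => intg (fun y => f (x, y)))
  end.

(** The definable word-valued maps. On a product a term reads one coordinate only; [eq_rect] serves
    to compare a word of [cX k] with words over [n.+2] letters when [k = n]. *)
Fixpoint term (c : code) n : (El c -> word n) -> Prop :=
  match c return (El c -> word n) -> Prop with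
  | c0 => fun=> True
  | c1 => fun=> True
  | cX k => fun t => (exists w, t = fun=> w) \/
      (exists (e : k = n) (u : word n) (j : nat),
         t = fun y => u ++ drop j (eq_rect k (fun i => word i) y n e))
  | cS c d => fun t => term (fun x => t (inl x)) /\ term (fun y => t (inr y))
  | cP c d => fun t => (exists2 t1, @term c n t1 & t = fun x => t1 x.1) \/
                       (exists2 t2, @term d n t2 & t = fun x => t2 x.2)
  end.

Inductive genalg (T : Type) (G : (T -> rat) -> Prop) : (T -> rat) -> Prop :=
| ga_gen f : G f -> genalg G f
| ga_add f g : genalg G f -> genalg G g -> genalg G (fun x => f x + g x)
| ga_mul f g : genalg G f -> genalg G g -> genalg G (fun x => f x * g x).

(** The predicates of the two factors are parameters, so that [tame] can be a structural recursion
    on codes. *)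
Inductive pgen (T U : Type) (A : (T -> rat) -> Prop) (B : (U -> rat) -> Prop)
    (tA : forall n, (T -> word n) -> Prop) (tB : forall n, (U -> word n) -> Prop) :
    (T * U -> rat) -> Prop :=
| pg_fst f : A f -> pgen A B tA tB (fun x => f x.1)
| pg_snd f : B f -> pgen A B tA tB (fun x => f x.2)
| pg_eq n (t : T -> word n) (t' : U -> word n) : tA n t -> tB n t' ->
    pgen A B tA tB (fun x => ind (t x.1 = t' x.2)).

Fixpoint tame (c : code) : (El c -> rat) -> Prop :=
  match c return (El c -> rat) -> Prop with
  | c0 => fun=> True
  | c1 => fun=> True
  | cX n => fun f => exists k, cylindrical k f
  | cS c d => fun f => tame (fun x => f (inl x)) /\ tame (fun y => f (inr y))
  | cP c d => genalg (pgen (@tame c) (@tame d) (@term c) (@term d))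
  end.

Lemma eq_tame c (f g : El c -> rat) : f =1 g -> tame f -> tame g.
Proof. by move=> /funext ->. Qed.

Lemma tame_cst c a : tame (fun _ : El c => a).
Proof.
elim: c => //= [n|c hc d hd]; first by exists 0%N.
exact: ga_gen (pg_fst _ _ _ hc).
Qed.

Lemma tame_add c (f g : El c -> rat) : tame f -> tame g -> tame (fun x => f x + g x).
Proof.
elim: c f g => //= [n|c hc d hd|c hc d hd] f g.
- by move=> [k hf] [l hg]; exists (maxn k l); apply: cylindrical_add.
- by move=> [f1 f2] [g1 g2]; split; [apply: hc f1 g1|apply: hd f2 g2].
- exact: ga_add.
Qed.

Lemma tame_mul c (f g : El c -> rat) : tame f -> tame g -> tame (fun x => f x * g x).
Proof.
elim: c f g => //= [n|c hc d hd|c hc d hd] f g.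
- by move=> [k hf] [l hg]; exists (maxn k l); apply: cylindrical_mul.
- by move=> [f1 f2] [g1 g2]; split; [apply: hc f1 g1|apply: hd f2 g2].
- exact: ga_mul.
Qed.

Lemma tame_scale c a (f : El c -> rat) : tame f -> tame (fun x => a * f x).
Proof. by apply: tame_mul; apply: tame_cst. Qed.

Lemma tame_sum c (I : Type) (r : seq I) (F : I -> El c -> rat) :
  (forall i, tame (F i)) -> tame (fun x => \sum_(i <- r) F i x).
Proof.
move=> h; elim: r => [|i r IH].
  by apply: eq_tame (tame_cst c 0) => x; rewrite big_nil.
by apply: eq_tame (tame_add (h i) IH) => x; rewrite big_cons.
Qed.

Lemma term_cst c n (w : word n) : term (fun _ : El c => w).
Proof. by elim: c => //= [k|c hc d hd]; left; [exists w|exists (fun=> w)]. Qed.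

Lemma term_cons c n i (t : El c -> word n) : term t -> term (fun x => i :: t x).
Proof.
elim: c t => //= [k|c hc d hd|c hc d hd] t.
- move=> [[w ->]|[e [u [j ->]]]]; [left; by exists (i :: w)|right].
  by exists e, (i :: u), j.
- by move=> [h1 h2]; split; [apply: (hc _ h1)|apply: (hd _ h2)].
- by move=> [[t1 h1 ->]|[t2 h2 ->]]; [left; exists (fun x => i :: t1 x); auto|
    right; exists (fun x => i :: t2 x); auto].
Qed.

Lemma term_behead c n (t : El c -> word n) : term t -> term (fun x => behead (t x)).
Proof.
elim: c t => //= [k|c hc d hd|c hc d hd] t.
- move=> [[w ->]|[e [[|i u] [j ->]]]]; first by left; exists (behead w).
    by right; exists e, [::], j.+1; apply: funext => y; rewrite /= -drop1 drop_drop add1n.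
  by right; exists e, u, j.
- by move=> [h1 h2]; split; [apply: (hc _ h1)|apply: (hd _ h2)].
- by move=> [[t1 h1 ->]|[t2 h2 ->]]; [left; exists (fun x => behead (t1 x)); auto|
    right; exists (fun x => behead (t2 x)); auto].
Qed.

Lemma catIr (T : Type) (s1 s2 s3 : seq T) : s1 ++ s2 = s3 ++ s2 -> s1 = s3.
Proof.
move=> e; have ss : size s1 = size s3.
  by move/(congr1 size): e; rewrite !size_cat => /addIn.
by move/(congr1 (take (size s1))): e; rewrite take_size_cat // take_size_cat.
Qed.

Lemma cylindrical_rec n k (f : word n -> rat) :
  (forall i, cylindrical k (fun w => f (i :: w))) -> cylindrical k.+1 f.
Proof. by move=> h [|i w] //=; rewrite h. Qed.

Lemma cylindrical_shift_cst n (w u : word n) j :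
  exists k, cylindrical k (fun y => ind (w = u ++ drop j y)).
Proof.
elim: u w => [|a u IH] w /=.
  elim: j => [|j [k IH]].
    exists (size w).+1 => y; have := cylindrical_dirac w (fun=> 1) y.
    by rewrite !mulr1 !drop0.
  by exists k.+1; apply: cylindrical_rec.
case: w => [|b w]; first by exists 0%N => y; rewrite !ind0.
have [k h] := IH w; exists k => y.
have e z : ind (b :: w = a :: u ++ drop j z) = ind (b = a) * ind (w = u ++ drop j z).
  by rewrite indM; apply: ind_iff; split=> [[-> ->]|[-> ->]].
by rewrite !e h.
Qed.

(** Beyond [maxn j j'] letters both sides end in the same tail, which cancels by [catIr]. *)
Lemma cylindrical_shift_eq n (u u' : word n) j j' :
  exists k, cylindrical k (fun y => ind (u ++ drop j y = u' ++ drop j' y)).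
Proof.
exists (maxn j j') => y; set k := maxn j j'.
case: (leqP (size y) k) => s; first by rewrite take_oversize.
have dr l : (l <= k)%N -> drop l y = drop l (take k y) ++ drop k y.
  move=> lk; rewrite -{1}(cat_take_drop k y) drop_cat size_takel; last exact: ltnW.
  case: ltnP => // kl; have -> : l = k by apply/eqP; rewrite eqn_leq lk kl.
  by rewrite subnn drop0 [drop k (take k y)]drop_oversize // size_takel // ltnW.
rewrite (dr j) ?leq_maxl // (dr j') ?leq_maxr // !catA.
by apply: ind_iff; split=> [/catIr ->|->].
Qed.

Lemma tame_term_eq c n (t t' : El c -> word n) :
  term t -> term t' -> tame (fun x => ind (t x = t' x)).
Proof.
elim: c t t' => //= [k|c hc d hd|c hc d hd] t t'; last 2 first.
- by move=> [h1 h2] [h1' h2']; split; [apply: hc h1 h1'|apply: hd h2 h2'].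
- move=> [[t1 h1 ->]|[t1 h1 ->]] [[t2 h2 ->]|[t2 h2 ->]].
  + exact: (ga_gen (pg_fst _ _ _ (hc _ _ h1 h2))).
  + exact: (ga_gen (pg_eq _ _ h1 h2)).
  + rewrite (_ : (fun x => _) = fun x : El c * El d => ind (t2 x.1 = t1 x.2)).
      exact: (ga_gen (pg_eq _ _ h2 h1)).
    by apply: funext => x; apply: ind_iff; split=> ->.
  + exact: (ga_gen (pg_snd _ _ _ (hd _ _ h1 h2))).
move=> h1 h2; have cst (e : k = n) (w u : word n) j :
    tame (c := cX k) (fun y => ind (w = u ++ drop j (eq_rect k (fun i => word i) y n e))).
  by subst k; apply: cylindrical_shift_cst.
case: h1 h2 => [[w ->]|[e [u [j ->]]]] [[w' ->]|[e' [u' [j' ->]]]].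
- exact: (tame_cst (cX k)).
- exact: cst e' w u' j'.
- by apply: (@eq_tame (cX k)) (cst e w' u j) => y; apply: ind_iff; split=> ->.
- by rewrite (Prop_irrelevance e' e); subst k; apply: cylindrical_shift_eq.
Qed.

Lemma tame_term_comp c n (t : El c -> word n) (h : word n -> rat) k :
  term t -> cylindrical k h -> tame (fun x => h (t x)).
Proof.
elim: c t => //= [l|c hc d hd|c hc d hd] t.
- move=> [[w ->]|[e [u [j ->]]]] hk; first by exists 0%N.
  subst l; exists (j + k)%N => y /=.
  rewrite hk [RHS]hk !take_cat; case: ltnP => // _; congr (h (_ ++ _)).
  by rewrite !take_drop take_takel // addnC leq_add2l leq_subr.
- by move=> [h1 h2] hk; split; [apply: hc h1 hk|apply: hd h2 hk].
- by move=> [[t1 h1 ->]|[t1 h1 ->]] hk; apply: ga_gen;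
    [apply: pg_fst (hc _ h1 hk)|apply: pg_snd (hd _ h1 hk)].
Qed.

(** Definability of a map is expressed by pullback. Terms have to be pulled back as well, because
    equality of terms generates the tame functions on a product. *)
Definition tmap c d (phi : El c -> El d) :=
  (forall f, tame f -> tame (fun x => f (phi x))) /\
  (forall n (t : El d -> word n), term t -> term (fun x => t (phi x))).

Lemma tmap_id c : tmap (fun x : El c => x). Proof. by []. Qed.

Lemma tmap_comp c d e (phi : El c -> El d) (psi : El d -> El e) :
  tmap phi -> tmap psi -> tmap (fun x => psi (phi x)).
Proof.
move=> [h1 h2] [k1 k2]; split=> [f /k1 /h1|n t /k2 /h2] //.
Qed.

Lemma tmap_cst c d (a : El d) : tmap (fun _ : El c => a).
Proof. by split=> *; [apply: tame_cst|apply: term_cst]. Qed.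

Lemma tmap_fst c d : @tmap (cP c d) c (fun x => x.1).
Proof. by split=> [f h|n t h]; [apply: ga_gen (pg_fst _ _ _ h)|left; exists t]. Qed.

Lemma tmap_snd c d : @tmap (cP c d) d (fun x => x.2).
Proof. by split=> [f h|n t h]; [apply: ga_gen (pg_snd _ _ _ h)|right; exists t]. Qed.

Lemma tmap_pair c d e (phi : El c -> El d) (psi : El c -> El e) :
  tmap phi -> tmap psi -> @tmap c (cP d e) (fun x => (phi x, psi x)).
Proof.
move=> [h1 h2] [k1 k2]; split=> [f|n t [[u hu ->]|[u hu ->]]]; last 2 first.
- exact: h2 hu.
- exact: k2 hu.
elim=> {f} [_ [f /h1 //|f /k1 //|n t t' ht ht']|f g _ hf _ hg|f g _ hf _ hg].
- exact: tame_term_eq (h2 _ _ ht) (k2 _ _ ht').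
- exact: tame_add hf hg.
- exact: tame_mul hf hg.
Qed.

Lemma tmap_inl c d : @tmap c (cS c d) inl.
Proof. by split=> [f []|n t []]. Qed.

Lemma tmap_inr c d : @tmap d (cS c d) inr.
Proof. by split=> [f []|n t []]. Qed.

Lemma tmap_case c d e (phi : El c -> El e) (psi : El d -> El e) : tmap phi -> tmap psi ->
  @tmap (cS c d) e (fun s => match s with inl x => phi x | inr y => psi y end).
Proof.
move=> [h1 h2] [k1 k2]; split=> [f hf|n t ht]; split.
- exact: h1. - exact: k1. - exact: h2. - exact: k2.
Qed.

Lemma tmap_swap c d : @tmap (cP c d) (cP d c) (fun x => (x.2, x.1)).
Proof. exact: tmap_pair (tmap_snd c d) (tmap_fst c d). Qed.

Lemma tmap_app c d x : @tmap d (cP c d) (fun y => (x, y)).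
Proof. exact: tmap_pair (tmap_cst d x) (tmap_id d). Qed.

Lemma tmap_appr c d y : @tmap c (cP c d) (fun x => (x, y)).
Proof. exact: tmap_pair (tmap_id c) (tmap_cst c y). Qed.

(** Nothing is claimed about [g] on the other summand: terms are extended there by the empty word,
    and the resulting indicators need not vanish. [tame_distr] cuts them off with the indicator of a
    summand. *)
Lemma tame_distr_l s c d (f : El s * El c -> rat) : @tame (cP s c) f ->
  exists2 g, @tame (cP s (cS c d)) g & forall x y, g (x, inl y) = f (x, y).
Proof.
elim=> {f} [_ [f hf|f hf|n t t' ht ht']|f g _ [f' hf ef] _ [g' hg eg]|f g _ [f' hf ef] _ [g' hg eg]].
- by exists (fun x => f x.1) => //; apply: ga_gen (pg_fst _ _ _ hf).
- exists (fun x => match x.2 with inl y => f y | inr _ => 0 end) => //.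
  have := @pg_snd (El s) (El (cS c d)) (@tame s) (@tame (cS c d)) (@term s) (@term (cS c d))
    (fun z => match z with inl y => f y | inr _ => 0 end).
  by move=> h; apply: ga_gen; apply: h; split => //; apply: tame_cst.
- exists (fun x => ind (t x.1 = match x.2 with inl y => t' y | inr _ => [::] end)) => //.
  have := @pg_eq (El s) (El (cS c d)) (@tame s) (@tame (cS c d)) (@term s) (@term (cS c d))
    n t (fun z => match z with inl y => t' y | inr _ => [::] end).
  by move=> h; apply: ga_gen; apply: h => //; split => //; apply: term_cst.
- by exists (fun x => f' x + g' x) => [|x y]; [apply: ga_add|rewrite ef eg].
- by exists (fun x => f' x * g' x) => [|x y]; [apply: ga_mul|rewrite ef eg].
Qed.

Lemma tame_distr s c d (f : El s * (El c + El d) -> rat) :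
  @tame (cP s c) (fun x => f (x.1, inl x.2)) -> @tame (cP s d) (fun x => f (x.1, inr x.2)) ->
  @tame (cP s (cS c d)) f.
Proof.
move=> /(tame_distr_l d)[g hg eg] /(tame_distr_l c)[h hh eh].
have sw : @tmap (cP s (cS c d)) (cP s (cS d c))
    (fun x => (x.1, match x.2 with inl y => inr y | inr y => inl y end)).
  apply: tmap_pair (tmap_fst _ _) _.
  exact: tmap_comp (tmap_snd s (cS c d)) (tmap_case (tmap_inr d c) (tmap_inl d c)).
pose l : El (cS c d) -> rat := fun z => if z is inl _ then 1 else 0.
have hl : @tame (cS c d) l by split; apply: tame_cst.
pose r : El (cS c d) -> rat := fun z => if z is inl _ then 0 else 1.
have hr : @tame (cS c d) r by split; apply: tame_cst.
apply: (@eq_tame (cP s (cS c d))) (tame_add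
  (tame_mul hg ((tmap_snd s _).1 _ hl)) (tame_mul (sw.1 _ hh) ((tmap_snd s _).1 _ hr))).
by move=> [x [y|y]] /=; rewrite ?eg ?eh /=; ring.
Qed.

Lemma tame_distr_r s c d (f : (El c + El d) * El s -> rat) :
  @tame (cP c s) (fun x => f (inl x.1, x.2)) -> @tame (cP d s) (fun x => f (inr x.1, x.2)) ->
  @tame (cP (cS c d) s) f.
Proof.
move=> h1 h2.
have := @tame_distr s c d (fun x => f (x.2, x.1)) ((tmap_swap _ _).1 _ h1) ((tmap_swap _ _).1 _ h2).
by move=> /((tmap_swap (cS c d) s).1); apply: eq_tame => -[].
Qed.

Lemma tame_eq c : @tame (cP c c) (fun x => ind (x.1 = x.2)).
Proof.
elim: c => [||n|c hc d hd|c hc d hd].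
- by apply: (@eq_tame (cP c0 c0)) (tame_cst (cP c0 c0) 0) => -[[]].
- by apply: (@eq_tame (cP c1 c1)) (tame_cst (cP c1 c1) 1) => -[[] []]; rewrite ind1.
- apply: ga_gen; apply: (@pg_eq _ _ _ _ _ _ n (fun x => x) (fun x => x));
    by right; exists erefl, [::], 0%N; apply: funext => x; rewrite drop0.
- apply: tame_distr; apply: tame_distr_r => /=.
  + by apply: (@eq_tame (cP c c)) hc => x; apply: ind_iff; split=> [->|[]].
  + by apply: (@eq_tame (cP d c)) (tame_cst (cP d c) 0) => x; rewrite ind0.
  + by apply: (@eq_tame (cP c d)) (tame_cst (cP c d) 0) => x; rewrite ind0.
  + by apply: (@eq_tame (cP d d)) hd => x; apply: ind_iff; split=> [->|[]].
- set e := cP c d.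
  have p1 := tmap_comp (tmap_fst e e) (tmap_fst c d).
  have p2 := tmap_comp (tmap_fst e e) (tmap_snd c d).
  have q1 := tmap_comp (tmap_snd e e) (tmap_fst c d).
  have q2 := tmap_comp (tmap_snd e e) (tmap_snd c d).
  apply: (@eq_tame (cP e e)) (tame_mul ((tmap_pair p1 q1).1 _ hc) ((tmap_pair p2 q2).1 _ hd)).
  by move=> [[a b] [a' b']] /=; rewrite indM; apply: ind_iff; split=> [[-> ->]|[-> ->]].
Qed.

Lemma term_id n : @term (cX n) n (fun x => x).
Proof. by right; exists erefl, [::], 0%N; apply: funext => x; rewrite drop0. Qed.

Lemma tame_app c d f x : @tame (cP c d) f -> tame (fun y => f (x, y)).
Proof. by move=> h; apply: (tmap_app d x).1 h. Qed.

Lemma tame_appr c d f y : @tame (cP c d) f -> tame (fun x => f (x, y)).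
Proof. by move=> h; apply: (tmap_appr c y).1 h. Qed.

(* A normal form in which integration over the last variable, a word, is explicit. *)
Inductive nform s n : (El s * word n -> rat) -> Prop :=
| nf_prod g k h : tame g -> cylindrical k h -> nform (fun x => g x.1 * h x.2)
| nf_graph g t : tame g -> term t -> nform (fun x => g x.1 * ind (t x.1 = x.2))
| nf_add f g : nform f -> nform g -> nform (fun x => f x + g x).

Lemma eq_nform s n (f g : El s * word n -> rat) : f =1 g -> nform f -> nform g.
Proof. by move=> /funext ->. Qed.

Lemma nform_fst s n g : tame g -> @nform s n (fun x => g x.1).
Proof.
move=> h; apply: eq_nform (nf_prod h (@cylindrical_cst n 1)) => x.
by rewrite mulr1.
Qed.

(** Two graphs meet where their terms agree, a tame condition on the first variable; on a graph, a
    function of the word may be evaluated at the term. *)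
Lemma nform_mul s n (f g : El s * word n -> rat) : nform f -> nform g ->
  nform (fun x => f x * g x).
Proof.
elim=> {f} [a k b ha hb|a t ha ht|f1 f2 _ h1 _ h2] hg; last first.
  by apply: eq_nform (nf_add (h1 hg) (h2 hg)) => x; rewrite mulrDl.
- elim: hg => {g} [a' k' b' ha' hb'|a' t' ha' ht'|g1 g2 _ h1 _ h2]; last first.
  + by apply: eq_nform (nf_add h1 h2) => x; rewrite mulrDr.
  + have h := tame_mul (tame_mul ha ha') (tame_term_eq ht ht').
    apply: eq_nform (nf_graph h ht) => x.
    rewrite [RHS]mulrACA -[LHS]mulrA !indM; congr (_ * _); apply: ind_iff.
    by split=> [[-> ->]|[-> ->]].
  + have h := tame_mul (tame_mul ha ha') (tame_term_comp ht hb').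
    apply: eq_nform (nf_graph h ht) => x.
    transitivity (ind (t x.1 = x.2) * (a x.1 * a' x.1 * b' (t x.1))); first by ring.
    transitivity (ind (t x.1 = x.2) * (a x.1 * a' x.1 * b' x.2)); last by ring.
    by apply: ind_mul_eq => ->.
- elim: hg => {g} [a' k' b' ha' hb'|a' t' ha' ht'|g1 g2 _ h1 _ h2]; last first.
  + by apply: eq_nform (nf_add h1 h2) => x; rewrite mulrDr.
  + have h := tame_mul (tame_mul ha ha') (tame_term_comp ht' hb).
    apply: eq_nform (nf_graph h ht') => x.
    transitivity (ind (t' x.1 = x.2) * (a x.1 * a' x.1 * b (t' x.1))); first by ring.
    transitivity (ind (t' x.1 = x.2) * (a x.1 * a' x.1 * b x.2)); last by ring.
    by apply: ind_mul_eq => ->.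
  + apply: eq_nform (nf_prod (tame_mul ha ha') (cylindrical_mul hb hb')) => x.
    by rewrite mulrACA.
Qed.

Lemma nform_sum s n (I : Type) (r : seq I) (F : I -> El s * word n -> rat) :
  (forall i, nform (F i)) -> nform (fun x => \sum_(i <- r) F i x).
Proof.
move=> h; elim: r => [|i r IH].
  by apply: eq_nform (nform_fst n (tame_cst s 0)) => x; rewrite big_nil.
by apply: eq_nform (nf_add (h i) IH) => x; rewrite big_cons.
Qed.

(** Trades the removal of a letter on one side for a prefix on the other. With [z = drop j x] this
    turns an equation in [drop j.+1 x] into equations in [drop j x]. *)
Lemma ind_behead n (u z : word n) : ind (u = behead z) =
  ind (u = [::]) * ind ([::] = z) + \sum_(i < n.+2) ind (i :: u = z).
Proof.
case: z => [|a z] /=.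
  rewrite [X in _ * X]ind1 // mulr1 big1 ?addr0 // => i _; exact: ind0.
rewrite [X in _ * X]ind0 // mulr0 add0r (bigD1 a) //= big1 ?addr0 => [|i ia].
  by apply: ind_iff; split=> [->|[]].
by apply: ind0 => -[e _]; rewrite e eqxx in ia.
Qed.

Lemma nform_drop s n j (t : El s -> word n) : term t ->
  nform (fun x => ind (t x.1 = drop j x.2)).
Proof.
elim: j t => [|j IH] t ht.
  apply: eq_nform (nf_graph (tame_cst s 1) ht) => x.
  by rewrite mul1r drop0.
apply: (@eq_nform _ _ (fun x => ind (t x.1 = [::]) * ind ([::] = drop j x.2) +
    \sum_(i < n.+2) ind (i :: t x.1 = drop j x.2))).
  by move=> x; rewrite -ind_behead -drop1 drop_drop add1n.
apply: nf_add; last by apply: nform_sum => i; apply: (IH _ (term_cons i ht)).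
apply: nform_mul (IH _ (term_cst s [::])).
exact: (nform_fst n (tame_term_eq ht (term_cst s [::]))).
Qed.

(** [t = a :: v] holds exactly when [t = a :: behead t], which does not involve the word variable,
    and [behead t = v]. *)
Lemma nform_shift s n u j (t : El s -> word n) : term t ->
  nform (fun x => ind (t x.1 = u ++ drop j x.2)).
Proof.
elim: u t => [|a u IH] t ht; first exact: nform_drop.
have hb := term_behead ht.
apply: eq_nform (nform_mul
  (nform_fst n (tame_term_eq ht (term_cons a hb))) (IH _ hb)) => x.
by rewrite indM; apply: ind_iff; split=> [[{2}-> ->]|->].
Qed.

Lemma tame_nform s n (f : El s * word n -> rat) : @tame (cP s (cX n)) f -> nform f.
Proof.
elim=> {f} [_ [f hf|f [k hf]|l t t' ht ht']|f g _ hf _ hg|f g _ hf _ hg].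
- exact: nform_fst.
- by apply: eq_nform (nf_prod (tame_cst s 1) hf) => x; rewrite mul1r.
- case: ht' => [[w ->]|[e [u [j ->]]]]; last by subst l; apply: nform_shift.
  exact: (nform_fst n (tame_term_eq ht (term_cst s w))).
- exact: nf_add.
- exact: nform_mul.
Qed.

Lemma tame_graph s n (t : El s -> word n) : term t ->
  @tame (cP s (cX n)) (fun x => ind (t x.1 = x.2)).
Proof. by move=> ht; apply: ga_gen; apply: (pg_eq _ _ ht (term_id n)). Qed.

Lemma nform_tame s n (f : El s * word n -> rat) : nform f -> @tame (cP s (cX n)) f.
Proof.
elim=> {f} [g k h hg hh|g t hg ht|f g _ hf _ hg].
- apply: tame_mul; first exact: (tmap_fst s (cX n)).1 hg.
  by apply: ((tmap_snd s (cX n)).1 h); exists k.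
- by apply: tame_mul (tame_graph ht); exact: (tmap_fst s (cX n)).1 hg.
- exact: tame_add.
Qed.

(** * Integration: stability, linearity, Dirac property, Fubini *)

Lemma wint_diracr n (a : rat) (w : word n) : wint (fun y => a * ind (w = y)) = a.
Proof.
by rewrite -[RHS](wint_dirac w (fun=> a)); congr wint; apply: funext => y; rewrite mulrC.
Qed.

(** For a word variable the normal form is used: a product integrates to a multiple of its
    coefficient, and a graph to its coefficient itself. The parameter code [s] is general because a
    product [d] moves its first factor into the parameters. *)
Lemma tame_intg s d f : @tame (cP s d) f -> tame (fun x => intg (fun y => f (x, y))).
Proof.
elim: d s f => [||n|c hc d hd|c hc d hd] s f hf.
- exact: tame_cst.
- exact: tame_appr hf.
- have := tame_nform hf; elim=> {hf f} [g k h hg hh|g t hg ht|f g hf IHf hg IHg] /=.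
  + apply: eq_tame (tame_mul hg (tame_cst s (wint h))) => x.
    by rewrite (wint_scale _ hh).
  + by apply: eq_tame hg => x; rewrite wint_diracr.
  + apply: eq_tame (tame_add IHf IHg) => x.
    have [k hk] := tame_app x (nform_tame hf); have [l hl] := tame_app x (nform_tame hg).
    by rewrite (wint_add hk hl).
- apply: tame_add; [apply: (hc s (fun x => f (x.1, inl x.2)))|apply: (hd s (fun x => f (x.1, inr x.2)))].
    exact: (tmap_pair (tmap_fst s c) (tmap_comp (tmap_snd s c) (tmap_inl c d))).1 hf.
  exact: (tmap_pair (tmap_fst s d) (tmap_comp (tmap_snd s d) (tmap_inr c d))).1 hf.
- apply: (hc s (fun x => intg (fun y => f (x.1, (x.2, y))))).
  apply: (hd (cP s c) (fun x => f (x.1.1, (x.1.2, x.2)))).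
  have p := tmap_fst (cP s c) d.
  exact: (tmap_pair (tmap_comp p (tmap_fst s c))
    (tmap_pair (tmap_comp p (tmap_snd s c)) (tmap_snd (cP s c) d))).1 hf.
Qed.

Lemma intg_cst0 c : intg (fun _ : El c => 0) = 0.
Proof.
elim: c => //= [n|c hc d hd|c hc d hd]; first exact: wint0.
  by rewrite hc hd addr0.
by under eq_fun do rewrite hd; rewrite hc.
Qed.

Lemma intg_add c (f g : El c -> rat) : tame f -> tame g ->
  intg (fun x => f x + g x) = intg f + intg g.
Proof.
elim: c f g => //= [n|c hc d hd|c hc d hd] f g hf hg.
- by case: hf hg => [k hf] [l hg]; apply: wint_add hf hg.
- by case: hf hg => [f1 f2] [g1 g2]; rewrite hc // hd // addrACA.
- rewrite -hc; try exact: (@tame_intg c d).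
  by congr intg; apply: funext => x; rewrite -hd //; apply: (@tame_app c d).
Qed.

Lemma intg_scale c a (f : El c -> rat) : tame f -> intg (fun x => a * f x) = a * intg f.
Proof.
elim: c f => //= [|n|c hc d hd|c hc d hd] f hf.
- by rewrite mulr0.
- by case: hf => [k hf]; apply: wint_scale hf.
- by case: hf => [f1 f2]; rewrite hc // hd // mulrDr.
- rewrite -hc; try exact: (@tame_intg c d).
  by congr intg; apply: funext => x; rewrite -hd //; apply: (@tame_app c d).
Qed.

Lemma intg_scaler c a (f : El c -> rat) : tame f -> intg (fun x => f x * a) = intg f * a.
Proof.
move=> h; rewrite mulrC -intg_scale //.
by congr intg; apply: funext => x; rewrite mulrC.
Qed.

Lemma intg_sum c (I : Type) (r : seq I) (F : I -> El c -> rat) : (forall i, tame (F i)) ->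
  intg (fun x => \sum_(i <- r) F i x) = \sum_(i <- r) intg (F i).
Proof.
move=> h; elim: r => [|i r IH].
  by rewrite big_nil -[RHS](intg_cst0 c); congr intg; apply: funext => x; rewrite big_nil.
rewrite big_cons -IH -intg_add //; last exact: tame_sum.
by congr intg; apply: funext => x; rewrite big_cons.
Qed.

Lemma intg_dirac c (a : El c) h : intg (fun y => ind (a = y) * h y) = h a.
Proof.
elim: c a h => [||n|c hc d hd|c hc d hd] //=.
- by move=> [] h; rewrite ind1 // mul1r.
- by move=> a h; apply: wint_dirac.
- have z e (P : El e -> Prop) (g : El e -> rat) : (forall x, ~ P x) ->
      intg (fun x => ind (P x) * g x) = 0.
    move=> hP; rewrite -[RHS](intg_cst0 e); congr intg; apply: funext => x.
    by rewrite ind0 ?mul0r.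
  move=> [a|a] h.
    rewrite [X in _ + X]z // addr0 -[RHS](hc a (fun x => h (inl x))).
    congr intg; apply: funext => x.
    by congr (_ * _); apply: ind_iff; split=> [[]|->].
  rewrite [X in X + _]z // add0r -[RHS](hd a (fun x => h (inr x))).
  congr intg; apply: funext => x.
  by congr (_ * _); apply: ind_iff; split=> [[]|->].
- move=> [a b] h; rewrite -[RHS](hd b (fun y => h (a, y))).
  rewrite -[RHS](hc a (fun x => intg (fun y => ind (b = y) * h (x, y)))).
  congr intg; apply: funext => x.
  case: (pselect (a = x)) => [->|ax]; last first.
    rewrite [X in _ = X * _]ind0 // mul0r -[RHS](intg_cst0 d); congr intg; apply: funext => y.
    by rewrite ind0 ?mul0r // => -[].
  rewrite [X in _ = X * _]ind1 // mul1r; congr intg; apply: funext => y.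
  by congr (_ * _); apply: ind_iff; split=> [[]|->].
Qed.

Lemma intg_diracr c (a : El c) h : intg (fun y => h y * ind (y = a)) = h a.
Proof.
rewrite -[RHS](intg_dirac a h); congr intg; apply: funext => y.
by rewrite mulrC; congr (_ * _); apply: ind_iff; split=> ->.
Qed.

(** Fubini for the graph of [drop j]. Splitting [y] by its first letter replaces [j.+1] by [j] in
    each branch, and the empty word contributes a point mass at [[::]]. *)
Lemma wint_push_drop n (g : word n -> rat) k j : cylindrical k g ->
  wint (fun z => wint (fun y => g y * ind (drop j y = z))) = wint g.
Proof.
elim: j k g => [|j IH] k g hg.
  congr wint; apply: funext => z; rewrite -(@intg_diracr (cX n) z g) /=.
  by congr wint; apply: funext => y; rewrite drop0.
have hd l (t : word n) : @term (cX n) n (fun y => t ++ drop l y).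
  by right; exists erefl, t, l.
have hk l : @tame (cP (cX n) (cX n)) (fun x => g x.1 * ind (drop l x.1 = x.2)).
  apply: tame_mul (tame_graph (hd l [::])).
  by apply: ((tmap_fst (cX n) (cX n)).1 g); exists k.
have hki i : @tame (cP (cX n) (cX n)) (fun x => g (i :: x.1) * ind (drop j x.1 = x.2)).
  apply: tame_mul (tame_graph (hd j [::])).
  by apply: ((tmap_fst (cX n) (cX n)).1 (fun x => g (i :: x))); exists k; apply: cylindrical_cons.
rewrite (wint_rec hg) -(@wint_diracr n (g [::]) [::]).
transitivity (@intg (cX n) (fun z => g [::] * ind ([::] = z) +
   \sum_(i < n.+2) wint (fun y => g (i :: y) * ind (drop j y = z)))).
  congr wint; apply: funext => z.
  by have [l hl] := @tame_appr (cX n) (cX n) _ z (hk j.+1); rewrite (wint_rec hl) /=.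
have hz i : @tame (cX n) (fun z => wint (fun y => g (i :: y) * ind (drop j y = z))).
  exact: (@tame_intg (cX n) (cX n) (fun x => g (i :: x.2) * ind (drop j x.2 = x.1))
    ((tmap_swap _ _).1 _ (hki i))).
rewrite intg_add; first last.
- exact: tame_sum.
- apply: tame_scale; exists 1%N => w.
  have := cylindrical_dirac [::] (fun=> 1) w.
  by rewrite !mulr1.
congr (_ + _); rewrite intg_sum //; apply: eq_bigr => i _.
exact: IH (cylindrical_cons i hg).
Qed.

(** After a letter [a] is prepended, the only branch of the recursion over [z] that contributes is
    that of words starting with [a]. *)
Lemma wint_push n (g : word n -> rat) k u j : cylindrical k g ->
  wint (fun z => wint (fun y => g y * ind (u ++ drop j y = z))) = wint g.
Proof.
move=> hg; elim: u => [|a u IH]; first exact: wint_push_drop hg.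
have hk : @tame (cP (cX n) (cX n)) (fun x => g x.1 * ind ((a :: u) ++ drop j x.1 = x.2)).
  apply: tame_mul; first by apply: ((tmap_fst (cX n) (cX n)).1 g); exists k.
  by apply: (@tame_graph (cX n) n (fun y => (a :: u) ++ drop j y)); right; exists erefl, (a :: u), j.
have [l hl] : @tame (cX n) (fun z => wint (fun y => g y * ind ((a :: u) ++ drop j y = z))).
  exact: (@tame_intg (cX n) (cX n) (fun x => g x.2 * ind ((a :: u) ++ drop j x.2 = x.1))
    ((tmap_swap _ _).1 _ hk)).
have z0 (P : word n -> Prop) : (forall y, ~ P y) -> wint (fun y => g y * ind (P y)) = 0.
  move=> hP; rewrite -[RHS](wint0 n); congr wint; apply: funext => y.
  by rewrite ind0 ?mulr0.
rewrite (wint_rec hl) z0 // add0r (bigD1 a) //= big1 ?addr0 => [|i ia].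
  rewrite -IH; congr wint; apply: funext => z; congr wint; apply: funext => y.
  by congr (_ * _); apply: ind_iff; split=> [[]|->].
rewrite -[RHS](wint0 n); congr wint; apply: funext => z; apply: z0 => y [e _].
by rewrite e eqxx in ia.
Qed.

Definition fubini c d := forall f, @tame (cP c d) f ->
  intg (fun x => intg (fun y => f (x, y))) = intg (fun y => intg (fun x => f (x, y))).

Lemma fubini_sym c d : fubini c d -> fubini d c.
Proof. by move=> h f /((tmap_swap c d).1) /h /= ->. Qed.

Lemma fubini0 d : fubini c0 d.
Proof. by move=> f _; rewrite [RHS]intg_cst0. Qed.

Lemma fubini1 d : fubini c1 d.
Proof. by []. Qed.

Lemma fubiniS c d e : fubini c e -> fubini d e -> fubini (cS c d) e.
Proof.
move=> hc hd f hf.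
have h1 := (tmap_pair (tmap_comp (tmap_fst c e) (tmap_inl c d)) (tmap_snd c e)).1 _ hf.
have h2 := (tmap_pair (tmap_comp (tmap_fst d e) (tmap_inr c d)) (tmap_snd d e)).1 _ hf.
rewrite /= (hc _ h1) (hd _ h2) -intg_add //.
  exact: (@tame_intg e c (fun x => f (inl x.2, x.1)) ((tmap_swap _ _).1 _ h1)).
exact: (@tame_intg e d (fun x => f (inr x.2, x.1)) ((tmap_swap _ _).1 _ h2)).
Qed.

Lemma fubiniP c d e : fubini c e -> fubini d e -> fubini (cP c d) e.
Proof.
move=> hc hd f hf /=.
have p := tmap_fst (cP c e) d.
have h1 := (tmap_pair (tmap_pair (tmap_comp p (tmap_fst c e)) (tmap_snd _ _))
   (tmap_comp p (tmap_snd c e))).1 _ hf.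
rewrite -(hc _ (tame_intg h1)) /=; congr intg; apply: funext => x.
exact: (hd _ ((tmap_pair (tmap_comp (tmap_fst d e) (tmap_app d x)) (tmap_snd d e)).1 _ hf)).
Qed.

Lemma wint_scaler n k a (f : word n -> rat) : cylindrical k f ->
  wint (fun w => f w * a) = wint f * a.
Proof.
move=> h; rewrite mulrC -(wint_scale _ h).
by congr wint; apply: funext => x; rewrite mulrC.
Qed.

(** Products and sums are formal. In the graph case the term is constant, giving a point mass, or a
    shift, which is [wint_push]. *)
Lemma fubiniX n m : fubini (cX n) (cX m).
Proof.
move=> f /tame_nform; elim=> {f} [g k h [l hg] hh|g t [k hg] ht|f g hf IHf hg IHg] /=.
- transitivity (wint g * wint h).
    rewrite -(wint_scaler _ hg).
    by congr wint; apply: funext => x; rewrite (wint_scale _ hh).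
  rewrite -(wint_scale _ hh).
  by congr wint; apply: funext => x; rewrite (wint_scaler _ hg).
- rewrite (_ : (fun x => _) = g); last by apply: funext => x; rewrite wint_diracr.
  case: ht => [[w ->]|[e [u [j ->]]]]; last by subst m; rewrite (wint_push _ _ hg).
  rewrite -[LHS](wint_diracr (wint g) w) /=; congr wint; apply: funext => y.
  by rewrite (wint_scaler _ hg).
- have tf := nform_tame hf; have tg := nform_tame hg.
  have tf' := (tmap_swap (cX m) (cX n)).1 _ tf; have tg' := (tmap_swap (cX m) (cX n)).1 _ tg.
  transitivity (wint (fun x => wint (fun y => f (x, y))) + wint (fun x => wint (fun y => g (x, y)))).
    have [k hk] := tame_intg tf; have [l hl] := tame_intg tg.
    rewrite -(wint_add hk hl) /=; congr wint; apply: funext => x.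
    have [a ha] := @tame_app (cX n) (cX m) _ x tf; have [b hb] := @tame_app (cX n) (cX m) _ x tg.
    exact: wint_add ha hb.
  rewrite [X in X + _]IHf [X in _ + X]IHg.
  have [k hk] := tame_intg tf'; have [l hl] := tame_intg tg'.
  rewrite -(wint_add hk hl) /=; congr wint; apply: funext => y.
  have [a ha] := @tame_appr (cX n) (cX m) _ y tf.
  have [b hb] := @tame_appr (cX n) (cX m) _ y tg.
  by rewrite -(wint_add ha hb).
Qed.

Lemma fubini_all c d : fubini c d.
Proof.
have hX n e : fubini (cX n) e.
  apply: fubini_sym; elim: e => [||m|e1 h1 e2 h2|e1 h1 e2 h2].
  - exact: fubini0. - exact: fubini1. - exact: fubiniX. - exact: fubiniS. - exact: fubiniP.
elim: c => [||n|c1 h1 c2 h2|c1 h1 c2 h2].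
- exact: fubini0. - exact: fubini1. - exact: hX. - exact: fubiniS. - exact: fubiniP.
Qed.

(** * The category of tame kernels *)

Section Kernels.
Variables c d : code.

Record kernel := Kernel { kfun :> El c * El d -> rat; kfunP : @tame (cP c d) kfun }.

Lemma kernelP (f g : kernel) : (forall x y, f (x, y) = g (x, y)) -> f = g.
Proof.
case: f g => [f hf] [g hg] /= fg; have e : f = g by apply: funext => -[x y].
by subst g; congr Kernel; apply: Prop_irrelevance.
Qed.

HB.instance Definition _ := gen_eqMixin kernel.
HB.instance Definition _ := gen_choiceMixin kernel.

Definition addk (f g : kernel) := Kernel (tame_add (kfunP f) (kfunP g)).
Definition zerok := Kernel (tame_cst (cP c d) 0).
Definition scalek a (f : kernel) := Kernel (tame_scale a (kfunP f)).
Definition oppk := scalek (-1).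

Fact addkA : associative addk.
Proof. by move=> f g h; apply: kernelP => x y; apply: addrA. Qed.
Fact addkC : commutative addk.
Proof. by move=> f g; apply: kernelP => x y; apply: addrC. Qed.
Fact add0k : left_id zerok addk.
Proof. by move=> f; apply: kernelP => x y; apply: add0r. Qed.
Fact addNk : left_inverse zerok oppk addk.
Proof. by move=> f; apply: kernelP => x y; rewrite /= mulN1r addNr. Qed.

HB.instance Definition _ := GRing.isZmodule.Build kernel addkA addkC add0k addNk.

Fact scalekA a b f : scalek a (scalek b f) = scalek (a * b) f.
Proof. by apply: kernelP => x y; apply: mulrA. Qed.
Fact scale1k : left_id 1 scalek.
Proof. by move=> f; apply: kernelP => x y; apply: mul1r. Qed.
Fact scalekDr : right_distributive scalek +%R.
Proof. by move=> a f g; apply: kernelP => x y; apply: mulrDr. Qed.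
Fact scalekDl f : {morph scalek^~ f : a b / a + b}.
Proof. by move=> a b; apply: kernelP => x y; apply: mulrDl. Qed.

HB.instance Definition _ :=
  GRing.Zmodule_isLmodule.Build rat kernel scalekA scale1k scalekDr scalekDl.

Lemma addkE (f g : kernel) x : (f + g : kernel) x = f x + g x. Proof. by []. Qed.
Lemma scalekE a (f : kernel) x : (a *: f : kernel) x = a * f x. Proof. by []. Qed.
End Kernels.

Lemma tame_comp c d e (f : kernel c d) (g : kernel d e) :
  @tame (cP (cP c e) d) (fun x => f (x.1.1, x.2) * g (x.2, x.1.2)).
Proof.
have p := tmap_fst (cP c e) d; have q := tmap_snd (cP c e) d.
apply: tame_mul.
  exact: (tmap_pair (tmap_comp p (tmap_fst c e)) q).1 (kfunP f).
exact: (tmap_pair q (tmap_comp p (tmap_snd c e))).1 (kfunP g).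
Qed.

Definition compk c d e (g : kernel d e) (f : kernel c d) : kernel c e :=
  Kernel (tame_intg (tame_comp f g)).

Lemma compkE c d e (g : kernel d e) (f : kernel c d) x z :
  compk g f (x, z) = intg (fun y => f (x, y) * g (y, z)).
Proof. by []. Qed.

Lemma kernel_app c d (f : kernel c d) x : tame (fun y => f (x, y)).
Proof. exact: tame_app (kfunP f). Qed.

Lemma kernel_appr c d (f : kernel c d) y : tame (fun x => f (x, y)).
Proof. exact: tame_appr (kfunP f). Qed.

(** Fubini in the two middle variables, with the outer ones fixed. *)
Lemma compk_assoc b c d e (h : kernel d e) (g : kernel c d) (f : kernel b c) :
  compk h (compk g f) = compk (compk h g) f.
Proof.
apply: kernelP => x w; rewrite !compkE.
have hF : @tame (cP d c) (fun p => f (x, p.2) * g (p.2, p.1) * h (p.1, w)).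
  apply: tame_mul; last exact: (tmap_fst d c).1 (kernel_appr h w).
  apply: tame_mul; first exact: (tmap_snd d c).1 (kernel_app f x).
  exact: (tmap_swap d c).1 (kfunP g).
have := fubini_all hF; rewrite /= => e1.
transitivity (intg (fun z => intg (fun y => f (x, y) * g (y, z) * h (z, w)))).
  congr intg; apply: funext => z /=; rewrite intg_scaler //.
  exact: tame_mul (kernel_app f x) (kernel_appr g z).
rewrite e1; congr intg; apply: funext => y /=; rewrite -intg_scale.
  by congr intg; apply: funext => z; rewrite mulrA.
exact: tame_mul (kernel_app g y) (kernel_appr h w).
Qed.

Lemma compk_linl b c d a (g g' : kernel c d) (f : kernel b c) :
  compk (a *: g + g') f = a *: compk g f + compk g' f.
Proof.
apply: kernelP => x z; rewrite addkE scalekE !compkE.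
have h (k : kernel c d) : tame (fun y => f (x, y) * k (y, z)).
  exact: tame_mul (kernel_app f x) (kernel_appr k z).
rewrite -intg_scale // -intg_add //; last exact: tame_scale.
congr intg; apply: funext => y; rewrite addkE scalekE; ring.
Qed.

Lemma compk_linr b c d a (g : kernel c d) (f f' : kernel b c) :
  compk g (a *: f + f') = a *: compk g f + compk g f'.
Proof.
apply: kernelP => x z; rewrite addkE scalekE !compkE.
have h (k : kernel b c) : tame (fun y => k (x, y) * g (y, z)).
  exact: tame_mul (kernel_app k x) (kernel_appr g z).
rewrite -intg_scale // -intg_add //; last exact: tame_scale.
congr intg; apply: funext => y; rewrite addkE scalekE; ring.
Qed.

Lemma tame_gr c d (phi : El c -> El d) : tmap phi ->
  @tame (cP c d) (fun x => ind (phi x.1 = x.2)).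
Proof.
move=> h; exact: (tmap_pair (tmap_comp (tmap_fst c d) h) (tmap_snd c d)).1 (tame_eq d).
Qed.

Definition gr c d (phi : El c -> El d) (h : tmap phi) : kernel c d := Kernel (tame_gr h).

(** The transposed graph: a projection onto a summand when [phi] is the inclusion of one. *)
Definition cogr c d (phi : El c -> El d) (h : tmap phi) : kernel d c :=
  Kernel ((tmap_swap d c).1 _ (tame_gr h)).

Lemma eq_gr c d (phi psi : El c -> El d) (h : tmap phi) (k : tmap psi) :
  phi =1 psi -> gr h = gr k.
Proof. by move=> e; apply: kernelP => x y; rewrite /= e. Qed.

(** Precomposition with a graph is substitution, by the Dirac property. The coherence diagrams
    thereby become equalities of functions. *)
Lemma compk_gr c d e (phi : El c -> El d) (h : tmap phi) (k : kernel d e) x z :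
  compk k (gr h) (x, z) = k (phi x, z).
Proof. exact: (intg_dirac (phi x) (fun y => k (y, z))). Qed.

Lemma gr_compk c d e (phi : El d -> El e) (psi : El e -> El d) (h : tmap phi) (k : kernel c d) x z :
  cancel phi psi -> cancel psi phi -> compk (gr h) k (x, z) = k (x, psi z).
Proof.
move=> e1 e2; rewrite compkE -[RHS](@intg_diracr _ (psi z) (fun y => k (x, y))).
congr intg; apply: funext => y; congr (_ * _); apply: ind_iff => /=.
by split=> [<-|->]; rewrite ?e1 ?e2.
Qed.

Lemma gr_comp c d e (phi : El c -> El d) (psi : El d -> El e) (h : tmap phi) (k : tmap psi) :
  compk (gr k) (gr h) = gr (tmap_comp h k).
Proof. by apply: kernelP => x z; rewrite compk_gr. Qed.

Lemma compk1 c d (k : kernel c d) : compk k (gr (tmap_id c)) = k.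
Proof. by apply: kernelP => x z; rewrite compk_gr. Qed.

Lemma comp1k c d (k : kernel c d) : compk (gr (tmap_id d)) k = k.
Proof. by apply: kernelP => x z; rewrite (gr_compk (psi := id)). Qed.

Definition kernel_linear : rat_linear_category :=
  @RatLinearCategory code kernel (fun c => gr (tmap_id c)) compk (@comp1k) (@compk1)
    compk_assoc compk_linl compk_linr.

Lemma zero_kernelP : @is_zero_object kernel_linear c0.
Proof. by split=> d f; [apply: (@kernelP c0 d) => -[]|apply: (@kernelP d c0) => x []]. Qed.

Lemma cogr_gr c d (phi : El c -> El d) (h : tmap phi) : injective phi ->
  compk (cogr h) (gr h) = gr (tmap_id c).
Proof.
move=> inj; apply: kernelP => x z; rewrite compk_gr /=.
by apply: ind_iff; split=> [/inj|->].
Qed.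

Lemma cogr_gr0 c c' d (phi : El c -> El d) (psi : El c' -> El d) (h : tmap phi) (k : tmap psi) :
  (forall x y, phi x <> psi y) -> compk (cogr k) (gr h) = 0.
Proof.
move=> ne; apply: kernelP => x z; rewrite compk_gr /=.
by rewrite ind0 // => e; apply: ne (esym e).
Qed.

Lemma gr_cogr_in c d (phi : El c -> El d) (h : tmap phi) x w : injective phi ->
  compk (gr h) (cogr h) (phi x, w) = ind (phi x = w).
Proof.
move=> inj; rewrite compkE /= -(intg_dirac x (fun y => ind (phi y = w))).
congr intg; apply: funext => y; congr (_ * _).
by apply: ind_iff; split=> [/inj ->|->].
Qed.

Lemma gr_cogr_out c d (phi : El c -> El d) (h : tmap phi) z w : (forall x, phi x <> z) ->
  compk (gr h) (cogr h) (z, w) = 0.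
Proof.
move=> ne; rewrite compkE -[RHS](intg_cst0 c); congr intg; apply: funext => y.
by rewrite /= ind0 ?mul0r.
Qed.

Lemma gr_cogr_cover c c' d (phi : El c -> El d) (psi : El c' -> El d) (h : tmap phi) (k : tmap psi) :
  injective phi -> injective psi -> (forall x y, phi x <> psi y) ->
  (forall z, (exists x, z = phi x) \/ (exists y, z = psi y)) ->
  compk (gr h) (cogr h) + compk (gr k) (cogr k) = gr (tmap_id d).
Proof.
move=> i1 i2 ne cov; apply: kernelP => z w; rewrite addkE.
case: (cov z) => [[x ->]|[y ->]].
  by rewrite gr_cogr_in // gr_cogr_out ?addr0 // => y e; apply: ne (esym e).
by rewrite [X in X + _]gr_cogr_out ?add0r ?gr_cogr_in.
Qed.

Lemma kernel_dsum_id c d :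
  compk (gr (tmap_inl c d)) (cogr (tmap_inl c d)) +
  compk (gr (tmap_inr c d)) (cogr (tmap_inr c d)) = gr (tmap_id (cS c d)).
Proof.
apply: gr_cogr_cover => [x y []|x y []||[x|x]] //; [by left; exists x|by right; exists x].
Qed.

Lemma inl_inj c d : injective (fun x : El c => inl x : El (cS c d)).
Proof. by move=> x y []. Qed.

Lemma inr_inj c d : injective (fun x : El d => inr x : El (cS c d)).
Proof. by move=> x y []. Qed.

Lemma kernel_prl_inr c d : compk (cogr (tmap_inl c d)) (gr (tmap_inr c d)) = 0.
Proof. exact: cogr_gr0. Qed.

Lemma kernel_prr_inl c d : compk (cogr (tmap_inr c d)) (gr (tmap_inl c d)) = 0.
Proof. exact: cogr_gr0. Qed.

Definition kernel_additive : rat_additive_category :=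
  @RatAdditiveCategory kernel_linear c0 zero_kernelP cS
    (fun c d => gr (tmap_inl c d)) (fun c d => gr (tmap_inr c d))
    (fun c d => cogr (tmap_inl c d)) (fun c d => cogr (tmap_inr c d))
    (fun c d => cogr_gr (tmap_inl c d) (@inl_inj c d))
    (fun c d => cogr_gr (tmap_inr c d) (@inr_inj c d))
    kernel_prl_inr kernel_prr_inl kernel_dsum_id.

(** * The tensor product of kernels *)

Lemma tame_tens c c' d d' (f : kernel c c') (g : kernel d d') :
  @tame (cP (cP c d) (cP c' d')) (fun p => f (p.1.1, p.2.1) * g (p.1.2, p.2.2)).
Proof.
have p := tmap_fst (cP c d) (cP c' d'); have q := tmap_snd (cP c d) (cP c' d').
apply: tame_mul.
  exact: (tmap_pair (tmap_comp p (tmap_fst c d)) (tmap_comp q (tmap_fst c' d'))).1 (kfunP f).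
exact: (tmap_pair (tmap_comp p (tmap_snd c d)) (tmap_comp q (tmap_snd c' d'))).1 (kfunP g).
Qed.

Definition tensk c c' d d' (f : kernel c c') (g : kernel d d') : kernel (cP c d) (cP c' d') :=
  Kernel (tame_tens f g).

Lemma tmap_prod c c' d d' (phi : El c -> El c') (psi : El d -> El d') : tmap phi -> tmap psi ->
  @tmap (cP c d) (cP c' d') (fun x => (phi x.1, psi x.2)).
Proof.
move=> h k; exact: tmap_pair (tmap_comp (tmap_fst c d) h) (tmap_comp (tmap_snd c d) k).
Qed.

Lemma tensk_gr c c' d d' (phi : El c -> El c') (psi : El d -> El d') (h : tmap phi) (k : tmap psi) :
  tensk (gr h) (gr k) = gr (tmap_prod h k).
Proof.
apply: kernelP => -[x y] [x' y'] /=; rewrite indM; apply: ind_iff.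
by split=> [[-> ->]|[-> ->]].
Qed.

Lemma tensk_id c d : tensk (gr (tmap_id c)) (gr (tmap_id d)) = gr (tmap_id (cP c d)).
Proof. by rewrite tensk_gr; apply: eq_gr => -[]. Qed.

Lemma tensk_comp c c' c'' d d' d'' (f' : kernel c' c'') (f : kernel c c')
    (g' : kernel d' d'') (g : kernel d d') :
  tensk (compk f' f) (compk g' g) = compk (tensk f' g') (tensk f g).
Proof.
apply: kernelP => -[x y] [x' y']; rewrite compkE /= -intg_scaler; last first.
  exact: tame_mul (kernel_app f x) (kernel_appr f' x').
congr intg; apply: funext => u; rewrite -intg_scale; last first.
  exact: tame_mul (kernel_app g y) (kernel_appr g' y').
by congr intg; apply: funext => v /=; rewrite mulrACA.
Qed.

Lemma tensk_addl c c' d d' (f f' : kernel c c') (g : kernel d d') :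
  tensk (f + f') g = tensk f g + tensk f' g.
Proof. by apply: kernelP => x y; apply: mulrDl. Qed.

Lemma tensk_addr c c' d d' (f : kernel c c') (g g' : kernel d d') :
  tensk f (g + g') = tensk f g + tensk f g'.
Proof. by apply: kernelP => x y; apply: mulrDr. Qed.

Definition massoc c d e (x : (El c * El d) * El e) : El c * (El d * El e) :=
  (x.1.1, (x.1.2, x.2)).
Definition massoci c d e (x : El c * (El d * El e)) : (El c * El d) * El e :=
  ((x.1, x.2.1), x.2.2).

Lemma massocK c d e : cancel (@massoc c d e) (@massoci c d e).
Proof. by case=> [[]]. Qed.

Lemma massociK c d e : cancel (@massoci c d e) (@massoc c d e).
Proof. by case=> [? []]. Qed.

Lemma tmap_assoc c d e : @tmap (cP (cP c d) e) (cP c (cP d e)) (@massoc c d e).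
Proof.
have p := tmap_fst (cP c d) e.
exact: tmap_pair (tmap_comp p (tmap_fst c d)) (tmap_pair (tmap_comp p (tmap_snd c d)) (tmap_snd _ _)).
Qed.

Lemma tmap_associ c d e : @tmap (cP c (cP d e)) (cP (cP c d) e) (@massoci c d e).
Proof.
have q := tmap_snd c (cP d e).
exact: tmap_pair (tmap_pair (tmap_fst _ _) (tmap_comp q (tmap_fst d e))) (tmap_comp q (tmap_snd d e)).
Qed.

Lemma kernel_iso (c d : kernel_additive) (phi : El c -> El d) (psi : El d -> El c) (h : tmap phi) (k : tmap psi) :
  cancel phi psi -> cancel psi phi -> @is_iso kernel_additive c d (gr h).
Proof.
move=> e1 e2; exists (gr k); rewrite /= !gr_comp.
by split; apply: eq_gr => x /=; rewrite ?e1 ?e2.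
Qed.

Definition kernel_cat : rat_additive_sym_monoidal_category.
Proof.
refine (@RatAdditiveSymMonoidalCategory kernel_additive cP tensk tensk_id tensk_comp
  tensk_addl tensk_addr c1
  (fun c d e => gr (tmap_assoc c d e)) (fun c d e => gr (tmap_associ c d e))
  (fun c => gr (tmap_snd c1 c)) (fun c => gr (tmap_fst c c1)) (fun c d => gr (tmap_swap c d))
  _ _ _ _ _ _ _ _ _ _ _ _) => /=.
- by move=> c d e; rewrite gr_comp; apply: eq_gr; apply: massocK.
- by move=> c d e; rewrite gr_comp; apply: eq_gr; apply: massociK.
- move=> c; apply: (kernel_iso _ (@tmap_app c1 c tt)) => // -[[] x] //.
- move=> c; apply: (kernel_iso _ (@tmap_appr c c1 tt)) => // -[x []] //.
- by move=> c d; rewrite gr_comp; apply: eq_gr => -[].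
- move=> c c' d d' e e' f g h; apply: kernelP => x y.
  rewrite (@gr_compk _ (cP (cP c' d') e') (cP c' (cP d' e')) _ (@massoci c' d' e') (tmap_assoc c' d' e')).
  - by rewrite compk_gr /= mulrA.
  - exact: massocK.
  - exact: massociK.
- move=> c c' f; apply: kernelP => -[[] x] y.
  rewrite (@gr_compk _ (cP c1 c') c' snd (fun y => (tt, y))) ?compk_gr //= ?ind1 ?mul1r // => -[[]] //.
- move=> c c' f; apply: kernelP => -[x []] y.
  rewrite (@gr_compk _ (cP c' c1) c' fst (fun y => (y, tt))) ?compk_gr //= ?ind1 ?mulr1 // => -[? []] //.
- move=> c c' d d' f g; apply: kernelP => x y.
  rewrite (@gr_compk _ (cP c' d') (cP d' c') _ (fun x => (x.2, x.1)) (tmap_swap c' d')) ?compk_gr /= 1?mulrC // => -[] //.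
- by move=> b c d e; rewrite -!/(gr (tmap_id _)) !tensk_gr !gr_comp; apply: eq_gr.
- by move=> c d; rewrite !tensk_gr !gr_comp; apply: eq_gr => -[[]].
- by move=> c d e; rewrite !tensk_gr !gr_comp; apply: eq_gr => -[[]].
Defined.

Local Open Scope cat_scope.

Definition biproduct (C : rat_linear_category) (A A1 A2 : C) : Prop :=
  exists (i1 : mor A1 A) (i2 : mor A2 A) (p1 : mor A A1) (p2 : mor A A2),
    [/\ p1 \oc i1 = idm A1, p2 \oc i2 = idm A2, p2 \oc i1 = 0, p1 \oc i2 = 0 &
        i1 \oc p1 + i2 \oc p2 = idm A].

Fixpoint nsum (C : rat_additive_category) k (A : C) : C :=
  if k is k'.+1 then dsum A (nsum k' A) else zero_ob C.

(** Each snake composite is a triple integral of indicators of equality; Dirac integration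
    eliminates the variables one by one. *)
Lemma kernel_dualizable (x : kernel_cat) : dualizable x.
Proof.
pose ev : kernel (cP x x) c1 :=
  Kernel ((tmap_fst (cP x x) c1).1 _ (tame_eq x)).
pose coev : kernel c1 (cP x x) :=
  Kernel ((tmap_snd c1 (cP x x)).1 _ (tame_eq x)).
exists x, ev, coev; split; apply: kernelP.
- move=> [[] a] b; rewrite compkE.
  transitivity (@intg (cP (cP x x) x) (fun p =>
     (ind (p.1.1 = p.1.2) * ind (a = p.2)) * (ind (p.1.1 = b) * ind (p.1.2 = p.2)))).
    congr intg; apply: funext => -[[u v] w].
    rewrite compk_gr (@gr_compk _ (cP x c1) x fst (fun y => (y, tt))) //= => -[? []] //.
  transitivity (intg (fun u : El x => intg (fun v : El x => ind (u = v) *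
      (ind (u = b) * ind (v = a))))).
    rewrite [LHS]/=; congr intg; apply: funext => u; congr intg; apply: funext => v.
    rewrite -[RHS](intg_dirac a (fun w => ind (u = v) * (ind (u = b) * ind (v = w)))).
    by congr intg; apply: funext => w; ring.
  transitivity (intg (fun u : El x => ind (u = a) * ind (u = b))).
    congr intg; apply: funext => u; rewrite intg_dirac; ring.
  rewrite (intg_diracr b (fun u => ind (u = a))) /=.
  by apply: ind_iff; split=> ->.
- move=> [a []] b; rewrite compkE.
  transitivity (@intg (cP x (cP x x)) (fun p =>
     (ind (a = p.1) * ind (p.2.1 = p.2.2)) * (ind (p.1 = p.2.1) * ind (p.2.2 = b)))).
    congr intg; apply: funext => -[w [u v]].
    rewrite compk_gr (@gr_compk _ (cP c1 x) x snd (fun y => (tt, y))) //= => -[[]] //.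
  transitivity (intg (fun w : El x => intg (fun u : El x => ind (w = u) *
      (ind (a = w) * ind (u = b))))).
    rewrite [LHS]/=; congr intg; apply: funext => w; congr intg; apply: funext => u.
    rewrite -[RHS](intg_dirac u (fun v => ind (w = u) * (ind (a = w) * ind (v = b)))).
    by congr intg; apply: funext => v; ring.
  transitivity (intg (fun w : El x => ind (a = w) * ind (w = b))).
    congr intg; apply: funext => u; rewrite intg_dirac; ring.
  by rewrite (intg_dirac a (fun w => ind (w = b))).
Qed.

Lemma kernel_cat_nonzero : nonzero_category kernel_cat.
Proof.
exists c1 => -[h _]; have := h c1 (gr (tmap_id c1)).
move=> /(congr1 (fun f : kernel c1 c1 => f (tt, tt))) /=.
by rewrite ind1.
Qed.

(* The words whose first letter is one of [l 0, ..., l (k - 1)], as [k] copies of all words. *)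
Fixpoint prepend n k (l : nat -> 'I_n.+2) : El (nsum (C := kernel_cat) k (cX n)) -> word n :=
  match k return El (nsum (C := kernel_cat) k (cX n)) -> word n with
  | 0 => fun x => match x with end
  | k'.+1 => fun x => match x with inl w => l 0%N :: w | inr y => prepend (fun i => l i.+1) y end
  end.

Lemma tmap_cons n (a : 'I_n.+2) : @tmap (cX n) (cX n) (cons a).
Proof.
split=> [f [k hk]|m t [[w ->]|[e [u [j ->]]]]].
- by exists k; apply: cylindrical_cons.
- by left; exists w.
- subst m; case: j => [|j]; last by right; exists erefl, u, j.
  right; exists erefl, (u ++ [:: a]), 0%N; apply: funext => y.
  by rewrite /= !drop0 -catA.
Qed.

Lemma tmap_prepend n k (l : nat -> 'I_n.+2) : @tmap (nsum (C := kernel_cat) k (cX n)) (cX n) (prepend l).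
Proof.
elim: k l => [|k IH] l; last exact: tmap_case (tmap_cons (l 0%N)) (IH _).
by split.
Qed.

Lemma prependP n k (l : nat -> 'I_n.+2) (x : El (nsum (C := kernel_cat) k (cX n))) :
  exists2 i, (i < k)%N & exists w, prepend l x = l i :: w.
Proof.
elim: k l x => [|k IH] l; first by case.
case=> [w|y]; first by exists 0%N => //; exists w.
by have [i ik [w e]] := IH (fun i => l i.+1) y; exists i.+1 => //; exists w.
Qed.

Lemma prepend_onto n k (l : nat -> 'I_n.+2) i w : (i < k)%N ->
  exists x : El (nsum (C := kernel_cat) k (cX n)), prepend l x = l i :: w.
Proof.
elim: k l i => // k IH l [_|i ik]; first by exists (inl w).
by have [x e] := IH (fun i => l i.+1) i ik; exists (inr x).
Qed.

Lemma prepend_inj n k (l : nat -> 'I_n.+2) :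
  (forall i j, (i < k)%N -> (j < k)%N -> l i = l j -> i = j) -> injective (@prepend n k l).
Proof.
elim: k l => [|k IH] l hl; first by case.
move=> [w|x] [w'|x'] /=.
- by case=> ->.
- by have [i ik [v ->]] := prependP (fun i => l i.+1) x' => -[] /(hl 0%N i.+1) -/(_ isT ik).
- by have [i ik [v ->]] := prependP (fun i => l i.+1) x => -[] /(hl i.+1 0%N) -/(_ ik isT).
- move=> /IH -> // i j ik jk /(hl i.+1 j.+1); case/(_ ik jk) => //.
Qed.

Lemma word_biproduct n :
  @biproduct kernel_cat (cX n) (unit_ob kernel_cat) (nsum (C := kernel_cat) n.+2 (cX n)).
Proof.
pose l i : 'I_n.+2 := inord i.
pose hn : @tmap c1 (cX n) (fun=> [::]) := @tmap_cst c1 (cX n) [::].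
pose hp := tmap_prepend n.+2 l.
have ip : injective (@prepend n n.+2 l).
  by apply: prepend_inj => i j ik jk /(congr1 val); rewrite /= !inordK.
have i1 : injective (fun _ : El c1 => [::] : El (cX n)) by move=> [] [].
have ne (x : El c1) y : [::] <> @prepend n n.+2 l y.
  by have [i _ [w ->]] := prependP l y.
exists (gr hn), (gr hp), (cogr hn), (cogr hp); split.
- exact: cogr_gr.
- exact: cogr_gr.
- exact: cogr_gr0.
- by apply: cogr_gr0 => x y e; apply: (ne y x).
- apply: gr_cogr_cover => // -[|i w]; first by left; exists tt.
  right; have [x e] := prepend_onto l w (ltn_ord i).
  by exists x; rewrite e /l inord_val.
Qed.

(** * Additive operations on the Segal bar construction *)

Lemma addr_idem_eq0 (V : zmodType) (x : V) : x = x + x -> x = 0.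
Proof. by move=> /(congr1 (fun y => y - x)); rewrite addrK subrr. Qed.

Section LinearCategory.
Variable C : rat_linear_category.
Implicit Types x y z : C.

Lemma compDl x y z (g g' : mor y z) (f : mor x y) : (g + g') \oc f = g \oc f + g' \oc f.
Proof. by have := comp_linear_l 1 g g' f; rewrite !scale1r. Qed.

Lemma compDr x y z (g : mor y z) (f f' : mor x y) : g \oc (f + f') = g \oc f + g \oc f'.
Proof. by have := comp_linear_r 1 g f f'; rewrite !scale1r. Qed.

Lemma comp0l x y z (f : mor x y) : (0 : mor y z) \oc f = 0.
Proof. by apply: addr_idem_eq0; rewrite -compDl addr0. Qed.

Lemma comp0r x y z (g : mor y z) : g \oc (0 : mor x y) = 0.
Proof. by apply: addr_idem_eq0; rewrite -compDr addr0. Qed.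

Lemma zero_object_id x : idm x = 0 -> is_zero_object x.
Proof.
by move=> h; split=> y f; [rewrite -(comp_idr f)|rewrite -(comp_idl f)]; rewrite h ?comp0r ?comp0l.
Qed.

(** In a linear category a coproduct is already a biproduct. Unlike the universal property, the
    biproduct equations are visibly preserved by additive operations. *)
Lemma coproduct_projections x y s (i : mor x s) (j : mor y s) : is_coproduct i j ->
  exists (p : mor s x) (q : mor s y),
    [/\ p \oc i = idm x, q \oc j = idm y, q \oc i = 0, p \oc j = 0 & i \oc p + j \oc q = idm s].
Proof.
move=> h; have [p [[p1 p2] _]] := h x (idm x) 0; have [q [[q1 q2] _]] := h y 0 (idm y).
exists p, q; split=> //; have [r [_ u]] := h s i j.
rewrite -(u (idm s)); last by rewrite !comp_idl.
apply/esym/u; rewrite !compDl -!comp_assoc p1 q1 p2 q2 !comp_idr !comp0r.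
by rewrite addr0 add0r.
Qed.

Lemma biproduct_coproduct x y s (i : mor x s) (j : mor y s) (p : mor s x) (q : mor s y) :
  p \oc i = idm x -> q \oc j = idm y -> q \oc i = 0 -> p \oc j = 0 ->
  i \oc p + j \oc q = idm s -> is_coproduct i j.
Proof.
move=> pi qj qi pj e z f g; exists (f \oc p + g \oc q); split.
  by rewrite !compDl -!comp_assoc pi qj qi pj !comp_idr !comp0r addr0 add0r.
by move=> h [<- <-]; rewrite -!comp_assoc -compDr e comp_idr.
Qed.

Lemma segal_eq n (A B : segal_simplex C n) (e : sob A = sob B) :
  (forall p q (h : cube_le p q),
     smor B h = eq_rect (sob A) (fun s => mor (s p) (s q)) (smor A h) (sob B) e) -> A = B.
Proof.
case: A e => a1 a2 a3 a4 a5 a6 a7; case: B => b1 b2 b3 b4 b5 b6 b7 /= e.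
subst b1 => /= hB.
have e : b2 = a2.
  apply: functional_extensionality_dep => p; apply: functional_extensionality_dep => q.
  by apply: functional_extensionality_dep => h; rewrite hB.
by subst b2; congr SegalSimplex; apply: Prop_irrelevance.
Qed.

Lemma segal_zero_eq n (z : C) (A B : segal_simplex C n) : is_zero_object z ->
  (forall p, sob A p = z) -> (forall p, sob B p = z) -> A = B.
Proof.
move=> hz hA hB; have e : sob A = sob B by apply: funext => p; rewrite hA hB.
apply: (segal_eq (e := e)) => p q h.
have [h1 _] : is_zero_object (sob B p) by rewrite hB.
by rewrite (h1 _ (smor B h)); apply/esym/h1.
Qed.

Section MapSimplex.
Variables (n : nat) (D E : segal_simplex C n) (o : cube n -> C).
Variable M : forall p q, mor (sob D p) (sob D q) -> mor (sob E p) (sob E q) -> mor (o p) (o q).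
Hypothesis M_id : forall p, M (idm (sob D p)) (idm (sob E p)) = idm (o p).
Hypothesis M_comp : forall p q r (f' : mor (sob D q) (sob D r)) (f : mor (sob D p) (sob D q))
  (g' : mor (sob E q) (sob E r)) (g : mor (sob E p) (sob E q)),
  M (f' \oc f) (g' \oc g) = M f' g' \oc M f g.
Hypothesis M_add : forall p q (f f' : mor (sob D p) (sob D q)) (g g' : mor (sob E p) (sob E q)),
  M (f + f') (g + g') = M f g + M f' g'.

Let M0 p q : M (0 : mor (sob D p) (sob D q)) (0 : mor (sob E p) (sob E q)) = 0.
Proof. by apply: addr_idem_eq0; rewrite -M_add !addr0. Qed.

(** One construction for two purposes: the sum of [D] and [E], and the image of [D] under a functor,
    obtained with [E := D] and an [M] that ignores its second argument. *)
Definition map_segal : segal_simplex C n.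
Proof.
refine (@SegalSimplex C n o (fun p q h => M (smor D h) (smor E h)) _ _ _ _ _).
- by move=> p h; rewrite !smor_id M_id.
- by move=> p q r h h' h''; rewrite (smor_comp D h h') (smor_comp E h h') M_comp.
- move=> i j S h; have [d [d1 d2]] := smor_iso D h; have [e [e1 e2]] := smor_iso E h.
  by exists (M d e); rewrite -!M_comp d1 d2 e1 e2 !M_id.
- move=> i S T hS hT dST.
  have [p [q [a1 a2 a3 a4 a5]]] := coproduct_projections (@smor_sum C n D i S T hS hT dST).
  have [p' [q' [b1 b2 b3 b4 b5]]] := coproduct_projections (@smor_sum C n E i S T hS hT dST).
  apply: (@biproduct_coproduct _ _ _ _ _ (M p p') (M q q')).
  + by rewrite -M_comp a1 b1 M_id.
  + by rewrite -M_comp a2 b2 M_id.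
  + by rewrite -M_comp a3 b3 M0.
  + by rewrite -M_comp a4 b4 M0.
  + by rewrite -!M_comp -M_add a5 b5 M_id.
- move=> i; have [h1 _] := sob_zero D i; have [h2 _] := sob_zero E i.
  by apply: zero_object_id; rewrite -M_id (h1 _ (idm _)) (h2 _ (idm _)) M0.
Defined.

End MapSimplex.

(** * Chosen biproducts and replacements up to isomorphism *)

Record bip x y := Bip {
  bo : C; bi1 : mor x bo; bi2 : mor y bo; bp1 : mor bo x; bp2 : mor bo y;
  bp1i1 : bp1 \oc bi1 = idm x; bp2i2 : bp2 \oc bi2 = idm y;
  bp1i2 : bp1 \oc bi2 = 0; bp2i1 : bp2 \oc bi1 = 0;
  bipE : bi1 \oc bp1 + bi2 \oc bp2 = idm bo }.

Lemma bip_eq x y o i1 i2 p1 p2 i1' i2' p1' p2' a1 a2 a3 a4 a5 b1 b2 b3 b4 b5 :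
  i1 = i1' -> i2 = i2' -> p1 = p1' -> p2 = p2' ->
  @Bip x y o i1 i2 p1 p2 a1 a2 a3 a4 a5 = @Bip x y o i1' i2' p1' p2' b1 b2 b3 b4 b5.
Proof. by move=> *; subst; congr Bip; apply: Prop_irrelevance. Qed.

Definition msum x y x' y' (b : bip x y) (b' : bip x' y') (f : mor x x') (g : mor y y') :
    mor (bo b) (bo b') := bi1 b' \oc f \oc bp1 b + bi2 b' \oc g \oc bp2 b.

Lemma msum_id x y (b : bip x y) : msum b b (idm x) (idm y) = idm (bo b).
Proof. by rewrite /msum !comp_idr bipE. Qed.

Lemma msum_comp x y x' y' x'' y'' (b : bip x y) (b' : bip x' y') (b'' : bip x'' y'')
    (f' : mor x' x'') (f : mor x x') (g' : mor y' y'') (g : mor y y') :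
  msum b b'' (f' \oc f) (g' \oc g) = msum b' b'' f' g' \oc msum b b' f g.
Proof.
rewrite /msum !compDl !compDr -!comp_assoc.
rewrite !(comp_assoc (bp1 b')) !(comp_assoc (bp2 b')) bp1i1 bp2i2 bp1i2 bp2i1.
by rewrite !comp_idl !comp0l !comp0r addr0 add0r.
Qed.

Lemma msum_add x y x' y' (b : bip x y) (b' : bip x' y') (f f' : mor x x') (g g' : mor y y') :
  msum b b' (f + f') (g + g') = msum b b' f g + msum b b' f' g'.
Proof. by rewrite /msum !compDr !compDl addrACA. Qed.

Definition sum_family n (D E : segal_simplex C n) (b : forall p, bip (sob D p) (sob E p)) :
    segal_simplex C n :=
  @map_segal n D E (fun p => bo (b p)) (fun p q f g => msum (b p) (b q) f g)
    (fun p => msum_id (b p)) (fun p q r f' f g' g => msum_comp (b p) (b q) (b r) f' f g' g)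
    (fun p q f f' g g' => msum_add (b p) (b q) f f' g g').

Definition bip_unitl z y (hz : is_zero_object z) : bip z y.
Proof.
by refine (@Bip z y y 0 (idm y) 0 (idm y) _ _ _ _ _);
  rewrite ?comp0l ?comp0r ?comp_idl ?add0r // (hz.1 _ (idm z)).
Defined.

Definition bip_unitr x z (hz : is_zero_object z) : bip x z.
Proof.
by refine (@Bip x z x (idm x) 0 (idm x) 0 _ _ _ _ _);
  rewrite ?comp0l ?comp0r ?comp_idl ?addr0 // (hz.1 _ (idm z)).
Defined.

Lemma sum_family_unitl n (D E : segal_simplex C n) (hz : forall p, is_zero_object (sob D p)) :
  sum_family (D := D) (E := E) (fun p => bip_unitl (sob E p) (hz p)) = E.
Proof.
apply: (@segal_eq n (sum_family (D := D) (E := E) (fun p => bip_unitl (sob E p) (hz p))) E erefl) => p q h /=.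
by rewrite /msum /= !comp0r add0r comp_idl comp_idr.
Qed.

Lemma sum_family_unitr n (D E : segal_simplex C n) (hz : forall p, is_zero_object (sob E p)) :
  sum_family (D := D) (E := E) (fun p => bip_unitr (sob D p) (hz p)) = D.
Proof.
apply: (@segal_eq n (sum_family (D := D) (E := E) (fun p => bip_unitr (sob D p) (hz p))) D erefl) => p q h /=.
by rewrite /msum /= !comp0r addr0 comp_idl comp_idr.
Qed.

Record repl x := Repl {
  ro : C; rf : mor x ro; rb : mor ro x; rfK : rb \oc rf = idm x; rbK : rf \oc rb = idm ro }.

Record additive_functor := AdditiveFunctor {
  ao : C -> C; am : forall x y, mor x y -> mor (ao x) (ao y);
  am_id : forall x, am (idm x) = idm (ao x);
  am_comp : forall x y z (g : mor y z) (f : mor x y), am (g \oc f) = am g \oc am f;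
  am_add : forall x y (f g : mor x y), am (f + g) = am f + am g }.

Definition mconj (Phi : additive_functor) x y (r : repl (ao Phi x)) (s : repl (ao Phi y))
    (f : mor x y) : mor (ro r) (ro s) := rf s \oc am Phi f \oc rb r.

Lemma mconj_id Phi x (r : repl (ao Phi x)) : mconj r r (idm x) = idm (ro r).
Proof. by rewrite /mconj am_id comp_idr rbK. Qed.

Lemma mconj_comp Phi x y z (r : repl (ao Phi x)) (s : repl (ao Phi y)) (t : repl (ao Phi z))
  (g : mor y z) (f : mor x y) : mconj r t (g \oc f) = mconj s t g \oc mconj r s f.
Proof.
rewrite /mconj am_comp -!comp_assoc; congr (_ \oc (_ \oc _)).
by rewrite !comp_assoc rfK comp_idl.
Qed.

Lemma mconj_add Phi x y (r : repl (ao Phi x)) (s : repl (ao Phi y)) (f g : mor x y) :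
  mconj r s (f + g) = mconj r s f + mconj r s g.
Proof. by rewrite /mconj am_add compDr compDl. Qed.

(** The image of [D] under [Phi] with each value moved along an isomorphism, chosen separately at
    every vertex of the cube. *)
Definition conj_family Phi n (D : segal_simplex C n) (r : forall p, repl (ao Phi (sob D p))) :
    segal_simplex C n :=
  @map_segal n D D (fun p => ro (r p)) (fun p q f _ => mconj (r p) (r q) f)
    (fun p => mconj_id (r p)) (fun p q s f' f _ _ => mconj_comp (r p) (r q) (r s) f' f)
    (fun p q f f' _ _ => mconj_add (r p) (r q) f f').

End LinearCategory.

Arguments ao {C} a x.
Arguments am {C} a {x y} f.

Section Bar.
Variable C : rat_additive_category.
Let B := segal_bar C.
Let b0 : B 0 := segal_base C.
Let zP := zero_obP C.

(** Literal equality with the chosen zero object is decided classically; this is the device that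
    makes constructions strict at the base point. *)
Definition zero_rec (T : C -> Type) (t0 : T (zero_ob C)) (t : forall x, T x) x : T x :=
  match pselect (x = zero_ob C) with
  | left e => eq_rect_r T t0 e
  | right _ => t x
  end.

Lemma zero_recE (T : C -> Type) (t0 : T (zero_ob C)) t : zero_rec t0 t (zero_ob C) = t0.
Proof.
rewrite /zero_rec; case: pselect => [e|//].
by rewrite (Prop_irrelevance e erefl).
Qed.

Definition bip_dsum (x y : C) : bip x y :=
  @Bip C x y (dsum x y) (inl_ x y) (inr_ x y) (prl_ x y) (prr_ x y) (prl_inl x y) (prr_inr x y)
    (prl_inr x y) (prr_inl x y) (dsum_id x y).

(* Direct sums made strictly unital, so that base points are strict units of the sum on the bar
   construction. *)
Definition bd (x y : C) : bip x y :=
  zero_rec (T := fun x => bip x y) (bip_unitl y zP)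
    (fun x => zero_rec (T := fun y => bip x y) (bip_unitr x zP) (fun y => bip_dsum x y) y) x.

Lemma bd_unitl y : bd (zero_ob C) y = bip_unitl y zP.
Proof. exact: zero_recE. Qed.

Lemma bd_unitr x : bd x (zero_ob C) = bip_unitr x zP.
Proof.
rewrite /bd {1}/zero_rec; case: pselect => [e|_]; last exact: zero_recE.
(* For two zero arguments the left rule takes precedence; it agrees with the right one because all
   maps involved are endomorphisms of a zero object. *)
subst x; rewrite /eq_rect_r /=.
by apply: bip_eq; rewrite ?(zP.1 _ (idm _)).
Qed.

Definition bar_sum_simplex n (D : (prod_sset B B) n) : B n :=
  sum_family (D := D.1) (E := D.2) (fun p => bd (sob D.1 p) (sob D.2 p)).

Lemma bar_sum_nat m n (f : delta m n) D :
  bar_sum_simplex (smap f D) = smap f (bar_sum_simplex D).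
Proof.
by apply: (@segal_eq C m (bar_sum_simplex (smap f D)) (restrict f (bar_sum_simplex D)) erefl).
Qed.

Definition bar_sum : sset_map (prod_sset B B) B := SSetMap bar_sum_nat.

Lemma bar_sum_r n (D : B n) : bar_sum n (D, base b0 n) = D.
Proof.
rewrite /bar_sum /= /bar_sum_simplex /=.
have -> : (fun p => bd (sob D p) (zero_ob C)) = (fun p => bip_unitr (sob D p) zP).
  by apply: functional_extensionality_dep => p; apply: bd_unitr.
exact: (@sum_family_unitr C n D (base b0 n) (fun=> zP)).
Qed.

Lemma bar_sum_l n (D : B n) : bar_sum n (base b0 n, D) = D.
Proof.
rewrite /bar_sum /= /bar_sum_simplex /=.
have -> : (fun p => bd (zero_ob C) (sob D p)) = (fun p => bip_unitl (sob D p) zP).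
  by apply: functional_extensionality_dep => p; apply: bd_unitl.
exact: (@sum_family_unitl C n (base b0 n) D (fun=> zP)).
Qed.

Section Conjugation.
Variables (Phi : additive_functor C) (r : bool -> forall x, repl (ao Phi x)).
Hypothesis r0 : forall b, ro (r b (zero_ob C)) = zero_ob C.

Definition conj_segal n (D : B n) (beta : cube n -> bool) : B n :=
  conj_family (Phi := Phi) (D := D) (fun p => r (beta p) (sob D p)).

Lemma conj_segal_nat m n (f : delta m n) (D : B n) beta :
  conj_segal (smap f D) (fun p => beta (push f p)) = smap f (conj_segal D beta).
Proof.
by apply: (@segal_eq C m (conj_segal (restrict f D) _) (restrict f (conj_segal D beta)) erefl).
Qed.

(** Two families of replacements for one functor give homotopic maps: positions over 0 of the
    interval use [r false], those over 1 use [r true]. The choice depends on the position in the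
    string of isomorphisms and not on the subset. *)
Definition conj_homotopy : sset_map (prod_sset B (std_simplex 1)) B.
Proof.
refine (@SSetMap (prod_sset B (std_simplex 1)) B
  (fun n a => conj_segal a.1 (fun p => (a.2 : delta n 1) p.1 != 0 :> nat)) _).
move=> m n f [D b]; rewrite -conj_segal_nat; congr conj_segal.
by apply: funext => p; rewrite /= dcompE.
Defined.

Definition conj_map (b : bool) : sset_map B B.
Proof.
refine (@SSetMap B B (fun n D => conj_segal D (fun=> b)) _).
by move=> m n f D; rewrite -conj_segal_nat.
Defined.

Lemma conj_segal_base n beta : conj_segal (base b0 n) beta = base b0 n.
Proof. by apply: (segal_zero_eq zP) => p //=; rewrite r0. Qed.

Lemma conj_map_pointed b : pointed b0 (conj_map b).
Proof.
by have := conj_segal_base (n := 0) (fun=> b); rewrite base0.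
Qed.

Lemma conj_homotopy_pointed : pointed_homotopy b0 conj_homotopy.
Proof. by move=> n c; apply: conj_segal_base. Qed.

Lemma conj_homotopy0 n D : conj_homotopy n (D, dconst n ord0) = conj_map false n D.
Proof. by congr conj_segal; apply: funext => p /=; rewrite dconstE. Qed.

Lemma conj_homotopy1 n D : conj_homotopy n (D, dconst n ord_max) = conj_map true n D.
Proof. by congr conj_segal; apply: funext => p /=; rewrite dconstE. Qed.

End Conjugation.

End Bar.

(** * Rationality of K-theory *)

Section Rationality.
Variable C : rat_additive_sym_monoidal_category.
Let B := segal_bar C.
Let b0 : B 0 := segal_base C.
Let zP := zero_obP C.

Lemma tensm0r (x x' y y' : C) (f : mor x x') : tensm f (0 : mor y y') = 0.
Proof. by apply: addr_idem_eq0; rewrite -tensm_addr addr0. Qed.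

Lemma tensm0l (x x' y y' : C) (g : mor y y') : tensm (0 : mor x x') g = 0.
Proof. by apply: addr_idem_eq0; rewrite -tensm_addl addr0. Qed.

Lemma tens_comp_idl (A x y z : C) (g : mor y z) (f : mor x y) :
  tensm (idm A) (g \oc f) = tensm (idm A) g \oc tensm (idm A) f.
Proof. by rewrite -tensm_comp comp_idl. Qed.

Definition tens_functor (A : C) : additive_functor C :=
  @AdditiveFunctor C (fun x => tens A x) (fun x y f => tensm (idm A) f)
    (fun x => tensm_id A x) (@tens_comp_idl A) (fun x y f g => tensm_addr (idm A) f g).

Definition repl_self (x : C) : repl x :=
  @Repl C x x (idm x) (idm x) (comp_idl _) (comp_idl _).

Definition repl_zero (x : C) (hx : is_zero_object x) : repl x.
Proof.
by refine (@Repl C x (zero_ob C) 0 0 _ _); rewrite comp0l;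
  [rewrite (hx.1 _ (idm x))|rewrite (zP.1 _ (idm _))].
Defined.

Lemma tens_zero (A : C) : is_zero_object (tens A (zero_ob C)).
Proof. by apply: zero_object_id; rewrite -tensm_id (zP.1 _ (idm _)) tensm0r. Qed.

(* The functor [A (x) -], modified to preserve the zero object on the nose. *)
Definition repl_tens (A x : C) : repl (tens A x) :=
  zero_rec (T := fun x => repl (tens A x)) (repl_zero (tens_zero A))
    (fun x => repl_self (tens A x)) x.

Lemma repl_tens0 A : ro (repl_tens A (zero_ob C)) = zero_ob C.
Proof. by rewrite /repl_tens zero_recE. Qed.

Definition tens_map (A : C) : sset_map B B :=
  conj_map (Phi := tens_functor A) (fun _ => repl_tens A) false.

Lemma tens_map_pointed A : pointed b0 (tens_map A).
Proof. by apply: conj_map_pointed => _; apply: repl_tens0. Qed.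

(** The identity is the tensor functor of the unit with its values replaced along [lunit];
    naturality of [lunit] makes the conjugated morphisms the original ones. *)
Lemma tens_unit_homotopy : exists2 h, pointed_homotopy b0 h &
  (forall n b, h n (b, dconst n ord0) = tens_map (unit_ob C) n b) /\
  (forall n b, h n (b, dconst n ord_max) = b).
Proof.
pose g (x : C) := projT1 (cid (lunit_iso x)).
have hg x : g x \oc lunit x = idm _ /\ lunit x \oc g x = idm x := projT2 (cid (lunit_iso x)).
pose ru x : repl (ao (tens_functor (unit_ob C)) x) := @Repl C _ x (lunit x) (g x) (hg x).1 (hg x).2.
pose r (b : bool) := if b then ru else repl_tens (unit_ob C).
have r0 b : ro (r b (zero_ob C)) = zero_ob C by case: b => //; apply: repl_tens0.
exists (conj_homotopy r); first exact: conj_homotopy_pointed.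
split=> n D; first exact: conj_homotopy0.
rewrite conj_homotopy1.
apply: (@segal_eq C n (conj_map r true n D) D erefl) => p q h /=.
by rewrite /mconj /= lunit_nat -comp_assoc (hg _).2 comp_idr.
Qed.

Section Biproduct.
Variables (A A1 A2 : C) (i1 : mor A1 A) (i2 : mor A2 A) (p1 : mor A A1) (p2 : mor A A2).
Hypothesis p1i1 : p1 \oc i1 = idm A1.
Hypothesis p2i2 : p2 \oc i2 = idm A2.
Hypothesis p2i1 : p2 \oc i1 = 0.
Hypothesis p1i2 : p1 \oc i2 = 0.
Hypothesis ipE : i1 \oc p1 + i2 \oc p2 = idm A.

Let s1 x := repl_tens A1 x.
Let s2 x := repl_tens A2 x.
Let u1 x : mor (tens A x) (ro (s1 x)) := rf (s1 x) \oc tensm p1 (idm x).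
Let u2 x : mor (tens A x) (ro (s2 x)) := rf (s2 x) \oc tensm p2 (idm x).
Let w1 x : mor (ro (s1 x)) (tens A x) := tensm i1 (idm x) \oc rb (s1 x).
Let w2 x : mor (ro (s2 x)) (tens A x) := tensm i2 (idm x) \oc rb (s2 x).

Let mid (A' A'' x y : C) (p : mor A A') (i : mor A'' A) (f : mor x y) :
  tensm p (idm y) \oc tensm (idm A) f \oc tensm i (idm x) = tensm (p \oc i) f.
Proof. by rewrite -!tensm_comp comp_idr comp_idl comp_idr. Qed.

Let comp4 (a b c d a' b' : C) (k1 : mor b a) (k2 : mor c b) (k3 : mor d c) (k4 : mor a' d) (k5 : mor b' a') :
  k1 \oc k2 \oc k3 \oc (k4 \oc k5) = k1 \oc (k2 \oc k3 \oc k4) \oc k5.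
Proof. by rewrite !comp_assoc. Qed.

Let uw11 x y (f : mor x y) : u1 y \oc tensm (idm A) f \oc w1 x = mconj (Phi := tens_functor A1) (s1 x) (s1 y) f.
Proof. by rewrite comp4 mid p1i1. Qed.

Let uw22 x y (f : mor x y) : u2 y \oc tensm (idm A) f \oc w2 x = mconj (Phi := tens_functor A2) (s2 x) (s2 y) f.
Proof. by rewrite comp4 mid p2i2. Qed.

Let uw12 x y (f : mor x y) : u1 y \oc tensm (idm A) f \oc w2 x = 0.
Proof. by rewrite comp4 mid p1i2 tensm0l comp0r comp0l. Qed.

Let uw21 x y (f : mor x y) : u2 y \oc tensm (idm A) f \oc w1 x = 0.
Proof. by rewrite comp4 mid p2i1 tensm0l comp0r comp0l. Qed.

Let bs x := bd (ro (s1 x)) (ro (s2 x)).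
Let F x : mor (tens A x) (bo (bs x)) := bi1 (bs x) \oc u1 x + bi2 (bs x) \oc u2 x.
Let G x : mor (bo (bs x)) (tens A x) := w1 x \oc bp1 (bs x) + w2 x \oc bp2 (bs x).

Let GF x : G x \oc F x = idm (tens A x).
Proof.
rewrite /G /F !compDl !compDr -!comp_assoc.
rewrite !(comp_assoc (bp1 _)) !(comp_assoc (bp2 _)) bp1i1 bp2i2 bp1i2 bp2i1.
rewrite !comp_idl !comp0l !comp0r addr0 ?add0r /w1 /w2 /u1 /u2 /=.
rewrite !(comp_assoc (rb _)) !rfK !comp_idl -!tensm_comp comp_idl -tensm_addl ipE.
exact: tensm_id.
Qed.

(** Conjugation by the splitting is block diagonal: the mixed terms contain [p1 \oc i2] or
    [p2 \oc i1]. *)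
Let FG_f x y (f : mor x y) : F y \oc tensm (idm A) f \oc G x =
  msum (bs x) (bs y) (mconj (Phi := tens_functor A1) (s1 x) (s1 y) f)
    (mconj (Phi := tens_functor A2) (s2 x) (s2 y) f).
Proof.
rewrite /F /G !compDl !compDr (comp4 _ (u1 y) _ (w1 x)) (comp4 _ (u1 y) _ (w2 x)).
rewrite (comp4 _ (u2 y) _ (w1 x)) (comp4 _ (u2 y) _ (w2 x)) uw11 uw12 uw21 uw22.
by rewrite !comp0r !comp0l addr0 add0r.
Qed.

Let FG x : F x \oc G x = idm (bo (bs x)).
Proof.
have := FG_f (idm x).
by rewrite tensm_id comp_idr (@mconj_id _ (tens_functor A1) x (s1 x)) (@mconj_id _ (tens_functor A2) x (s2 x)) msum_id.
Qed.

(** Values of the tensor functor of [A] are replaced by the strictly unital sums of those for [A1]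
    and [A2], so that the end 1 equals the sum of the two maps and not merely an isomorphic copy. *)
Lemma tens_biproduct_homotopy : exists2 h, pointed_homotopy b0 h &
  (forall n b, h n (b, dconst n ord0) = tens_map A n b) /\
  (forall n b, h n (b, dconst n ord_max) = bar_sum C n (tens_map A1 n b, tens_map A2 n b)).
Proof.
pose rs x : repl (ao (tens_functor A) x) := @Repl C _ (bo (bs x)) (F x) (G x) (GF x) (FG x).
pose r (b : bool) := if b then rs else repl_tens A.
have r0 b : ro (r b (zero_ob C)) = zero_ob C.
  case: b; last exact: repl_tens0.
  by rewrite /= /bs /s1 /s2 !repl_tens0 bd_unitl.
exists (conj_homotopy r); first exact: conj_homotopy_pointed.
split=> n D; first exact: conj_homotopy0.
rewrite conj_homotopy1.
apply: (@segal_eq C n (conj_map r true n D)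
  (bar_sum C n (tens_map A1 n D, tens_map A2 n D)) erefl) => p q h.
exact: esym (FG_f (smor D h)).
Qed.

End Biproduct.

Theorem rational_K_theory_of_biproducts :
  (forall n, exists A : C, biproduct A (unit_ob C) (nsum n.+2 A)) -> rational_K_theory C.
Proof.
move=> hA p Y i [Hi HY].
have [V [phi [star [[ph1 ph2 ph3] stD stU stS]]]] :=
  magma_homotopy_group (@bar_sum_r C) (@bar_sum_l C) p Hi HY.
pose t A := star (tens_map A).
have tD A u v : t A (u + v) = t A u + t A v by apply: stD; apply: tens_map_pointed.
have tU v : t (unit_ob C) v = v.
  have [h hh [h0 h1]] := tens_unit_homotopy.
  by apply: (stU _ h (tens_map_pointed _) hh).
have tS A A1 A2 v : biproduct A A1 A2 -> t A v = t A1 v + t A2 v.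
  move=> [i1 [i2 [p1 [p2 [e1 e2 e3 e4 e5]]]]].
  have [h hh [h0 h1]] := tens_biproduct_homotopy e1 e2 e3 e4 e5.
  by apply: (stS _ _ _ h (tens_map_pointed _) (tens_map_pointed _) (tens_map_pointed _) hh).
have t0 v : t (zero_ob C) v = 0.
  apply: addr_idem_eq0; apply: tS.
  by exists 0, 0, 0, 0; split; rewrite ?comp0l ?addr0 //; apply: esym; apply: zP.1.
have tn A k v : t (nsum k A) v = t A v *+ k.
  elim: k => [|k IH]; first by rewrite t0.
  rewrite mulrS -IH; apply: tS; exists (inl_ _ _), (inr_ _ _), (prl_ _ _), (prr_ _ _).
  by split; [exact: prl_inl|exact: prr_inr|exact: prr_inl|exact: prl_inr|exact: dsum_id].
(* The biproduct gives [t A v = v + (n + 2) t A v], hence [- t A] inverts multiplication by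
   [n.+1]. *)
have tA n : exists2 s : V -> V, {morph s : u v / u + v} & forall v, s v *+ n.+1 = v.
  have [A hAn] := hA n; exists (fun v => - t A v) => [u v|v]; first by rewrite tD opprD.
  have := tS _ _ _ v hAn; rewrite tU tn (mulrS (t A v) n.+1) addrCA -[LHS]addr0 => /addrI /esym/eqP.
  by rewrite mulNrn addr_eq0 => /eqP e; apply: esym.
have [||W [f [f1 f2 f3]]] := @divisible_lmod V.
- by move=> n v; have [s _ hs] := tA n; exists (s v).
(* Additivity of the inverse excludes torsion: [u] equals [s (u *+ n.+1)], that is [s 0]. *)
- move=> n u hu; have [s sD hs] := tA n.
  have s0 : s 0 = 0 by apply: addr_idem_eq0; rewrite -sD addr0.
  have sn k : s (u *+ k) = s u *+ k.
    by elim: k => [|k IH]; rewrite ?s0 // !mulrS sD IH.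
  by rewrite -(hs u) -sn hu s0.
exists W, (fun y => f (phi y)); split=> [w|x y hx hy|x y z hx hy hz h].
- by have [v <-] := f2 w; have [x hx <-] := ph1 v; exists x.
- by rewrite -ph2 //; split=> [/f1|->].
- by rewrite -f3 (ph3 x y z).
Qed.

End Rationality.

Theorem corollary4p28 :
  exists C : rat_additive_sym_monoidal_category,
    nonzero_category C /\
    (forall x : C, dualizable x) /\
    rational_K_theory C.
Proof.
exists kernel_cat; split; first exact: kernel_cat_nonzero.
split; first exact: kernel_dualizable.
apply: rational_K_theory_of_biproducts => n.
by exists (cX n); apply: word_biproduct.
Qed.
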